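(* Let $G:\mathbb{C}_0^+\to\mathbb{C}$ be holomorphic and bounded, where $\mathbb{C}_0^+=\{z\in\mathbb{C}\mid \mathrm{Re}\, z>0\}$. Then $G$ has a realization as a well-posed linear system; that is, there exist a separable Hilbert space $H$, a $C_0$-semigroup $T(t)$ on $H$ with generator $A$, an admissible control operator $B\in\mathcal{L}(\mathbb{C},H_{-1})$ for $T(t)$, and an admissible observation operator $C\in\mathcal{L}(H_1,\mathbb{C})$ for $T(t)$ such that $(T,B,C,G)$ is a well-posed linear system. In particular, for some $\rho>0$, $$\frac{G(s)-G(z)}{z-s}=C(sI-A)^{-1}(zI-A)^{-1}B,\qquad s,z\in\mathbb{C}_\rho^+,\ s\neq z.$$
   Context: For $\delta\in\mathbb{R}$, $\mathbb{C}_\delta^+=\{z\in\mathbb{C}\mid \mathrm{Re}\, z>\delta\}$, and $H_\infty(\Omega)$ denotes the set of bounded holomorphic functions $\Omega\to\mathbb{C}$. Let $T(t)$ be a $C_0$-semigroup on a separable (complex) Hilbert space $H$ with generator $A$ and resolvent set $\rho(A)$; fix $\beta\in\rho(A)$. $H_1$ is $D(A)$ with the norm $\|x\|_1=\|(\beta I-A)x\|$, and $H_{-1}$ is the completion of $H$ with respect to $\|x\|_{-1}=\|(\beta I-A)^{-1}x\|$ (the topologies do not depend on $\beta$). $T(t)$ restricts to a $C_0$-semigroup on $H_1$ and extends to a $C_0$-semigroup on $H_{-1}$, whose generator is an extension of $A$ with domain $H$; the restrictions and extensions are denoted by the same symbols. In particular, for $z\in\rho(A)$, $(zI-A)^{-1}$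 is bounded from $H_{-1}$ to $H$ and from $H$ to $H_1$. Admissible control operator: $B\in\mathcal{L}(\mathbb{C},H_{-1})$ (identified with an element of $H_{-1}$) is an admissible control operator for $T(t)$ if for some (equivalently, any) $t>0$ the operator $\mathcal{B}_tu:=\int_0^tT(t-\rho)Bu(\rho)\,d\rho$, a priori mapping $L_2(0,\infty)$ into $H_{-1}$, belongs to $\mathcal{L}(L_2(0,\infty),H)$. Admissible observation operator: $C\in\mathcal{L}(H_1,\mathbb{C})$ is an admissible observation operator for $T(t)$ if for some (equivalently, any) $t>0$ there is $K>0$ with $\|CT(\cdot)x\|_{L_2(0,t)}\le K\|x\|$ for all $x\in D(A)$. Well-posed linear system: $(T,B,C,G)$ is a well-posed linear system if $T(t)$ is a $C_0$-semigroup (on a separable Hilbert space $H$, with generator $A$), $B$ is an admissible control operator for $T(t)$, $C$ is an admissible observation operator for $T(t)$, and there is a constant $\rho>0$ such that $\mathbb{C}_\rho^+\subset\rho(A)$, $G\in H_\infty(\mathbb{C}_\rho^+)$ (i.e. the restriction of $G$ to $\mathbb{C}_\rho^+$ is holomorphic and bounded), and $\frac{G(s)-G(z)}{z-s}=C(sI-A)^{-1}(zI-A)^{-1}B$ for all $s,z\in\mathbb{C}_\rho^+$, $s\ne z$. A function $G$ has a realization as a well-posed linear system if there exists a well-posed linear system $(T,B,C,G)$. *)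

(* Defs.v *)
From HB Require Import structures.
From mathcomp Require Import all_boot all_order all_algebra.
From mathcomp Require Import complex.
From mathcomp Require Import all_classical all_reals all_analysis.

Set Implicit Arguments.
Unset Strict Implicit.
Unset Printing Implicit Defensive.

Import Order.TTheory GRing.Theory Num.Theory.
Import numFieldNormedType.Exports.

Local Open Scope classical_set_scope.
Local Open Scope ring_scope.
Local Open Scope complex_scope.

(* The complex numbers are R[i] for R : realType.
   The library norm of a normed module over R[i] takes values in R[i] (in the
   nonnegative reals); [rnorm] is the same number seen in R. *)
Definition rnorm (R : realType) (V : normedZmodType R[i]) (x : V) : R :=
  complex.Re `|x|.

Definition half_plane (R : realType) (delta : R) : set R[i] :=
  [set z | delta < complex.Re z].

(* The regular module R[i]^o carries the topology of the complex plane, and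
   [derivable f z 1] there is complex differentiability of f at z. For open
   Omega this only involves the values of f on Omega. *)
Definition holomorphic_on (R : realType) (Omega : set R[i])
    (f : R[i] -> R[i]) : Prop :=
  forall z, Omega z -> derivable (f : R[i]^o -> R[i]^o) z 1.

Definition Hinfty (R : realType) (Omega : set R[i]) (f : R[i] -> R[i]) : Prop :=
  holomorphic_on Omega f /\
  exists M : R, forall z, Omega z -> rnorm (f z) <= M.

Definition is_hilbert (R : realType) (H : completeNormedModType R[i]) : Prop :=
  exists d : {dot H for Num.conj}, forall x : H, `|x| ^+ 2 = d x x.

Definition separable (T : topologicalType) : Prop :=
  exists S : set T, countable S /\ dense S.

(* Only the operators T t with 0 <= t are meaningful. *)
Definition C0_semigroup (R : realType) (H : completeNormedModType R[i])
    (T : R -> {linear H -> H}) : Prop :=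
  [/\ forall t, 0 <= t -> continuous (T t),
      forall x, T 0 x = x,
      forall s t x, 0 <= s -> 0 <= t -> T (s + t) x = T s (T t x)
    & forall x, T t x @[t --> 0^'+] --> x].

Definition generator_dom (R : realType) (H : completeNormedModType R[i])
    (T : R -> {linear H -> H}) : set H :=
  [set x | cvg ((h^-1)%:C *: (T h x - x) @[h --> (0 : R)^'+])].

(* Meaningful on [generator_dom T] only. *)
Definition generator (R : realType) (H : completeNormedModType R[i])
    (T : R -> {linear H -> H}) (x : H) : H :=
  lim ((h^-1)%:C *: (T h x - x) @[h --> (0 : R)^'+]).

(* (z I - A)^-1 for the generator A of T; meaningful for z in the resolvent
   set of A. *)
Definition resolvent (R : realType) (H : completeNormedModType R[i])
    (T : R -> {linear H -> H}) (z : R[i]) (x : H) : H :=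
  xget 0 [set y | generator_dom T y /\ z *: y - generator T y = x].

(* z I - A : D(A) -> H is bijective with bounded inverse. *)
Definition resolvent_set (R : realType) (H : completeNormedModType R[i])
    (T : R -> {linear H -> H}) : set R[i] :=
  [set z | (forall x, exists! y,
              generator_dom T y /\ z *: y - generator T y = x) /\
           continuous (resolvent T z)].

(* (Hm1, iota) is a completion of H for the norm x |-> |(beta I - A)^-1 x|. *)
Definition is_Hm1 (R : realType) (H : completeNormedModType R[i])
    (T : R -> {linear H -> H}) (beta : R[i])
    (Hm1 : completeNormedModType R[i]) (iota : {linear H -> Hm1}) : Prop :=
  (forall x, `|iota x| = `|resolvent T beta x|) /\ dense (range iota).

(* The extension of f : H -> V to a bounded operator Hm1 -> V along the dense
   embedding iota. It is unique when it exists (0 is a dummy value). *)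
Definition extension (R : realType) (H Hm1 V : completeNormedModType R[i])
    (iota : {linear H -> Hm1}) (f : H -> V) : Hm1 -> V :=
  xget (fun=> 0)
    [set F | [/\ linear F, continuous F & forall x, F (iota x) = f x]].

Definition semigroup_m1 (R : realType) (H Hm1 : completeNormedModType R[i])
    (iota : {linear H -> Hm1}) (T : R -> {linear H -> H}) (t : R) : Hm1 -> Hm1 :=
  extension iota (fun x => iota (T t x)).

Definition resolvent_m1 (R : realType) (H Hm1 : completeNormedModType R[i])
    (iota : {linear H -> Hm1}) (T : R -> {linear H -> H}) (z : R[i]) : Hm1 -> H :=
  extension iota (resolvent T z).

(* A list of pairs (E, v) encodes the simple function sum of 1_E v. *)
Definition simple_fun (R : realType) (V : normedModType R[i])
    (s : seq (set R * V)) (x : R) : V :=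
  \sum_(p <- s) (\1_(p.1) x : R)%:C *: p.2.

Definition simple_int (R : realType) (V : normedModType R[i])
    (s : seq (set R * V)) : V :=
  \sum_(p <- s) (fine (lebesgue_measure p.1))%:C *: p.2.

(* f is Bochner integrable over D (Lebesgue measure) with integral y. L^1
   convergence of the simple functions s n to f implies a.e. convergence of a
   subsequence, hence strong measurability of f. *)
Definition is_bochner_integral (R : realType) (V : normedModType R[i])
    (D : set R) (f : R -> V) (y : V) : Prop :=
  exists s : nat -> seq (set R * V),
    [/\ forall n p, p \in s n ->
          [/\ measurable p.1, p.1 `<=` D & (lebesgue_measure p.1 < +oo)%E],
        forall n, measurable_fun D (fun x => rnorm (f x - simple_fun (s n) x)),
        (\int[lebesgue_measure]_(x in D)
           (rnorm (f x - simple_fun (s n) x))%:E)%E @[n --> \oo] --> 0%E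
      & simple_int (s n) @[n --> \oo] --> y].

Definition L2norm (R : realType) (D : set R) (f : R -> R[i]) : \bar R :=
  ('N[lebesgue_measure]_2%:E [(fun x => (rnorm (f x))%:E) \_ D])%E.

(* An element of L_2(0, oo) is given by a Borel measurable representative u
   (every class has one); the values of u outside ]0, +oo[ are irrelevant. *)
Definition L2_pos (R : realType) (u : R -> R[i]) : Prop :=
  [/\ measurable_fun (`]0, +oo[ : set R) (fun x => complex.Re (u x)),
      measurable_fun (`]0, +oo[ : set R) (fun x => complex.Im (u x))
    & (L2norm `]0%R, +oo[ u < +oo)%E].

(* B in L(CC, H_{-1}) is identified with its value at 1. *)
Definition admissible_control (R : realType)
    (H Hm1 : completeNormedModType R[i]) (iota : {linear H -> Hm1})
    (T : R -> {linear H -> H}) (B : Hm1) : Prop :=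
  exists t : R, 0 < t /\ exists K : R, forall u, L2_pos u ->
    exists y : H,
      is_bochner_integral `]0, t[
        (fun r => u r *: semigroup_m1 iota T (t - r) B) (iota y) /\
      ((rnorm y)%:E <= K%:E * L2norm `]0%R, +oo[ u)%E.

(* C in L(H_1, CC): H_1 is the domain of A normed by |(beta I - A) x|, so C is
   a function on H whose values matter on the domain of A only. *)
Definition H1_functional (R : realType) (H : completeNormedModType R[i])
    (T : R -> {linear H -> H}) (beta : R[i]) (C : H -> R[i]) : Prop :=
  (forall (a : R[i]) x y, generator_dom T x -> generator_dom T y ->
     C (a *: x + y) = a * C x + C y) /\
  exists M : R, forall x, generator_dom T x ->
    rnorm (C x) <= M * rnorm (beta *: x - generator T x).

Definition admissible_observation (R : realType)
    (H : completeNormedModType R[i]) (T : R -> {linear H -> H})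
    (C : H -> R[i]) : Prop :=
  exists t : R, 0 < t /\ exists K : R, 0 < K /\
    forall x, generator_dom T x ->
      (L2norm `]0%R, t[ (fun r => C (T r x)) <= (K * rnorm x)%:E)%E.

Definition well_posed_linear_system (R : realType)
    (H : completeNormedModType R[i]) (T : R -> {linear H -> H}) (beta : R[i])
    (Hm1 : completeNormedModType R[i]) (iota : {linear H -> Hm1})
    (B : Hm1) (C : H -> R[i]) (G : R[i] -> R[i]) : Prop :=
  [/\ [/\ is_hilbert H, separable H & C0_semigroup T],
      resolvent_set T beta /\ is_Hm1 T beta iota,
      admissible_control iota T B,
      H1_functional T beta C /\ admissible_observation T C
    & exists rho : R, 0 < rho /\
        [/\ half_plane rho `<=` resolvent_set T,
            Hinfty (half_plane rho) G
          & forall s z, half_plane rho s -> half_plane rho z -> s != z ->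
              (G s - G z) / (z - s)
              = C (resolvent T s (resolvent_m1 iota T z B))]].

(* Main.v *)
From HB Require Import structures.
Require Import Defs.
From mathcomp Require Import all_boot all_order all_algebra.
From mathcomp Require Import complex.
From mathcomp Require Import all_classical all_reals all_analysis.
From mathcomp Require Import measurable_realfun.
From mathcomp Require Import ring lra.

(** The realization consists of multiplication operators on L2 of the real
    line. Put a(w) = 1 + iw and let A be multiplication by a; then T(t) is
    multiplication by exp (t a), and (z - A)^-1 is multiplication by 1 / (z - a)
    whenever Re z > 1. Take for B the function G(a), an element of H_{-1}, and
    for C the functional mapping x to the integral of x over the line, divided
    by 2 pi. Then C (s - A)^-1 (z - A)^-1 B is the absolutely convergent integral
    of G(a) / ((s - a) (z - a)) over the line, divided by 2 pi, and Cauchy's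
    formula on the line Re = 1, [cauchy_line], evaluates it as
    (G(s) - G(z)) / (z - s) for s and z to the right of Re = 2. This formula
    follows from Goursat's lemma on large boxes to the right of the line.

    Admissibility is one half of Plancherel's theorem, [plancherel_le]. Up to
    time tau = 2 pi an input u is mapped to the function G(a) v, where v(w) is the
    integral of exp ((tau - r) a(w)) u(r) for r from 0 to tau, a Fourier
    transform of u with a bounded weight; G is bounded, and the norm of v is at
    most a multiple of that of u, by Bessel's inequality for Fourier series on a
    period. That the vector-valued integral of the orbit is multiplication by v
    is [bochner_orbit]; as simple integrals of orbits are themselves
    multiplications, it reduces to scalar integrals. The bound on the output is
    the dual statement, [observation_bound].

    The Hilbert space is the completion of the continuous square-integrable
    functions. An element of the completion is represented by the functional
    that it induces on these functions, so that an operator acts by composition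
    with its adjoint on functions, [mult], and identities between operators
    become pointwise identities of functions. Strong convergence of operators,
    hence continuity of the semigroup and the computation of its generator,
    is dominated convergence, [mult_cvg]. The space H_{-1} is the same Hilbert
    space with (2 - A)^-1 as the embedding of H, [embm1], whence B is represented
    by G(a) / (2 - a) and C is the pairing of (2 - A) x with a multiple of the
    complex conjugate of 1 / (2 - a). *)

Set Implicit Arguments.
Unset Strict Implicit.
Unset Printing Implicit Defensive.

Import Order.TTheory GRing.Theory Num.Theory.
Import numFieldNormedType.Exports.

Local Open Scope classical_set_scope.
Local Open Scope ring_scope.
Local Open Scope complex_scope.

Local Notation Re := complex.Re.
Local Notation Im := complex.Im.
Local Notation "x ^*" := (conjc x) : ring_scope.

(** * The real-valued norm of complex normed spaces *)

Section RealValuedNorm.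
Variable R : realType.
Local Notation C := R[i].

Lemma ReD (x y : C) : Re (x + y) = Re x + Re y.
Proof. by case: x; case: y. Qed.
Lemma ImD (x y : C) : Im (x + y) = Im x + Im y.
Proof. by case: x; case: y. Qed.
Lemma ReN (x : C) : Re (- x) = - Re x.
Proof. by case: x. Qed.
Lemma ImN (x : C) : Im (- x) = - Im x.
Proof. by case: x. Qed.
Lemma ReM (x y : C) : Re (x * y) = Re x * Re y - Im x * Im y.
Proof. by case: x; case: y. Qed.
Lemma ImM (x y : C) : Im (x * y) = Re x * Im y + Im x * Re y.
Proof. by case: x => a b; case: y => c d /=; rewrite [b * c]mulrC. Qed.
Lemma ReJ (x : C) : Re x^* = Re x.
Proof. by case: x. Qed.
Lemma ImJ (x : C) : Im x^* = - Im x.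
Proof. by case: x. Qed.
Lemma complex_ext (x y : C) : Re x = Re y -> Im x = Im y -> x = y.
Proof. by case: x => a b; case: y => c d /= -> ->. Qed.

Lemma neq_Re (x y : C) : Re x != Re y -> x != y.
Proof. by apply: contra_neq => ->. Qed.
Lemma neq_Im (x y : C) : Im x != Im y -> x != y.
Proof. by apply: contra_neq => ->. Qed.

Section AnyGroup.
Variable V : normedZmodType C.
Implicit Types x y : V.

Lemma rnormE x : `|x| = (rnorm x)%:C.
Proof. by rewrite /rnorm RRe_real// normr_real. Qed.

Lemma rnorm_ge0 x : 0 <= rnorm x.
Proof. by rewrite -ler0c -rnormE. Qed.

Lemma rnormD x y : rnorm (x + y) <= rnorm x + rnorm y.
Proof. by rewrite -lecR rmorphD /= -!rnormE ler_normD. Qed.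

Lemma rnormN x : rnorm (- x) = rnorm x.
Proof. by rewrite /rnorm normrN. Qed.

Lemma rnormB x y : rnorm (x - y) <= rnorm x + rnorm y.
Proof. by rewrite -(rnormN y) rnormD. Qed.

Lemma rnorm_distC x y : rnorm (x - y) = rnorm (y - x).
Proof. by rewrite -rnormN opprB. Qed.

Lemma rnorm0 : rnorm (0 : V) = 0.
Proof. by rewrite /rnorm normr0. Qed.

Lemma rnorm_eq0 x : rnorm x = 0 -> x = 0.
Proof. by move=> x0; apply/normr0_eq0; rewrite rnormE x0. Qed.

Lemma ler_rnormBD x y z : rnorm (x - z) <= rnorm (x - y) + rnorm (y - z).
Proof. by rewrite -[x - z](subrKA y) rnormD. Qed.

Lemma ler_rdist x y : `|rnorm x - rnorm y| <= rnorm (x - y).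
Proof.
have := rnormD (x - y) y; have := rnormD (y - x) x.
rewrite !subrK (rnorm_distC y x) ler_norml => h1 h2.
by apply/andP; split; lra.
Qed.

End AnyGroup.

Lemma rnormM (x y : C) : rnorm (x * y) = rnorm x * rnorm y.
Proof. by apply: complexI; rewrite rmorphM /= -!rnormE normrM. Qed.

Lemma rnormZ (V : normedModType C) (a : C) (x : V) :
  rnorm (a *: x) = rnorm a * rnorm x.
Proof. by apply: complexI; rewrite rmorphM /= -!rnormE normrZ. Qed.

Lemma rnormV (x : C) : rnorm x^-1 = (rnorm x)^-1.
Proof.
by apply: complexI; rewrite fmorphV /= -!rnormE normfV.
Qed.

Lemma rnormJ (x : C) : rnorm x^* = rnorm x.
Proof. by rewrite /rnorm normcJ. Qed.

Lemma rnorm1 : rnorm (1 : C) = 1.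
Proof. by rewrite /rnorm normr1. Qed.

Lemma rnorm_sqr (x : C) : rnorm x ^+ 2 = Re x ^+ 2 + Im x ^+ 2.
Proof. by apply: complexI; rewrite add_Re2_Im2 rnormE rmorphXn. Qed.

Lemma rnormC (x : C) : rnorm x = Num.sqrt (Re x ^+ 2 + Im x ^+ 2).
Proof. by rewrite -rnorm_sqr sqrtr_sqr ger0_norm ?rnorm_ge0. Qed.

Lemma rnorm_real (x : R) : rnorm (x%:C : C) = `|x|.
Proof. by rewrite rnormC /= [0 ^+ 2]expr0n /= addr0 sqrtr_sqr. Qed.

Lemma ler_Re (x : C) : `|Re x| <= rnorm x.
Proof. by rewrite rnormC -sqrtr_sqr ler_wsqrtr// lerDl sqr_ge0. Qed.

Lemma ler_Im (x : C) : `|Im x| <= rnorm x.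
Proof. by rewrite rnormC -sqrtr_sqr ler_wsqrtr// lerDr sqr_ge0. Qed.

Lemma rnorm_le (x : C) : rnorm x <= `|Re x| + `|Im x|.
Proof.
rewrite -(@ler_pXn2r _ 2) ?nnegrE ?rnorm_ge0 ?addr_ge0//.
rewrite rnorm_sqr sqrrD !real_normK ?num_real//.
by rewrite -addrA lerD2l lerDr mulrn_wge0// mulr_ge0.
Qed.

Lemma mulcJ (x : C) : x * x^* = (rnorm x ^+ 2)%:C.
Proof. by rewrite -sqr_normc rnormE rmorphXn. Qed.

Lemma rnorm_neq0 (x : C) : x != 0 -> 0 < rnorm x.
Proof.
move=> x0; rewrite lt_neqAle rnorm_ge0 andbT eq_sym.
by apply: contra_neq x0 => /rnorm_eq0.
Qed.

(** The norm of a module over the complex numbers is complex valued, so its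
    topology is read off through real radii once and for all here. *)
Lemma rcvgP (V : normedModType C) (T : Type) (F : set_system T)
    (FF : Filter F) (f : T -> V) (l : V) :
  f @ F --> l <-> (fun x => rnorm (f x - l)) @ F --> (0 : R).
Proof.
split=> [/cvgrPdist_lt fl|/cvgrPdist_lt fl].
  apply/cvgrPdist_lt => e e0.
  have := fl e%:C; rewrite ltcR => /(_ e0).
  apply: filterS => x; rewrite rnormE ltcR rnorm_distC.
  by rewrite sub0r normrN ger0_norm// rnorm_ge0.
apply/cvgrPdist_lt => e e0.
have e0' : 0 < Re e by move: e0; rewrite ltcE => /andP[].
have -> : e = (Re e)%:C by rewrite RRe_real// gtr0_real.
have := fl _ e0'; apply: filterS => x.
by rewrite rnormE ltcR rnorm_distC sub0r normrN ger0_norm// rnorm_ge0.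
Qed.

Lemma rballP (V : normedModType C) (x y : V) (e : R) :
  ball x e%:C y <-> rnorm (x - y) < e.
Proof. by rewrite -ball_normE /ball_ /= rnormE ltcR. Qed.

(** The limit keeps the rate r, which is what pointwise limits of functionals
    need in order to be approximable again. *)
Lemma complex_limit (c : nat -> C) (r : nat -> R) :
  (forall m n, rnorm (c m - c n) <= r m + r n) ->
  r @ \oo --> (0 : R) -> exists l, forall n, rnorm (l - c n) <= r n.
Proof.
move=> cr r0.
have cv (f : C -> R) : (forall x y, `|f x - f y| <= rnorm (x - y)) ->
    cvgn (fun n => f (c n)).
  move=> lip; apply/cauchy_cvgP/cauchy_ballP => e e0.
  have e2 : 0 < e / 2 by rewrite divr_gt0.
  move/cvgrPdist_lt : (r0) => /(_ _ e2) [N _ hN].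
  exists ([set f (c n) | n in [set n | (N <= n)%N]], [set f (c n) | n in [set n | (N <= n)%N]]).
    by split; exists N => // n Nn; exists n.
  move=> [x y] [[m Nm <-] [n Nn <-]] /=; rewrite /ball /=.
  have := hN m Nm; have := hN n Nn; rewrite !sub0r !normrN => h1 h2.
  rewrite (le_lt_trans (lip _ _))// (le_lt_trans (cr _ _))//.
  have := ler_norm (r m); have := ler_norm (r n); lra.
have cR : cvgn (fun n => Re (c n)).
  by apply: cv => x y; rewrite -ReN -ReD ler_Re.
have cI : cvgn (fun n => Im (c n)).
  by apply: cv => x y; rewrite -ImN -ImD ler_Im.
exists (limn (fun n => Re (c n)) +i* limn (fun n => Im (c n))) => n.
set l := _ +i* _.
have lim0 : rnorm (c m - l) @[m --> \oo] --> (0 : R).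
  apply: (@squeeze_cvgr _ _ _ _ (fun=> 0) (fun m =>
     `|Re (c m) - limn (fun n => Re (c n))| + `|Im (c m) - limn (fun n => Im (c n))|)).
  - by apply: nearW => m; rewrite rnorm_ge0 /= (le_trans (rnorm_le _))// ReD ImD ReN ImN.
  - exact: cvg_cst.
  - rewrite -[X in _ --> X](addr0 0); apply: cvgD.
      by rewrite -(normr0 R); apply: cvg_norm; rewrite -(subrr (limn (fun n => Re (c n))));
        apply: cvgB cR (cvg_cst _).
    by rewrite -(normr0 R); apply: cvg_norm; rewrite -(subrr (limn (fun n => Im (c n))));
        apply: cvgB cI (cvg_cst _).
have lim1 : rnorm (c m - l) + (r m + r n) @[m --> \oo] --> 0 + (0 + r n).
  by apply: cvgD => //; apply: cvgD => //; exact: cvg_cst.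
rewrite !add0r in lim1.
apply: ler_cvg_to (cvg_cst _) lim1 _; apply: nearW => m.
by rewrite (le_trans (ler_rnormBD _ (c m) _))// (rnorm_distC l) lerD.
Qed.

(* Strict bounds with an error 1 / (n + 1) are what density provides. *)
Lemma harmonic_le (x y K : R) : (forall n, x <= y + K * n.+1%:R^-1) -> x <= y.
Proof.
move=> h; have c : y + K * n.+1%:R^-1 @[n --> \oo] --> y + K * 0.
  by apply: cvgD; [exact: cvg_cst|apply: cvgM; [exact: cvg_cst|exact: cvg_harmonic]].
rewrite mulr0 addr0 in c.
by apply: ler_cvg_to (cvg_cst _) c _; apply: nearW.
Qed.

End RealValuedNorm.

(** * Integration of complex-valued functions of a real variable *)

Section ComplexIntegral.
Variable R : realType.
Local Notation C := R[i].
Local Notation mu := (@lebesgue_measure R).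
Implicit Types (D : set R) (f g : R -> C) (h : R -> R).

(** Measurability, integrals and continuity are taken componentwise, so that
    the theory of real-valued functions applies. *)
Definition cmeasurable D f :=
  measurable_fun D (fun x => Re (f x)) /\ measurable_fun D (fun x => Im (f x)).

Definition rintegrable D h := mu.-integrable D (fun x => (h x)%:E).

Definition cintegrable D f :=
  rintegrable D (fun x => Re (f x)) /\ rintegrable D (fun x => Im (f x)).

Definition rint D h : R := (\int[mu]_(x in D) h x)%R.

Definition cint D f : C :=
  rint D (fun x => Re (f x)) +i* rint D (fun x => Im (f x)).

Lemma measurable_rnorm D f : cmeasurable D f ->
  measurable_fun D (fun x => rnorm (f x)).
Proof.
move=> [mr mi].
have -> : (fun x => rnorm (f x)) =
    Num.sqrt \o (fun x => Re (f x) ^+ 2 + Im (f x) ^+ 2).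
  by apply/funext => x /=; rewrite rnormC.
apply: measurableT_comp.
  by apply: continuous_measurable_fun; exact: sqrt_continuous.
by apply: measurable_funD; apply: measurable_funX.
Qed.

Lemma cmeasurableD D f g : cmeasurable D f -> cmeasurable D g ->
  cmeasurable D (fun x => f x + g x).
Proof.
move=> [f1 f2] [g1 g2]; split.
  by under eq_fun do rewrite ReD; exact: measurable_funD.
by under eq_fun do rewrite ImD; exact: measurable_funD.
Qed.

Lemma cmeasurableM D f g : cmeasurable D f -> cmeasurable D g ->
  cmeasurable D (fun x => f x * g x).
Proof.
move=> [f1 f2] [g1 g2]; split.
  by under eq_fun do rewrite ReM; apply: measurable_funB; exact: measurable_funM.
by under eq_fun do rewrite ImM; apply: measurable_funD; exact: measurable_funM.
Qed.

Lemma cmeasurableJ D f : cmeasurable D f -> cmeasurable D (fun x => (f x)^*).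
Proof.
move=> [f1 f2]; split; first by under eq_fun do rewrite ReJ.
by under eq_fun do rewrite ImJ; exact: measurable_funN.
Qed.

Lemma cmeasurable_cst D (c : C) : cmeasurable D (fun=> c).
Proof. by split; exact: measurable_cst. Qed.

Lemma cmeasurable_real D h : measurable_fun D h ->
  cmeasurable D (fun x => (h x)%:C).
Proof. by split => //; exact: measurable_cst. Qed.

Lemma cmeasurableN D f : cmeasurable D f -> cmeasurable D (fun x => - f x).
Proof.
move=> mf; have := cmeasurableM (cmeasurable_cst D (-1)) mf.
by under [X in cmeasurable _ X]eq_fun do rewrite mulN1r.
Qed.

Lemma cmeasurableB D f g : cmeasurable D f -> cmeasurable D g ->
  cmeasurable D (fun x => f x - g x).
Proof. by move=> mf mg; apply: cmeasurableD => //; exact: cmeasurableN. Qed.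

Lemma measurable_line : measurable [set: R].
Proof. exact: measurableT. Qed.

Section FixedDomain.
Variables (D : set R) (mD : measurable D).

Lemma le_rintegrable h k : measurable_fun D h -> rintegrable D k ->
  (forall x, D x -> `|h x| <= k x) -> rintegrable D h.
Proof.
move=> mh ik hk; apply: le_integrable ik => //; first exact/measurable_EFinP.
move=> x Dx /=; rewrite lee_fin (le_trans (hk _ Dx))//.
by rewrite ger0_norm// (le_trans _ (hk _ Dx)).
Qed.

Lemma cintegrable_cmeasurable f : cintegrable D f -> cmeasurable D f.
Proof.
by move=> [/integrableP[/measurable_EFinP h1 _] /integrableP[/measurable_EFinP]].
Qed.

Lemma cintegrable_le f k : cmeasurable D f -> rintegrable D k ->
  (forall x, D x -> rnorm (f x) <= k x) -> cintegrable D f.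
Proof.
move=> [m1 m2] ik fk; split; apply: le_rintegrable ik _ => // x Dx.
  by rewrite (le_trans (ler_Re _))// fk.
by rewrite (le_trans (ler_Im _))// fk.
Qed.

Lemma rintegrableD h k : rintegrable D h -> rintegrable D k ->
  rintegrable D (fun x => h x + k x).
Proof. by move=> ih ik; exact: (@integrableD _ _ _ mu D mD _ _ ih ik). Qed.

Lemma rintegrableZ r h : rintegrable D h -> rintegrable D (fun x => r * h x).
Proof.
by move=> ih; exact: (@integrableZl _ _ _ mu D mD r _ ih).
Qed.

Lemma rintegrableN h : rintegrable D h -> rintegrable D (fun x => - h x).
Proof. by move=> /(rintegrableZ (-1)); under eq_fun do rewrite mulN1r. Qed.

Lemma rintegrableB h k : rintegrable D h -> rintegrable D k ->
  rintegrable D (fun x => h x - k x).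
Proof. by move=> ih ik; apply: rintegrableD => //; exact: rintegrableN. Qed.

Lemma rintegrable_abs h : rintegrable D h -> rintegrable D (fun x => `|h x|).
Proof. by move=> /integrable_norm. Qed.

Lemma rintegrable0 : rintegrable D (fun=> 0).
Proof. exact: integrable0. Qed.

Lemma cintegrable_rnorm f : cintegrable D f ->
  rintegrable D (fun x => rnorm (f x)).
Proof.
move=> fi; have [m1 m2] := cintegrable_cmeasurable fi; case: fi => i1 i2.
apply: (@le_rintegrable _ (fun x => `|Re (f x)| + `|Im (f x)|)).
- exact: measurable_rnorm.
- by apply: rintegrableD; exact: rintegrable_abs.
- by move=> x _; rewrite ger0_norm ?rnorm_ge0 ?rnorm_le.
Qed.

Lemma cintegrableD f g : cintegrable D f -> cintegrable D g ->
  cintegrable D (fun x => f x + g x).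
Proof.
move=> [f1 f2] [g1 g2]; split; rewrite /rintegrable.
  by under eq_fun do rewrite ReD; exact: rintegrableD.
by under eq_fun do rewrite ImD; exact: rintegrableD.
Qed.

Lemma cintegrableZ (c : C) f : cintegrable D f -> cintegrable D (fun x => c * f x).
Proof.
move=> fi; apply: (@cintegrable_le _ (fun x => rnorm c * rnorm (f x))).
- by apply: cmeasurableM (cintegrable_cmeasurable fi); exact: cmeasurable_cst.
- exact/rintegrableZ/cintegrable_rnorm.
- by move=> x _; rewrite rnormM.
Qed.

Lemma cintegrableB f g : cintegrable D f -> cintegrable D g ->
  cintegrable D (fun x => f x - g x).
Proof.
move=> fi /(cintegrableZ (-1)) gi; have := cintegrableD fi gi.
by under [X in cintegrable _ X]eq_fun do rewrite mulN1r.
Qed.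

Lemma cintegrable0 : cintegrable D (fun=> 0).
Proof. by split; exact: rintegrable0. Qed.

Lemma rintD h k : rintegrable D h -> rintegrable D k ->
  rint D (fun x => h x + k x) = rint D h + rint D k.
Proof. by move=> ih ik; exact: RintegralD. Qed.

Lemma rintB h k : rintegrable D h -> rintegrable D k ->
  rint D (fun x => h x - k x) = rint D h - rint D k.
Proof. by move=> ih ik; exact: RintegralB. Qed.

Lemma rintZ r h : rintegrable D h -> rint D (fun x => r * h x) = r * rint D h.
Proof. by move=> ih; exact: RintegralZl. Qed.

Lemma rint0 : rint D (fun=> 0) = 0.
Proof. by rewrite /rint Rintegral_cst// mul0r. Qed.

Lemma le_rint h k : rintegrable D h -> rintegrable D k ->
  (forall x, D x -> h x <= k x) -> rint D h <= rint D k.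
Proof. by move=> ih ik hk; exact: (@le_Rintegral _ _ _ mu D). Qed.

Lemma eq_rint h k : (forall x, D x -> h x = k x) -> rint D h = rint D k.
Proof. by move=> hk; apply: eq_Rintegral => x; rewrite inE; exact: hk. Qed.

Lemma eq_cint f g : (forall x, D x -> f x = g x) -> cint D f = cint D g.
Proof.
by move=> fg; apply: complex_ext => /=; apply: eq_rint => x Dx; rewrite fg.
Qed.

Lemma eq_cintegrable f g : (forall x, D x -> f x = g x) ->
  cintegrable D f -> cintegrable D g.
Proof.
by move=> fg [h1 h2]; split; [move: h1|move: h2]; apply: eq_integrable => // x;
  rewrite inE => Dx; rewrite fg.
Qed.

Lemma rint_ge0 h : (forall x, D x -> 0 <= h x) -> 0 <= rint D h.
Proof. exact: (@Rintegral_ge0 _ _ _ mu D h). Qed.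

Lemma rintE h : rintegrable D h ->
  (\int[mu]_(x in D) (h x)%:E)%E = (rint D h)%:E.
Proof. by move=> ih; rewrite fineK//; exact: integrable_fin_num. Qed.

Lemma cintD f g : cintegrable D f -> cintegrable D g ->
  cint D (fun x => f x + g x) = cint D f + cint D g.
Proof.
move=> [f1 f2] [g1 g2]; apply: complex_ext; rewrite ?(ReD, ImD) /= -rintD//.
  by apply: eq_rint => x _; rewrite ReD.
by apply: eq_rint => x _; rewrite ImD.
Qed.

Lemma cintZ (c : C) f : cintegrable D f ->
  cint D (fun x => c * f x) = c * cint D f.
Proof.
move=> [f1 f2]; apply: complex_ext; rewrite ?(ReM, ImM) /= -!rintZ//.
  rewrite -rintB; [|exact: rintegrableZ..].
  by apply: eq_rint => x _; rewrite ReM.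
rewrite -rintD; [|exact: rintegrableZ..].
by apply: eq_rint => x _; rewrite ImM.
Qed.

Lemma cintN f : cintegrable D f -> cint D (fun x => - f x) = - cint D f.
Proof.
by move=> fi; rewrite -mulN1r -cintZ//; apply: eq_cint => x _; rewrite mulN1r.
Qed.

Lemma cintB f g : cintegrable D f -> cintegrable D g ->
  cint D (fun x => f x - g x) = cint D f - cint D g.
Proof.
move=> fi gi; rewrite -cintN// -cintD//.
have := cintegrableZ (-1) gi.
by under [X in cintegrable _ X]eq_fun do rewrite mulN1r.
Qed.

Lemma cint0 : cint D (fun=> 0) = 0.
Proof. by rewrite /cint rint0. Qed.

Lemma cintJ f : cintegrable D f -> cint D (fun x => (f x)^*) = (cint D f)^*.
Proof.
move=> [f1 f2]; apply: complex_ext => /=.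
  by apply: eq_rint => x _; rewrite ReJ.
by rewrite -mulN1r -rintZ//; apply: eq_rint => x _; rewrite ImJ mulN1r.
Qed.

Lemma cint_real h : cint D (fun x => (h x)%:C) = (rint D h)%:C.
Proof. by apply: complex_ext => //=; rewrite rint0. Qed.

Lemma cintegrable_real h : rintegrable D h -> cintegrable D (fun x => (h x)%:C).
Proof. by move=> ih; split => //=; exact: rintegrable0. Qed.

(* Rotating the integral onto the positive half-line reduces the bound to
   the real part of a rotated integrand. *)
Lemma rnorm_cint f : cintegrable D f ->
  rnorm (cint D f) <= rint D (fun x => rnorm (f x)).
Proof.
move=> fi; have [->|c0] := eqVneq (cint D f) 0.
  by rewrite rnorm0 rint_ge0// => x _; exact: rnorm_ge0.
set c := cint D f in c0 *.
have n0 := rnorm_neq0 c0.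
rewrite -(ler_pM2l n0) -rintZ; last exact: cintegrable_rnorm.
have -> : rnorm c * rnorm c = Re (cint D (fun x => c^* * f x)).
  by rewrite cintZ// [c^* * _]mulrC mulcJ /= expr2.
apply: le_rint => //.
- by case: (cintegrableZ c^* fi).
- exact/rintegrableZ/cintegrable_rnorm.
- by move=> x _; rewrite -(rnormJ c) -rnormM (le_trans (ler_norm _))// ler_Re.
Qed.

Lemma rint_DCT (h_ : nat -> R -> R) h k :
  (forall n, measurable_fun D (h_ n)) -> rintegrable D k ->
  (forall x, D x -> h_ ^~ x @ \oo --> h x) ->
  (forall n x, D x -> `|h_ n x| <= k x) ->
  rint D (h_ n) @[n --> \oo] --> rint D h.
Proof.
move=> mh ik hh hk.
have [] := @dominated_convergence _ _ _ mu D mD (fun n x => (h_ n x)%:E)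
   (fun x => (h x)%:E) (fun x => (k x)%:E).
- by move=> n; apply/measurable_EFinP; exact: mh.
- apply/measurable_EFinP; apply: measurable_fun_cvg mh _ => x Dx.
  exact: hh.
- apply: aeW => x Dx; apply/cvg_EFin; first by near=> n.
  exact: hh.
- exact: ik.
- by apply: aeW => x n Dx /=; rewrite lee_fin hk.
- move=> ih _; rewrite rintE// => /fine_cvgP[_].
  by [].
Unshelve. all: by end_near. Qed.

Lemma rint_abs_DCT (h_ : nat -> R -> R) k :
  (forall n, measurable_fun D (h_ n)) -> rintegrable D k ->
  (forall x, D x -> h_ ^~ x @ \oo --> 0) ->
  (forall n x, D x -> `|h_ n x| <= k x) ->
  rint D (h_ n) @[n --> \oo] --> 0.
Proof.
move=> mh ik h0 hk; rewrite -[X in _ --> X](rint0); exact: (rint_DCT mh ik h0 hk).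
Qed.

End FixedDomain.

Lemma rintegrableS D E h : measurable D -> measurable E -> D `<=` E ->
  rintegrable E h -> rintegrable D h.
Proof. by move=> mD mE DE; exact: integrableS. Qed.

Lemma le_rint_set D E h : measurable D -> measurable E -> D `<=` E ->
  (forall x, E x -> 0 <= h x) -> rintegrable E h -> rint D h <= rint E h.
Proof.
move=> mD mE DE h0 ih; rewrite -lee_fin -!rintE//; last exact: rintegrableS ih.
apply: ge0_subset_integral => //.
by apply/measurable_EFinP; case/integrableP : ih => /measurable_EFinP.
Qed.

Definition ccontinuous_at f (x : R) :=
  (fun y => Re (f y)) @ x --> Re (f x) /\ (fun y => Im (f y)) @ x --> Im (f x).

Definition ccontinuous f := forall x, ccontinuous_at f x.

Lemma ccontinuous_atD f g x : ccontinuous_at f x -> ccontinuous_at g x ->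
  ccontinuous_at (fun y => f y + g y) x.
Proof.
move=> [f1 f2] [g1 g2]; split.
  by under eq_fun do rewrite ReD; rewrite ReD; exact: cvgD.
by under eq_fun do rewrite ImD; rewrite ImD; exact: cvgD.
Qed.

Lemma ccontinuous_atM f g x : ccontinuous_at f x -> ccontinuous_at g x ->
  ccontinuous_at (fun y => f y * g y) x.
Proof.
move=> [f1 f2] [g1 g2]; split.
  by under eq_fun do rewrite ReM; rewrite ReM; apply: cvgB; exact: cvgM.
by under eq_fun do rewrite ImM; rewrite ImM; apply: cvgD; exact: cvgM.
Qed.

Lemma ccontinuous_at_cst (c : C) x : ccontinuous_at (fun=> c) x.
Proof. by split; exact: cvg_cst. Qed.

Lemma ccontinuous_atN f x : ccontinuous_at f x -> ccontinuous_at (fun y => - f y) x.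
Proof.
move=> cf; have := ccontinuous_atM (ccontinuous_at_cst (-1) x) cf.
by under [X in ccontinuous_at X _]eq_fun do rewrite mulN1r.
Qed.

Lemma ccontinuous_atB f g x : ccontinuous_at f x -> ccontinuous_at g x ->
  ccontinuous_at (fun y => f y - g y) x.
Proof. by move=> cf cg; apply: ccontinuous_atD => //; exact: ccontinuous_atN. Qed.

Lemma ccontinuous_at_real h x : {for x, continuous h} ->
  ccontinuous_at (fun y => (h y)%:C) x.
Proof. by move=> ch; split; [exact: ch|exact: cvg_cst]. Qed.

Lemma ccontinuous_atJ f x : ccontinuous_at f x -> ccontinuous_at (fun y => (f y)^*) x.
Proof.
move=> [f1 f2]; split; first by under eq_fun do rewrite ReJ; rewrite ReJ.
by under eq_fun do rewrite ImJ; rewrite ImJ; exact: cvgN.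
Qed.

Lemma ccontinuous_rnorm f x : ccontinuous_at f x ->
  {for x, continuous (fun y => rnorm (f y))}.
Proof.
move=> [f1 f2].
have -> : (fun x => rnorm (f x)) =
    Num.sqrt \o (fun x => Re (f x) * Re (f x) + Im (f x) * Im (f x)).
  by apply/funext => y /=; rewrite rnormC !expr2.
apply: continuous_comp; last exact: sqrt_continuous.
by apply: cvgD; exact: cvgM.
Qed.

Lemma continuous_rnorm2 f : ccontinuous f -> continuous (fun y => rnorm (f y) ^+ 2).
Proof.
move=> cf x; rewrite /continuous_at expr2; under eq_fun do rewrite expr2.
by apply: cvgM; exact: ccontinuous_rnorm.
Qed.

(** Links the componentwise notion with continuity for the norm, the form that
    survives for functions with values in a Hilbert space. *)
Lemma ccontinuous_atP f x :
  ccontinuous_at f x <-> rnorm (f y - f x) @[y --> x] --> (0 : R).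
Proof.
split=> [cf|cf].
  have := ccontinuous_rnorm (ccontinuous_atB cf (ccontinuous_at_cst (f x) x)).
  by rewrite /prop_for /continuous_at subrr rnorm0.
have key (h : C -> R) : (forall a b, `|h a - h b| <= rnorm (a - b)) ->
    (fun y => h (f y)) @ x --> h (f x).
  move=> hh; apply/cvgrPdist_le => e e0.
  move/cvgrPdist_le : cf => /(_ e e0); apply: filterS => y.
  rewrite sub0r normrN ger0_norm ?rnorm_ge0// => h1.
  by rewrite distrC (le_trans (hh _ _)).
split; apply: key => a b.
  by rewrite -ReN -ReD ler_Re.
by rewrite -ImN -ImD ler_Im.
Qed.

Lemma ccontinuous_atV f x : ccontinuous_at f x -> f x != 0 ->
  ccontinuous_at (fun y => (f y)^-1) x.
Proof.
move=> cf f0; have n0 := rnorm_neq0 f0.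
have -> : (fun y => (f y)^-1) =
    (fun y => ((rnorm (f y) * rnorm (f y))^-1)%:C * (f y)^*).
  by apply/funext => y; rewrite invc_norm rnormE -expr2 fmorphV rmorphXn.
apply: ccontinuous_atM; last exact: ccontinuous_atJ.
apply: ccontinuous_at_real.
apply: continuousV; first by rewrite mulf_neq0// gt_eqF.
by apply: continuousM; exact: ccontinuous_rnorm.
Qed.

Lemma ccontinuous_cmeasurable f D : measurable D -> ccontinuous f -> cmeasurable D f.
Proof.
move=> mD cf; split; apply: measurable_funS (@subsetT _ D) _ => //;
  by apply: continuous_measurable_fun => x; case: (cf x).
Qed.

Lemma ccontinuous_cintegrable f a b :
  (forall x, a <= x <= b -> ccontinuous_at f x) -> cintegrable `[a, b] f.
Proof.
move=> cf; split; apply: continuous_compact_integrable; try exact: segment_compact;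
 by apply: continuous_in_subspaceT => x; rewrite inE /= in_itv /= => /cf[].
Qed.

Lemma continuous_rintegrable h a b :
  (forall x, a <= x <= b -> {for x, continuous h}) -> rintegrable `[a, b] h.
Proof.
move=> cf; apply: continuous_compact_integrable; first exact: segment_compact.
by apply: continuous_in_subspaceT => x; rewrite inE /= in_itv /= => /cf.
Qed.

End ComplexIntegral.
Arguments measurable_line {R}.

(** * Goursat's lemma for rectangles *)

Section Goursat.
Variable R : realType.
Local Notation C := R[i].
Implicit Types (F : C -> C) (z w : C).

(** Complex differentiability with real radii; unlike the limit of difference
    quotients it needs no exclusion of the centre. *)
Definition cdiff F z := exists d : C, forall e : R, 0 < e ->
  exists2 r : R, 0 < r & forall w, rnorm (w - z) < r ->
    rnorm (F w - F z - d * (w - z)) <= e * rnorm (w - z).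

Lemma derivable_cdiff F z : derivable (F : C^o -> C^o) z 1 -> cdiff F z.
Proof.
move=> /cvg_ex[/= l]; move/rcvgP => Fl; exists l => e e0.
move/cvgrPdist_lt : Fl => /(_ _ e0).
rewrite /dnbhs /within /= => /nbhs_ballP[/= r r0 rF].
exists (Re r) => [|w wr]; first by move: r0; rewrite /= ltcE => /andP[].
have [->|wz] := eqVneq w z.
  by rewrite !subrr mulr0 subr0 rnorm0 mulr0.
have wz0 : w - z != 0 by rewrite subr_eq0.
have r0' : 0 < r by [].
have rE : r = (Re r)%:C by rewrite RRe_real// gtr0_real.
have := rF (w - z); rewrite /ball /= sub0r normrN rnormE rE ltcR.
move=> /(_ wr wz0); rewrite sub0r normrN ger0_norm ?rnorm_ge0//.
have -> : (w - z) *: (1 : C^o) + z = w.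
  by rewrite -[LHS]/((w - z) * 1 + z) mulr1 subrK.
move=> /ltW h; have -> : F w - F z - l * (w - z) =
    (w - z) * ((w - z)^-1 * (F w - F z) - l) by field.
rewrite rnormM mulrC ler_wpM2r ?rnorm_ge0//.
Qed.

Lemma cdiff_bound F z : cdiff F z -> exists K r : R, 
  [/\ 0 < K, 0 < r & forall w, rnorm (w - z) < r ->
    rnorm (F w - F z) <= K * rnorm (w - z)].
Proof.
move=> [d /(_ 1 ltr01)[r r0 rF]]; exists (rnorm d + 1), r; split => //.
  by rewrite ltr_wpDl// rnorm_ge0.
move=> w wr; rewrite -(subrK (d * (w - z)) (F w - F z)).
rewrite (le_trans (rnormD _ _))// rnormM mulrDl addrC lerD2l.
exact: rF.
Qed.

(** A function into the plane, continuous along the inclusion of a segment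
    with isometric parameter, because it is Lipschitz at each point. *)
Lemma cdiff_ccontinuous F (p : R -> C) t :
  (forall u, rnorm (p u - p t) <= `|u - t|) -> cdiff F (p t) ->
  ccontinuous_at (fun u => F (p u)) t.
Proof.
move=> pt /cdiff_bound[K [r [K0 r0 Fr]]].
have lip u : `|u - t| < r -> rnorm (F (p u) - F (p t)) <= K * `|u - t|.
  move=> ur; rewrite (le_trans (Fr _ _))//; first exact: le_lt_trans (pt u) ur.
  by rewrite ler_wpM2l// ltW.
have near_ok e : 0 < e ->
    \forall u \near t, rnorm (F (p u) - F (p t)) < e.
  move=> e0; have m0 : 0 < Num.min r (e / K).
    by rewrite lt_min r0 divr_gt0.
  apply/nbhs_ballP; exists (Num.min r (e / K)) => //= u.
  rewrite /ball /= distrC lt_min => /andP[ur ue].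
  rewrite (le_lt_trans (lip _ ur))// mulrC -ltr_pdivlMr//.
apply/ccontinuous_atP/cvgrPdist_lt => e /near_ok; apply: filterS => u.
by rewrite sub0r normrN ger0_norm ?rnorm_ge0.
Qed.

Lemma rnorm_h (x x' y : R) : rnorm ((x +i* y) - (x' +i* y)) <= `|x - x'|.
Proof. by rewrite (le_trans (rnorm_le _))//= subrr normr0 addr0. Qed.

Lemma rnorm_v (x y y' : R) : rnorm ((x +i* y) - (x +i* y')) <= `|y - y'|.
Proof. by rewrite (le_trans (rnorm_le _))//= subrr normr0 add0r. Qed.

Definition hint F (y a b : R) : C := cint `[a, b] (fun x => F (x +i* y)).
Definition vint F (x a b : R) : C := cint `[a, b] (fun y => F (x +i* y)).

Definition hintable F y a b := cintegrable `[a, b] (fun x => F (x +i* y)).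
Definition vintable F x a b := cintegrable `[a, b] (fun y => F (x +i* y)).

(** Integral of F along the boundary of a box, counterclockwise. *)
Definition boxint F (x0 x1 y0 y1 : R) : C :=
  hint F y0 x0 x1 - hint F y1 x0 x1 + 'i * (vint F x1 y0 y1 - vint F x0 y0 y1).

Lemma cint_split (f : R -> C) (a c b : R) : a <= c <= b ->
  cintegrable `[a, b] f -> cint `[a, b] f = cint `[a, c] f + cint `[c, b] f.
Proof.
move=> /andP[ac cb] [f1 f2].
have key (h : R -> R) : rintegrable `[a, b] h ->
    rint `[a, b] h = rint `[a, c] h + rint `[c, b] h.
  move=> ih; have := @Rintegral_itvB R h (BLeft a) (BRight b) c ih.
  rewrite !bnd_simp => /(_ ac cb) hB.
  rewrite /rint -(@Rintegral_itv_obnd_cbnd _ c (BRight b)) -?hB.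
    by rewrite addrC subrK.
  apply: rintegrableS ih => // x /=; rewrite !in_itv /= => /andP[cx xb].
  by rewrite xb andbT (le_trans ac)// ltW.
by apply: complex_ext; rewrite ?ReD ?ImD /= key.
Qed.

Lemma boxint_cutV F x0 x1 y0 y1 c : x0 <= c <= x1 ->
  hintable F y0 x0 x1 -> hintable F y1 x0 x1 ->
  boxint F x0 x1 y0 y1 = boxint F x0 c y0 y1 + boxint F c x1 y0 y1.
Proof.
move=> cx i0 i1; rewrite /boxint.
by rewrite /hint (cint_split cx i0) (cint_split cx i1); ring.
Qed.

Lemma boxint_cutH F x0 x1 y0 y1 c : y0 <= c <= y1 ->
  vintable F x0 y0 y1 -> vintable F x1 y0 y1 ->
  boxint F x0 x1 y0 y1 = boxint F x0 x1 y0 c + boxint F x0 x1 c y1.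
Proof.
move=> cx i0 i1; rewrite /boxint.
by rewrite /vint (cint_split cx i0) (cint_split cx i1); ring.
Qed.

Lemma fine_itvcc (a b : R) : a <= b ->
  fine (lebesgue_measure (`[a, b] : set R)) = b - a.
Proof.
move=> ab; rewrite lebesgue_measure_itv /= lte_fin; case: ltP => //= ba.
by apply/eqP; rewrite eq_sym subr_eq0 eq_le ab ba.
Qed.

Lemma cint_cst (a b : R) (c : C) : a <= b ->
  cint `[a, b] (fun=> c) = (b - a)%:C * c.
Proof.
move=> ab; have m := fine_itvcc ab.
apply: complex_ext; rewrite ?ReM ?ImM /= mul0r ?subr0 ?addr0 /rint.
  by rewrite Rintegral_cst// m mulrC.
by rewrite Rintegral_cst// m mulrC.
Qed.

Lemma rint_cst (a b k : R) : a <= b -> rint `[a, b] (fun=> k) = k * (b - a).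
Proof.
move=> ab; rewrite /rint Rintegral_cst//; congr (_ * _).
exact: fine_itvcc.
Qed.

Lemma rnorm_cint_le (f : R -> C) (a b K : R) : a <= b ->
  cintegrable `[a, b] f -> (forall x, a <= x <= b -> rnorm (f x) <= K) ->
  rnorm (cint `[a, b] f) <= K * (b - a).
Proof.
move=> ab fi fK; rewrite (le_trans (rnorm_cint _ fi))// -(rint_cst _ ab).
apply: le_rint => //; first exact: cintegrable_rnorm.
by apply: continuous_rintegrable => x _; exact: cvg_cst.
Qed.

Definition boundary_integrable F x0 x1 y0 y1 :=
  [/\ hintable F y0 x0 x1, hintable F y1 x0 x1,
      vintable F x0 y0 y1 & vintable F x1 y0 y1].

Lemma boxint_affine (c d z : C) x0 x1 y0 y1 : x0 <= x1 -> y0 <= y1 ->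
  boxint (fun w => c + d * (w - z)) x0 x1 y0 y1 = 0.
Proof.
move=> x01 y01.
have ch y x : ccontinuous_at (fun x => c + d * ((x +i* y) - z)) x.
  apply: ccontinuous_atD; first exact: ccontinuous_at_cst.
  apply: ccontinuous_atM; first exact: ccontinuous_at_cst.
  apply: ccontinuous_atB; last exact: ccontinuous_at_cst.
  by split; [exact: cvg_id|exact: cvg_cst].
have cv x y : ccontinuous_at (fun y => c + d * ((x +i* y) - z)) y.
  apply: ccontinuous_atD; first exact: ccontinuous_at_cst.
  apply: ccontinuous_atM; first exact: ccontinuous_at_cst.
  apply: ccontinuous_atB; last exact: ccontinuous_at_cst.
  by split; [exact: cvg_cst|exact: cvg_id].
rewrite /boxint /hint /vint.
(* Opposite sides differ by a translation, so pairing them leaves constants. *)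
rewrite -!cintB//; try by apply: ccontinuous_cintegrable => x _.
rewrite (@eq_cint _ `[x0, x1] _ (fun=> d * ((y0 - y1)%:C * 'i))); last first.
  move=> x _; rewrite opprD addrACA subrr add0r -mulrBr; congr (_ * _).
  by apply: complex_ext; rewrite !(ReD, ImD, ReN, ImN, ReM, ImM) /=; ring.
rewrite (@eq_cint _ `[y0, y1] _ (fun=> d * (x1 - x0)%:C)); last first.
  move=> x _; rewrite opprD addrACA subrr add0r -mulrBr; congr (_ * _).
  by apply: complex_ext; rewrite !(ReD, ImD, ReN, ImN, ReM, ImM) /=; ring.
rewrite !cint_cst//.
by apply: complex_ext; rewrite !(ReD, ImD, ReM, ImM) /=; ring.
Qed.

Lemma boxintD F G x0 x1 y0 y1 : boundary_integrable F x0 x1 y0 y1 ->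
  boundary_integrable G x0 x1 y0 y1 ->
  boxint (fun z => F z + G z) x0 x1 y0 y1 =
    boxint F x0 x1 y0 y1 + boxint G x0 x1 y0 y1.
Proof.
by move=> [a b c d] [e f g h]; rewrite /boxint /hint /vint !cintD//; ring.
Qed.

Lemma boxintZ (k : C) F x0 x1 y0 y1 : boundary_integrable F x0 x1 y0 y1 ->
  boxint (fun z => k * F z) x0 x1 y0 y1 = k * boxint F x0 x1 y0 y1.
Proof.
by move=> [a b c d]; rewrite /boxint /hint /vint !cintZ//; ring.
Qed.

Lemma rnorm_boxint F x0 x1 y0 y1 K : x0 <= x1 -> y0 <= y1 ->
  boundary_integrable F x0 x1 y0 y1 ->
  (forall x, x0 <= x <= x1 -> rnorm (F (x +i* y0)) <= K) ->
  (forall x, x0 <= x <= x1 -> rnorm (F (x +i* y1)) <= K) ->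
  (forall y, y0 <= y <= y1 -> rnorm (F (x0 +i* y)) <= K) ->
  (forall y, y0 <= y <= y1 -> rnorm (F (x1 +i* y)) <= K) ->
  rnorm (boxint F x0 x1 y0 y1) <= 2 * K * ((x1 - x0) + (y1 - y0)).
Proof.
move=> x01 y01 [i1 i2 i3 i4] k1 k2 k3 k4.
rewrite (le_trans (rnormD _ _))// rnormM.
have -> : rnorm ('i : C) = 1.
  by rewrite rnormC /= expr0n expr1n add0r sqrtr1.
have h1 := rnormB (hint F y0 x0 x1) (hint F y1 x0 x1).
have h2 := rnormB (vint F x1 y0 y1) (vint F x0 y0 y1).
have := rnorm_cint_le x01 i1 k1; have := rnorm_cint_le x01 i2 k2.
have := rnorm_cint_le y01 i3 k3; have := rnorm_cint_le y01 i4 k4.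
rewrite /hint /vint in h1 h2 *; lra.
Qed.

Definition cdiff_box F x0 x1 y0 y1 :=
  forall x y, x0 <= x <= x1 -> y0 <= y <= y1 -> cdiff F (x +i* y).

Lemma cdiff_hintable F y a b : (forall x, a <= x <= b -> cdiff F (x +i* y)) ->
  hintable F y a b.
Proof.
move=> dF; apply: ccontinuous_cintegrable => x xab.
by apply: (@cdiff_ccontinuous F (fun x => x +i* y)) => [u|]; [exact: rnorm_h|exact: dF].
Qed.

Lemma cdiff_vintable F x a b : (forall y, a <= y <= b -> cdiff F (x +i* y)) ->
  vintable F x a b.
Proof.
move=> dF; apply: ccontinuous_cintegrable => y xab.
by apply: (@cdiff_ccontinuous F (fun y => x +i* y)) => [u|]; [exact: rnorm_v|exact: dF].
Qed.

Lemma cdiff_boundary F x0 x1 y0 y1 : x0 <= x1 -> y0 <= y1 ->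
  cdiff_box F x0 x1 y0 y1 -> boundary_integrable F x0 x1 y0 y1.
Proof.
move=> x01 y01 dF; split; (apply: cdiff_hintable + apply: cdiff_vintable);
  by move=> t tab; apply: dF => //; rewrite lexx ?x01 ?y01.
Qed.


Section Bisection.
Variables (F : C -> C) (p q : R) (p0 : 0 <= p) (q0 : 0 <= q).

(* A box is given by its lower left corner and the level of its subdivision. *)
Let len (l : R) n := l * 2^-1 ^+ n.

Let J (c : R * R) n :=
  boxint F c.1 (c.1 + len p n) c.2 (c.2 + len q n).

Let quadrant (c : R * R) n (ab : bool * bool) :=
  (c.1 + ab.1%:R * len p n.+1, c.2 + ab.2%:R * len q n.+1).

Let len_ge0 l n : 0 <= l -> 0 <= len l n.
Proof. by move=> l0; rewrite /len mulr_ge0// exprn_ge0. Qed.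

Let lenS l n : len l n = len l n.+1 + len l n.+1.
Proof. by rewrite /len exprS; field. Qed.

(** The integrals over the inner edges of the four quadrants cancel. *)
Lemma boxint_quadrants c n :
  cdiff_box F c.1 (c.1 + len p n) c.2 (c.2 + len q n) ->
  exists ab, rnorm (J c n) <= 4 * rnorm (J (quadrant c n ab) n.+1).
Proof.
case: c => x y /= dF.
have pn := len_ge0 n.+1 p0; have qn := len_ge0 n.+1 q0.
have H u : y <= u <= y + len q n -> hintable F u x (x + len p n).
  by move=> uy; apply: cdiff_hintable => t tx; exact: dF.
have V u a b : x <= u <= x + len p n -> y <= a -> b <= y + len q n ->
    vintable F u a b.
  move=> ux ya by_; apply: cdiff_vintable => t /andP[at_ tb]; apply: dF => //.
  by rewrite (le_trans ya)// (le_trans tb).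
have Js : J (x, y) n = J (quadrant (x, y) n (false, false)) n.+1
    + J (quadrant (x, y) n (false, true)) n.+1
    + (J (quadrant (x, y) n (true, false)) n.+1
    + J (quadrant (x, y) n (true, true)) n.+1).
  rewrite /J /quadrant /= !mul0r !mul1r !addr0.
  rewrite (lenS p n) in H V *; rewrite (lenS q n) in H V *.
  rewrite (@boxint_cutV _ _ _ _ _ (x + len p n.+1)); first last.
  - by apply: H; apply/andP; split; lra.
  - by apply: H; apply/andP; split; lra.
  - by apply/andP; split; lra.
  rewrite (@boxint_cutH _ x _ _ _ (y + len q n.+1)); first last.
  - by apply: V => //; apply/andP; split; lra.
  - by apply: V => //; apply/andP; split; lra.
  - by apply/andP; split; lra.
  rewrite (@boxint_cutH _ (x + _) _ _ _ (y + len q n.+1)); first last.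
  - by apply: V => //; apply/andP; split; lra.
  - by apply: V => //; apply/andP; split; lra.
  - by apply/andP; split; lra.
  by rewrite -!addrA.
apply: contrapT => /forallNP no.
have n1 := no (false, false); have n2 := no (false, true).
have n3 := no (true, false); have n4 := no (true, true).
have tri : rnorm (J (x, y) n) <= rnorm (J (quadrant (x, y) n (false, false)) n.+1)
    + rnorm (J (quadrant (x, y) n (false, true)) n.+1)
    + (rnorm (J (quadrant (x, y) n (true, false)) n.+1)
    + rnorm (J (quadrant (x, y) n (true, true)) n.+1)).
  by rewrite Js (le_trans (rnormD _ _))// lerD// rnormD.
move/negP: n1; move/negP: n2; move/negP: n3; move/negP: n4; rewrite -!ltNge.
move: tri; move: (rnorm _) (rnorm _) (rnorm _) (rnorm _) (rnorm _) => a b c d e.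
lra.
Qed.

(** Goursat's lemma: if the boundary integral were nonzero, repeated
    subdivision would produce shrinking boxes whose boundary integrals decay
    at most like their area; but near the common point of the boxes F is
    affine up to a small error, and affine functions integrate to zero. *)
Lemma boxint_cdiff_from (x y : R) : cdiff_box F x (x + p) y (y + q) ->
  boxint F x (x + p) y (y + q) = 0.
Proof.
move=> dF.
pose ok (c : R * R) n := [/\ x <= c.1, c.1 + len p n <= x + p,
  y <= c.2 & c.2 + len q n <= y + q].
have dok c n : ok c n -> cdiff_box F c.1 (c.1 + len p n) c.2 (c.2 + len q n).
  move=> [h1 h2 h3 h4] u v /andP[u1 u2] /andP[v1 v2].
  by apply: dF; apply/andP; split; lra.
have step (cn : (R * R) * nat) : exists ab, ok cn.1 cn.2 ->
    rnorm (J cn.1 cn.2) <= 4 * rnorm (J (quadrant cn.1 cn.2 ab) cn.2.+1).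
  have [okc|nok] := pselect (ok cn.1 cn.2); last by exists (false, false).
  by have [ab h] := boxint_quadrants (dok _ _ okc); exists ab.
have {step}[sel hsel] := choice step.
(* Corners of nested boxes, each a quadrant of the preceding one. *)
pose fix cs n := if n is m.+1 then quadrant (cs m) m (sel (cs m, m)) else (x, y).
have len0 l : len l 0 = l by rewrite /len expr0 mulr1.
have stepx n : (cs n).1 <= (cs n.+1).1 /\
    (cs n.+1).1 + len p n.+1 <= (cs n).1 + len p n.
  have := len_ge0 n.+1 p0; rewrite /= (lenS p n).
  by case: (sel _).1; rewrite /= ?mul1r ?mul0r; lra.
have stepy n : (cs n).2 <= (cs n.+1).2 /\
    (cs n.+1).2 + len q n.+1 <= (cs n).2 + len q n.
  have := len_ge0 n.+1 q0; rewrite /= (lenS q n).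
  by case: (sel _).2; rewrite /= ?mul1r ?mul0r; lra.
have okn n : ok (cs n) n.
  elim: n => [|n [h1 h2 h3 h4]]; first by split; rewrite /= ?len0.
  have [a b] := stepx n; have [c d] := stepy n.
  by split; lra.
have Jn n : rnorm (J (x, y) 0) <= 4 ^+ n * rnorm (J (cs n) n).
  elim: n => [|n ih]; first by rewrite expr0 mul1r.
  rewrite (le_trans ih)// exprSr -mulrA ler_wpM2l ?exprn_ge0//.
  exact: (hsel (cs n, n) (okn n)).
have nested (u l : nat -> R) : (forall n, u n <= u n.+1) ->
    (forall n, u n.+1 + l n.+1 <= u n + l n) -> (forall n, 0 <= l n) ->
    exists c, forall n, u n <= c <= u n + l n.
  move=> u1 u2 l0.
  have mu : {homo u : m n / (m <= n)%N >-> m <= n} by exact/nondecreasing_seqP.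
  have mv : {homo (fun n => u n + l n) : m n / (m <= n)%N >-> n <= m}.
    by move=> m n mn; have := @nonincreasing_seqP _ _ (fun n => u n + l n);
      case=> /(_ u2) h _; exact: h.
  have ub m n : u m <= u n + l n.
    rewrite (le_trans (mu m (maxn m n) (leq_maxl _ _)))//.
    rewrite (le_trans _ (mv n (maxn m n) (leq_maxr _ _)))//.
    by rewrite lerDl.
  exists (sup (range u)) => n; apply/andP; split.
    apply: ub_le_sup; last by exists n.
    by exists (u 0 + l 0) => _ [m _ <-].
  apply: ge_sup; first by exists (u 0); exists 0.
  by move=> _ [m _ <-].
have [cx hx] := nested _ _ (fun n => (stepx n).1) (fun n => (stepx n).2)
  (fun n => len_ge0 n p0).
have [cy hy] := nested _ _ (fun n => (stepy n).1) (fun n => (stepy n).2)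
  (fun n => len_ge0 n q0).
pose z := cx +i* cy.
have [d dz] : cdiff F z.
  have := hx 0; have := hy 0; rewrite /= !len0 => h1 h2.
  exact: dF.
(* The bound with a free constant e forces the integral to vanish. *)
have bnd e : 0 < e -> rnorm (J (x, y) 0) <= e * (2 * (p + q) ^+ 2).
  move=> e0; have [r r0 hr] := dz _ e0.
  have [n nr] : exists n, (p + q) * 2^-1 ^+ n < r.
    have : (p + q) * 2^-1 ^+ n @[n --> \oo] --> (p + q) * 0.
      apply: cvgM; first exact: cvg_cst.
      by apply: cvg_expr; rewrite ger0_norm// invf_lt1// ltr1n.
    rewrite mulr0 => /cvgrPdist_lt /(_ _ r0)[N _ /(_ N (leqnn N))] /=.
    rewrite sub0r normrN => h; exists N; exact: le_lt_trans (ler_norm _) h.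
  have [w1 w2 w3 w4] := okn n.
  have lp := len_ge0 n p0; have lq := len_ge0 n q0.
  have close u v : (cs n).1 <= u <= (cs n).1 + len p n ->
      (cs n).2 <= v <= (cs n).2 + len q n ->
      rnorm ((u +i* v) - z) <= len p n + len q n.
    move=> /andP[u1 u2] /andP[v1 v2].
    have /andP[x1 x2] := hx n; have /andP[y1 y2] := hy n.
    rewrite (le_trans (rnorm_le _))//= lerD// ler_norml; apply/andP; split; lra.
  have lenpq : len p n + len q n = (p + q) * 2^-1 ^+ n by rewrite /len -mulrDl.
  pose E w := F w + (-1) * (F z + d * (w - z)).
  have dJ := dok _ _ (okn n).
  have bF : boundary_integrable F (cs n).1 ((cs n).1 + len p n)
      (cs n).2 ((cs n).2 + len q n).
    by apply: cdiff_boundary => //; rewrite lerDl.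
  have bA : boundary_integrable (fun w => F z + d * (w - z))
      (cs n).1 ((cs n).1 + len p n) (cs n).2 ((cs n).2 + len q n).
    apply: cdiff_boundary; rewrite ?lerDl// => u v _ _; exists d => e' e'0.
    exists 1 => // w _; rewrite (_ : _ - _ = 0); last by ring.
    by rewrite rnorm0 mulr_ge0 ?rnorm_ge0// ltW.
  have bA' : boundary_integrable (fun w => (-1) * (F z + d * (w - z)))
      (cs n).1 ((cs n).1 + len p n) (cs n).2 ((cs n).2 + len q n).
    by case: bA => *; split; exact: cintegrableZ.
  have bE : boundary_integrable E (cs n).1 ((cs n).1 + len p n)
      (cs n).2 ((cs n).2 + len q n).
    by case: bF bA' => ? ? ? ? [? ? ? ?]; split; exact: cintegrableD.
  have JE : J (cs n) n = boxint E (cs n).1 ((cs n).1 + len p n)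
      (cs n).2 ((cs n).2 + len q n).
    by rewrite /E boxintD// boxintZ// boxint_affine ?lerDl// mulr0 addr0.
  have Eb u v : (cs n).1 <= u <= (cs n).1 + len p n ->
      (cs n).2 <= v <= (cs n).2 + len q n ->
      rnorm (E (u +i* v)) <= e * (len p n + len q n).
    move=> hu hv; have cl := close _ _ hu hv.
    have -> : E (u +i* v) = F (u +i* v) - F z - d * ((u +i* v) - z).
      by rewrite /E; ring.
    rewrite (le_trans (hr _ _))//; last by rewrite ler_wpM2l// ltW.
    by rewrite (le_lt_trans cl)// lenpq.
  have Jle : rnorm (J (cs n) n) <= 2 * (e * (len p n + len q n)) *
      (len p n + len q n).
    have len_id (u l : R) : u + l - u = l by ring.
    have bnds (u l : R) : 0 <= l ->
        (u <= u <= u + l) && (u <= u + l <= u + l).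
      by move=> l0; apply/andP; split; apply/andP; split; lra.
    have /andP[bx1 bx2] := bnds (cs n).1 _ lp.
    have /andP[by1 by2] := bnds (cs n).2 _ lq.
    have := rnorm_boxint _ _ bE (fun u hu => Eb u _ hu by1)
      (fun u hu => Eb u _ hu by2) (fun u hu => Eb _ u bx1 hu)
      (fun u hu => Eb _ u bx2 hu).
    by rewrite !len_id !lerDl -JE; exact.
  rewrite (le_trans (Jn n))// (le_trans (ler_wpM2l _ Jle)) ?exprn_ge0// lenpq.
  have four : 4 ^+ n * (2^-1 ^+ n * 2^-1 ^+ n) = 1 :> R.
    rewrite -!exprMn (_ : 4 * (2^-1 * 2^-1) = 1) ?expr1n//; first by field.
  rewrite le_eqVlt; apply/orP; left; apply/eqP.
  transitivity (e * (2 * (p + q) ^+ 2) * (4 ^+ n * (2^-1 ^+ n * 2^-1 ^+ n))).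
    by ring.
  by rewrite four mulr1.
have -> : boxint F x (x + p) y (y + q) = J (x, y) 0 by rewrite /J /= !len0.
apply: rnorm_eq0; apply/eqP; rewrite eq_le rnorm_ge0 andbT.
set M := 2 * (p + q) ^+ 2 in bnd.
have M0 : 0 <= M by rewrite mulr_ge0// sqr_ge0.
apply/ler_addgt0Pr => e e0; rewrite add0r.
have e1 : 0 < e / (M + 1) by rewrite divr_gt0// ltr_wpDl.
rewrite (le_trans (bnd _ e1))// mulrAC ler_pdivrMr ?ltr_wpDl//.
by apply: ler_wpM2l; [exact: ltW|rewrite lerDl].
Qed.

End Bisection.

Lemma boxint_cdiff F x0 x1 y0 y1 : x0 <= x1 -> y0 <= y1 ->
  cdiff_box F x0 x1 y0 y1 -> boxint F x0 x1 y0 y1 = 0.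
Proof.
move=> x01 y01 dF; rewrite -(subrK x0 x1) -(subrK y0 y1).
rewrite [x1 - _ + _]addrC [y1 - _ + _]addrC.
by apply: boxint_cdiff_from; rewrite ?subr_ge0// !subrKC.
Qed.

(** A bounded singularity does not contribute: cutting out a small square
    around it leaves boxes on which F is differentiable, and the integral
    around the square is bounded by its perimeter. *)
Lemma boxint_cdiff_punctured F (s : C) x0 x1 y0 y1 K r :
  x0 < Re s < x1 -> y0 < Im s < y1 -> 0 < r ->
  (forall x y, x0 <= x <= x1 -> y0 <= y <= y1 -> x +i* y != s ->
     cdiff F (x +i* y)) ->
  (forall w, w != s -> rnorm (w - s) < r -> rnorm (F w) <= K) ->
  boxint F x0 x1 y0 y1 = 0.
Proof.
move=> /andP[sx0 sx1] /andP[sy0 sy1] r0 dF bF.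
have neqx x y : x != Re s -> x +i* y != s by apply: contra_neq => <-.
have neqy x y : y != Im s -> x +i* y != s by apply: contra_neq => <-.
have bnd e : 0 < e -> e <= Re s - x0 -> e <= x1 - Re s -> e <= Im s - y0 ->
    e <= y1 - Im s -> 2 * e < r -> rnorm (boxint F x0 x1 y0 y1) <= K * (8 * e).
  move=> e0 e1 e2 e3 e4 er.
  have Hy y a b : y != Im s -> y0 <= y <= y1 -> x0 <= a -> b <= x1 -> hintable F y a b.
    move=> ys yy ax bx; apply: cdiff_hintable => x /andP[xa xb].
    by apply: dF; rewrite ?neqy//; apply/andP; split; lra.
  have Vx x a b : x != Re s -> x0 <= x <= x1 -> y0 <= a -> b <= y1 -> vintable F x a b.
    move=> ys yy ax bx; apply: cdiff_vintable => y /andP[xa xb].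
    by apply: dF; rewrite ?neqx//; apply/andP; split; lra.
  have Z a b c d : x0 <= a -> a <= b -> b <= x1 -> y0 <= c -> c <= d -> d <= y1 ->
      [|| b < Re s, Re s < a, d < Im s | Im s < c] -> boxint F a b c d = 0.
    move=> h1 h2 h3 h4 h5 h6 h7; apply: boxint_cdiff => // x y /andP[xa xb] /andP[yc yd].
    apply: dF; rewrite ?(le_trans h1)// ?(le_trans h4) ?(le_trans xb) ?(le_trans yd)//.
    case/or4P: h7 => h7; [apply: neqx|apply: neqx|apply: neqy|apply: neqy].
    - by rewrite lt_eqF// (le_lt_trans xb).
    - by rewrite gt_eqF// (lt_le_trans h7).
    - by rewrite lt_eqF// (le_lt_trans yd).
    - by rewrite gt_eqF// (lt_le_trans h7).
  have ny0 : y0 != Im s by rewrite lt_eqF.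
  have ny1 : y1 != Im s by rewrite gt_eqF.
  rewrite (@boxint_cutV _ _ _ _ _ (Re s - e)); first last.
  - by apply: Hy => //; apply/andP; split; lra.
  - by apply: Hy => //; apply/andP; split; lra.
  - by apply/andP; split; lra.
  rewrite (Z x0 (Re s - e)) ?add0r; try lra.
  rewrite (@boxint_cutV _ (Re s - e) _ _ _ (Re s + e)); first last.
  - by apply: Hy => //; try apply/andP; try split; lra.
  - by apply: Hy => //; try apply/andP; try split; lra.
  - by apply/andP; split; lra.
  rewrite (Z (Re s + e)) ?addr0; try lra.
  have nx0 : Re s - e != Re s by rewrite lt_eqF// gtrBl.
  have nx1 : Re s + e != Re s by rewrite gt_eqF// ltrDl.
  rewrite (@boxint_cutH _ _ _ _ _ (Im s - e)); first last.
  - by apply: Vx => //; apply/andP; split; lra.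
  - by apply: Vx => //; apply/andP; split; lra.
  - by apply/andP; split; lra.
  rewrite (Z _ _ y0 (Im s - e)) ?add0r; try lra.
  rewrite (@boxint_cutH _ _ _ (Im s - e) _ (Im s + e)); first last.
  - by apply: Vx => //; try apply/andP; try split; lra.
  - by apply: Vx => //; try apply/andP; try split; lra.
  - by apply/andP; split; lra.
  rewrite (Z _ _ (Im s + e)) ?addr0; try lra.
  have -> : K * (8 * e) = 2 * K * ((Re s + e - (Re s - e)) + (Im s + e - (Im s - e))).
    by ring.
  have close x y : Re s - e <= x <= Re s + e -> Im s - e <= y <= Im s + e ->
      rnorm ((x +i* y) - s) < r.
    move=> /andP[a b] /andP[c d]; rewrite (le_lt_trans (rnorm_le _))//.
    rewrite ReD ImD ReN ImN /= (le_lt_trans _ er)// mulr_natl mulr2n lerD//.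
      by rewrite ler_norml; apply/andP; split; lra.
    by rewrite ler_norml; apply/andP; split; lra.
  have ny2 : Im s - e != Im s by rewrite lt_eqF// gtrBl.
  have ny3 : Im s + e != Im s by rewrite gt_eqF// ltrDl.
  apply: rnorm_boxint; try lra.
  - by split; [apply: Hy|apply: Hy|apply: Vx|apply: Vx] => //;
      do ?[apply/andP; split]; lra.
  - by move=> x xx; apply: bF; [exact: neqy|apply: close => //; apply/andP; split; lra].
  - by move=> x xx; apply: bF; [exact: neqy|apply: close => //; apply/andP; split; lra].
  - by move=> x xx; apply: bF; [exact: neqx|apply: close => //; apply/andP; split; lra].
  - by move=> x xx; apply: bF; [exact: neqx|apply: close => //; apply/andP; split; lra].
apply: rnorm_eq0; apply/eqP; rewrite eq_le rnorm_ge0 andbT.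
apply/ler_addgt0Pr => e e0; rewrite add0r.
pose m := Num.min (Num.min (Re s - x0) (x1 - Re s)) (Num.min (Im s - y0) (y1 - Im s)).
pose d := Num.min (Num.min m (r / 4)) (e / (8 * (`|K| + 1))).
have K1 : 0 < 8 * (`|K| + 1) by rewrite mulr_gt0// ltr_wpDl.
have d0 : 0 < d.
  rewrite /d /m !lt_min !subr_gt0 sx0 sx1 sy0 sy1 /= !divr_gt0//.
have : d <= d by []. 
rewrite {2}/d /m !le_min => /andP[/andP[/andP[/andP[d1 d2] /andP[d3 d4]] d5] d6].
have d7 : 2 * d < r by lra.
rewrite (le_trans (bnd _ d0 d1 d2 d3 d4 d7))//.
rewrite ler_pdivlMr// in d6; rewrite (le_trans _ d6)//.
have := ler_norm K; nra.
Qed.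


End Goursat.

(** * Cauchy's formula on a vertical line *)

Section WholeLine.
Variable R : realType.
Local Notation C := R[i].
Local Notation mu := (@lebesgue_measure R).

Lemma rint_FTC (h H : R -> R) (a b : R) : a <= b -> continuous h ->
  (forall x : R, is_derive x (1 : R) H (h x)) -> rint `[a, b] h = H b - H a.
Proof.
rewrite le_eqVlt => /predU1P[<- _ _|ab ch dH].
  by rewrite subrr /rint set_itv1 Rintegral_set1.
have cH : continuous H.
  move=> x; apply: differentiable_continuous; apply/derivable1_diffP.
  by have [] := dH x.
rewrite /rint /Rintegral (@continuous_FTC2 _ h H)//.
- exact: continuous_subspaceT.
- split; first by move=> x _; have [] := dH x.
  + by apply: cvg_at_right_filter; exact: cH.
  + by apply: cvg_at_left_filter; exact: cH.
- by move=> x _; rewrite derive1E; have [] := dH x.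
Qed.

Definition sym_itv (n : nat) : set R := `[- n%:R, n%:R].

Lemma measurable_sym n : measurable (sym_itv n).
Proof. exact: measurable_itv. Qed.

Lemma sym_itv_nd : nondecreasing_seq sym_itv.
Proof.
move=> m n mn; apply/subsetPset => x; rewrite /sym_itv /= !in_itv /=.
move=> /andP[mx xm]; have := mn; rewrite -(ler_nat R) => mn'.
by apply/andP; split; lra.
Qed.

Lemma sym_itv_cover : \bigcup_n sym_itv n = setT.
Proof.
rewrite -subTset => x _; exists (Num.bound `|x|) => //=.
by rewrite /sym_itv /= in_itv /= -ler_norml ltW// archi_boundP.
Qed.

(** Monotone convergence along the symmetric intervals, in a form that also
    yields integrability. *)
Lemma rintegrableT_bound (h : R -> R) (K : R) : measurable_fun setT h ->
  (forall x, 0 <= h x) ->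
  (forall n, rintegrable (sym_itv n) h) ->
  (forall n, rint (sym_itv n) h <= K) ->
  rintegrable setT h /\ rint setT h <= K.
Proof.
move=> mh h0 ih hK.
have ub : (\int[mu]_x (h x)%:E <= K%:E)%E.
  rewrite -sym_itv_cover.
  have cvgI : (\int[mu]_(x in sym_itv i) (h x)%:E)%E @[i --> \oo] -->
      (\int[mu]_(x in \bigcup_i sym_itv i) (h x)%:E)%E.
    apply: ge0_nondecreasing_set_cvg_integral.
    - exact: sym_itv_nd.
    - exact: measurable_sym.
    - by move=> n; apply/measurable_EFinP; exact: measurable_funS mh.
    - by move=> n x _; rewrite lee_fin.
  rewrite -(cvg_lim _ cvgI)//; apply: lime_le.
    by apply/cvg_ex; eexists; exact: cvgI.
  apply: nearW => n; rewrite (rintE (measurable_sym n) (ih n)) lee_fin.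
  exact: hK.
have it : rintegrable setT h.
  apply/integrableP; split; first exact/measurable_EFinP.
  under eq_integral do rewrite gee0_abs ?lee_fin//.
  exact: le_lt_trans ub (ltry _).
by split => //; rewrite -lee_fin -rintE.
Qed.

Lemma rint_restrict D (h : R -> R) : rint D h = rint setT (h \_ D).
Proof. exact: Rintegral_mkcond. Qed.

Lemma cvg_rint_sym (h : R -> R) : rintegrable setT h ->
  rint (sym_itv n) h @[n --> \oo] --> rint setT h.
Proof.
move=> ih; under eq_fun do rewrite rint_restrict.
apply: (@rint_DCT _ setT _ _ _ (fun x => `|h x|)) => //.
- move=> n; have [/measurable_EFinP mh _] := integrableP _ _ _ ih.
  apply/measurable_restrict => //; first exact: measurable_sym.
  exact: measurable_funS mh.
- exact: rintegrable_abs.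
- move=> x _; apply/cvgrPdist_le => e e0; near=> n.
  rewrite patchE mem_set ?subrr ?normr0 ?ltW//.
  rewrite /sym_itv /= in_itv /= -ler_norml.
  near: n; exists (Num.bound `|x|) => // n /= xn.
  by rewrite (le_trans (ltW (archi_boundP _)))// ler_nat.
- by move=> n x _; rewrite patchE; case: ifP; rewrite ?normr0.
Unshelve. all: by end_near. Qed.

Lemma cvg_cint_sym (f : R -> C) : cintegrable setT f ->
  rnorm (cint (sym_itv n) f - cint setT f) @[n --> \oo] --> (0 : R).
Proof.
move=> [f1 f2].
apply: (@squeeze_cvgr _ _ _ _ (fun=> 0)
  (fun n => `|rint (sym_itv n) (fun x => Re (f x)) - rint setT (fun x => Re (f x))| +
     `|rint (sym_itv n) (fun x => Im (f x)) - rint setT (fun x => Im (f x))|)).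
- apply: nearW => n; rewrite rnorm_ge0 /= (le_trans (rnorm_le _))//.
- exact: cvg_cst.
- rewrite -[X in _ --> X](addr0 0); apply: cvgD.
    by rewrite -(normr0 R); apply: cvg_norm; rewrite -(subrr (rint setT (fun x => Re (f x))));
      apply: cvgB; [exact: cvg_rint_sym|exact: cvg_cst].
  by rewrite -(normr0 R); apply: cvg_norm; rewrite -(subrr (rint setT (fun x => Im (f x))));
      apply: cvgB; [exact: cvg_rint_sym|exact: cvg_cst].
Qed.

(** The squared modulus of 1 / (w - p) for p = t + i s. *)
Definition poisson (s t w : R) := (s ^+ 2 + (w - t) ^+ 2)^-1.

Lemma poisson_continuous s t : 0 < s -> continuous (poisson s t).
Proof.
move=> s0 w; apply: cvgV; first by rewrite gt_eqF// ltr_pwDl ?exprn_gt0// sqr_ge0.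
apply: cvgD; first exact: cvg_cst.
by under eq_fun do rewrite expr2; rewrite expr2; apply: cvgM; apply: cvgB;
  (exact: cvg_id || exact: cvg_cst).
Qed.

Lemma poisson_ge0 s t w : 0 <= poisson s t w.
Proof. by rewrite invr_ge0 addr_ge0// sqr_ge0. Qed.

Lemma poisson_rint (s t a b : R) : 0 < s -> a <= b ->
  rint `[a, b] (poisson s t) = s^-1 * (atan ((b - t) / s) - atan ((a - t) / s)).
Proof.
move=> s0 ab; rewrite mulrBr.
have d w : is_derive (w : R) (1 : R) (fun w => s^-1 * atan ((w - t) / s)) (poisson s t w).
  apply: is_derive_eq.
  rewrite /poisson /GRing.scale /=; field.
  by rewrite !gt_eqF ?ltr_pwDl ?exprn_gt0 ?sqr_ge0.
by rewrite (rint_FTC ab (poisson_continuous s0) d).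
Qed.

Lemma poisson_integral (s t : R) : 0 < s ->
  rintegrable setT (poisson s t) /\ rint setT (poisson s t) = pi / s.
Proof.
move=> s0.
have nn n : - n%:R <= n%:R :> R by rewrite ge0_cp.
have ip : rintegrable setT (poisson s t).
  suff [] : rintegrable setT (poisson s t) /\ rint setT (poisson s t) <= s^-1 * pi by [].
  apply: rintegrableT_bound.
  - by apply: continuous_measurable_fun; exact: poisson_continuous.
  - by move=> x; exact: poisson_ge0.
  - by move=> n; apply: continuous_rintegrable => x _; exact: poisson_continuous.
  - move=> n; rewrite poisson_rint// ler_wpM2l ?invr_ge0 ?ltW//.
    have := atan_ltpi2 ((n%:R - t) / s); have := atan_gtNpi2 ((- n%:R - t) / s).
    lra.
split => //; have c1 := cvg_rint_sym ip.
have toy u : ((n%:R - u) / s : R) @[n --> \oo] --> +oo.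
  apply/cvgryPge => A; near=> n.
  rewrite ler_pdivlMr// lerBrDr; near: n; exact: nbhs_infty_ger.
have c2 u : atan ((n%:R - u) / s) @[n --> \oo] --> (pi / 2 : R).
  exact: cvg_comp (toy u) (@cvgy_atan R).
have c3 : atan ((- n%:R - t) / s) @[n --> \oo] --> (- (pi / 2) : R).
  rewrite (_ : (fun _ => _) = (fun n : nat => - atan ((n%:R - (- t)) / s))).
    exact: cvgN (c2 _).
  by apply/funext => n; rewrite -atanN; congr atan; ring.
have c4 : rint (sym_itv n) (poisson s t) @[n --> \oo] --> s^-1 * (pi / 2 - - (pi / 2)).
  rewrite (_ : (fun _ => _) = (fun n : nat => s^-1 *
    (atan ((n%:R - t) / s) - atan ((- n%:R - t) / s)))).
    by apply: cvgM; [exact: cvg_cst|exact: cvgB (c2 t) c3].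
  by apply/funext => n; rewrite poisson_rint.
rewrite (cvg_unique _ c1 c4)// opprK mulrC; field.
by rewrite gt_eqF.
Unshelve. all: by end_near. Qed.

Definition line (w : R) : C := 1 +i* w.

Lemma line_ccontinuous : ccontinuous line.
Proof. by move=> w; split; [exact: cvg_cst|exact: cvg_id]. Qed.

Lemma line_neq (p : C) w : Re p != 1 -> line w - p != 0.
Proof. by move=> p1; rewrite subr_eq0; apply: contra_neq p1 => <-. Qed.

Lemma rnorm_line (p : C) w :
  rnorm (line w - p) ^- 2 = poisson `|1 - Re p| (Im p) w.
Proof. by rewrite rnorm_sqr /poisson ReD ImD ReN ImN /= real_normK ?num_real. Qed.

Lemma cintegrable_line2 (f : R -> C) (M : R) (p q : C) :
  Re p != 1 -> Re q != 1 -> cmeasurable setT f -> (forall w, rnorm (f w) <= M) ->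
  cintegrable setT (fun w => f w / ((line w - p) * (line w - q))).
Proof.
move=> p1 q1 mf fM.
have i (u : C) : Re u != 1 -> rintegrable setT (poisson `|1 - Re u| (Im u)).
  move=> u1; have : 0 < `|1 - Re u| by rewrite normr_gt0 subr_eq0 eq_sym.
  by move=> /poisson_integral => /(_ (Im u))[].
apply: (@cintegrable_le _ setT measurableT _
  (fun w => M * (poisson `|1 - Re p| (Im p) w + poisson `|1 - Re q| (Im q) w))).
- apply: cmeasurableM => //; apply: ccontinuous_cmeasurable => // w.
  apply: ccontinuous_atV; last by rewrite mulf_neq0 ?line_neq.
  by apply: ccontinuous_atM; apply: ccontinuous_atB;
    (exact: line_ccontinuous || exact: ccontinuous_at_cst).
- by apply: rintegrableZ => //; apply: rintegrableD => //; exact: i.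
- move=> w _; rewrite rnormM ler_pM ?rnorm_ge0//.
  rewrite rnormV rnormM -!rnorm_line invfM -!exprVn.
  set a := (rnorm _)^-1; set b := (rnorm _)^-1.
  have a0 : 0 <= a by rewrite invr_ge0 rnorm_ge0.
  have b0 : 0 <= b by rewrite invr_ge0 rnorm_ge0.
  by nra.
Qed.

Lemma derivable_sub (p x : C) : derivable ((fun y => y - p) : C^o -> C^o) x 1.
Proof.
by apply: (@derivableB _ C^o C^o id (cst p)); [exact: derivable_id|exact: derivable_cst].
Qed.

Lemma boundary_integrableB (F G : C -> C) x0 x1 y0 y1 :
  boundary_integrable F x0 x1 y0 y1 -> boundary_integrable G x0 x1 y0 y1 ->
  boundary_integrable (fun z => F z - G z) x0 x1 y0 y1.
Proof.
by move=> [a b c d] [e f g h]; split; exact: cintegrableB.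
Qed.

Lemma boxintB (F G : C -> C) x0 x1 y0 y1 :
  boundary_integrable F x0 x1 y0 y1 -> boundary_integrable G x0 x1 y0 y1 ->
  boxint (fun z => F z - G z) x0 x1 y0 y1 =
    boxint F x0 x1 y0 y1 - boxint G x0 x1 y0 y1.
Proof.
by move=> [a b c d] [e f g h]; rewrite /boxint /hint /vint !cintB//; ring.
Qed.

Section CauchyFormula.
Variables (G : C -> C) (M : R).
Hypothesis dG : forall z, 0 < Re z -> derivable (G : C^o -> C^o) z 1.
Hypothesis bG : forall z, 0 < Re z -> rnorm (G z) <= M.

(* Mirror image of s in the line Re = 1. *)
Let mirror (s : C) : C := (2 - Re s) +i* Im s.

(* The pole added at the mirror image lies outside of Re >= 1. It makes the
   numerator vanish at s, so that the pole at s is removable, while the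
   integral of the correction over the line is elementary. *)
Let num (s xi : C) := G xi - G s * (s - mirror s) / (xi - mirror s).

Let phi (s xi : C) := num s xi / (xi - s).

Lemma num_derivable s xi : 2 < Re s -> 0 < Re xi ->
  derivable (num s : C^o -> C^o) xi 1.
Proof.
move=> s2 x0; apply: derivableB; first exact: dG.
apply: derivableM; first exact: derivable_cst.
apply: derivableV.
  rewrite subr_eq0; apply: neq_Re => /=; apply/eqP; lra.
exact: derivable_sub.
Qed.

Lemma phi_cdiff s xi : 2 < Re s -> 0 < Re xi -> xi != s -> cdiff (phi s) xi.
Proof.
move=> s2 x0 xs; apply: derivable_cdiff.
apply: derivableM; first exact: num_derivable.
apply: derivableV; first by rewrite subr_eq0.
exact: derivable_sub.
Qed.

Lemma num_self s : 2 < Re s -> num s s = 0.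
Proof.
move=> s2; rewrite /num mulfK ?subrr//.
rewrite subr_eq0; apply: neq_Re => /=; apply/eqP; lra.
Qed.

Lemma phi_box s (L : R) : 2 < Re s -> Re s < 1 + L -> `|Im s| < L ->
  boxint (phi s) 1 (1 + L) (- L) L = 0.
Proof.
move=> s2 sL; rewrite ltr_norml => /andP[iL1 iL2].
have /derivable_cdiff/cdiff_bound[K [r [K0 r0 hK]]] :
    derivable (num s : C^o -> C^o) s 1 by apply: num_derivable => //; lra.
apply: (@boxint_cdiff_punctured _ _ s _ _ _ _ K r) => //.
- by apply/andP; split; lra.
- by apply/andP; split; lra.
- move=> x y /andP[x1 _] _ xs; apply: phi_cdiff => //=; lra.
- move=> w ws wr; have := hK w wr; rewrite num_self// subr0 /phi rnormM rnormV.
  by rewrite ler_pdivrMr// rnorm_neq0// subr_eq0.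
Qed.

Lemma phi_boundary s (L : R) : 2 < Re s -> Re s < 1 + L -> `|Im s| < L ->
  boundary_integrable (phi s) 1 (1 + L) (- L) L.
Proof.
move=> s2 sL; rewrite ltr_norml => /andP[iL1 iL2].
split; [apply: cdiff_hintable|apply: cdiff_hintable|
        apply: cdiff_vintable|apply: cdiff_vintable] => u /andP[u1 u2];
  apply: phi_cdiff => //=; try lra.
- by apply: neq_Im => /=; apply/eqP; lra.
- by apply: neq_Im => /=; apply/eqP; lra.
- by apply: neq_Re => /=; apply/eqP; lra.
- by apply: neq_Re => /=; apply/eqP; lra.
Qed.

(* phi s decays like 1 / xi only; in the difference the leading terms are
   combined into a decay of 1 / xi ^ 2. *)
Let F s z xi := phi s xi - phi z xi.

Lemma phi_expand s z xi : 2 < Re s -> 2 < Re z -> 0 < Re xi -> xi != s -> xi != z ->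
  F s z xi = (s - z) * (G xi / ((xi - s) * (xi - z)))
    - G s * (s - mirror s) * (1 / ((xi - s) * (xi - mirror s)))
    + G z * (z - mirror z) * (1 / ((xi - z) * (xi - mirror z))).
Proof.
move=> s2 z2 x0 xs xz; rewrite /F /phi /num.
have h1 : xi - mirror s != 0.
  by rewrite subr_eq0; apply: neq_Re => /=; apply/eqP; lra.
have h2 : xi - mirror z != 0.
  by rewrite subr_eq0; apply: neq_Re => /=; apply/eqP; lra.
have h3 : xi - s != 0 by rewrite subr_eq0.
have h4 : xi - z != 0 by rewrite subr_eq0.
move: (mirror s) (mirror z) h1 h2 => a b h1 h2.
by field; rewrite h1 h2 h3 h4.
Qed.

Let bound s z := 4 * (rnorm (s - z) * M + rnorm (G s * (s - mirror s))
  + rnorm (G z * (z - mirror z))).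

Lemma far_away (L : R) xi p q : 0 < L -> 2 * rnorm p <= L -> 2 * rnorm q <= L ->
  L <= rnorm xi -> rnorm ((xi - p) * (xi - q))^-1 <= 4 / L ^+ 2.
Proof.
move=> L0 hp hq Lxi.
have far u : 2 * rnorm u <= L -> L / 2 <= rnorm (xi - u).
  by move=> hu; have := rnormD (xi - u) u; rewrite subrK; lra.
rewrite rnormV rnormM.
have -> : 4 / L ^+ 2 = ((L / 2) * (L / 2))^-1 by field; rewrite gt_eqF.
rewrite lef_pV2 ?posrE ?mulr_gt0 ?divr_gt0//; last first.
- by rewrite (lt_le_trans _ (far q hq))// divr_gt0.
- by rewrite (lt_le_trans _ (far p hp))// divr_gt0.
by apply: ler_pM; rewrite ?far// divr_ge0// ltW.
Qed.

Lemma phi_decay s z (L : R) xi : 2 < Re s -> 2 < Re z -> 0 < Re xi ->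
  0 < L -> 2 * rnorm s < L -> 2 * rnorm z < L ->
  2 * rnorm (mirror s) <= L -> 2 * rnorm (mirror z) <= L -> L <= rnorm xi ->
  rnorm (F s z xi) <= bound s z / L ^+ 2.
Proof.
move=> s2 z2 x0 L0 h1 h2 h3 h4 Lxi.
have nn u : 2 * rnorm u < L -> xi != u.
  move=> hu; apply/eqP => xu; move: Lxi; rewrite xu => Lu.
  by have := rnorm_ge0 u; lra.
rewrite phi_expand ?nn//.
rewrite (le_trans (rnormD _ _))// (le_trans (lerD (rnormB _ _) (lexx _)))//.
set e := 4 / L ^+ 2.
have -> : bound s z / L ^+ 2 = rnorm (s - z) * (M * e) + rnorm (G s * (s - mirror s)) * e
    + rnorm (G z * (z - mirror z)) * e.
  by rewrite /bound /e; field; rewrite gt_eqF.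
have far p q : 2 * rnorm p <= L -> 2 * rnorm q <= L ->
    rnorm ((xi - p) * (xi - q))^-1 <= e by move=> *; exact: far_away.
rewrite !lerD//.
- rewrite 2!rnormM ler_wpM2l ?rnorm_ge0//.
  by rewrite ler_pM ?rnorm_ge0 ?bG// far// ltW.
- by rewrite rnormM div1r ler_wpM2l ?rnorm_ge0// far// ltW.
- by rewrite rnormM div1r ler_wpM2l ?rnorm_ge0// far// ltW.
Qed.

(** The integral over a box vanishes, and on its three far sides, of length L,
    the integrand is of size 1 / L ^ 2. *)
Lemma vint_phi s z n : 2 < Re s -> 2 < Re z -> (0 < n)%N ->
  2 * (rnorm s + rnorm (mirror s) + rnorm z + rnorm (mirror z)) < n%:R ->
  rnorm (cint (sym_itv n) (fun w => F s z (line w))) <= 4 * bound s z / n%:R.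
Proof.
move=> s2 z2 n0 hn; set L : R := n%:R.
have L0 : 0 < L by rewrite ltr0n.
have := rnorm_ge0 s; have := rnorm_ge0 z.
have := rnorm_ge0 (mirror s); have := rnorm_ge0 (mirror z) => r1 r2 r3 r4.
have lt_s u : 2 * rnorm u < L -> Re u < 1 + L /\ `|Im u| < L.
  have := rnorm_ge0 u; have := ler_Re u; have := ler_Im u; have := ler_norm (Re u).
  by split; lra.
have [sL1 sL2] : Re s < 1 + L /\ `|Im s| < L by apply: lt_s; rewrite /L; lra.
have [zL1 zL2] : Re z < 1 + L /\ `|Im z| < L by apply: lt_s; rewrite /L; lra.
have bs := phi_boundary s2 sL1 sL2; have bz := phi_boundary z2 zL1 zL2.
have box0 : boxint (F s z) 1 (1 + L) (- L) L = 0.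
  by rewrite /F boxintB// !phi_box// subrr.
have [i1 i2 i3 i4] := boundary_integrableB bs bz.
have decay xi : 0 < Re xi -> L <= rnorm xi -> rnorm (F s z xi) <= bound s z / L ^+ 2.
  by move=> x0 Lx; apply: phi_decay => //; rewrite /L; lra.
have h0 : rnorm (hint (F s z) (- L) 1 (1 + L)) <= bound s z / L ^+ 2 * (1 + L - 1).
  apply: rnorm_cint_le => //; first lra.
  move=> x /andP[x1 _]; apply: decay => /=; first lra.
  by rewrite (le_trans _ (ler_Im _))//= normrN gtr0_norm.
have h1 : rnorm (hint (F s z) L 1 (1 + L)) <= bound s z / L ^+ 2 * (1 + L - 1).
  apply: rnorm_cint_le => //; first lra.
  move=> x /andP[x1 _]; apply: decay => /=; first lra.
  by rewrite (le_trans _ (ler_Im _))//= gtr0_norm.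
have h2 : rnorm (vint (F s z) (1 + L) (- L) L) <= bound s z / L ^+ 2 * (L - - L).
  apply: rnorm_cint_le => //; first lra.
  move=> x _; apply: decay => /=; first lra.
  by rewrite (le_trans _ (ler_Re _))//= gtr0_norm; lra.
have -> : cint (sym_itv n) (fun w => F s z (line w)) = vint (F s z) 1 (- L) L by [].
have i1n : rnorm ('i : C) = 1.
  by rewrite rnormC /= expr0n expr1n add0r sqrtr1.
have -> : vint (F s z) 1 (- L) L =
    - 'i * (hint (F s z) (- L) 1 (1 + L) - hint (F s z) L 1 (1 + L))
    + vint (F s z) (1 + L) (- L) L.
  have ii : ('i : C) * 'i = -1 by rewrite -expr2 sqr_i.
  move: box0; rewrite /boxint; set v0 := vint _ 1 _ _; set v1 := vint _ _ _ _.
  move: (hint _ _ _ _) (hint _ _ _ _) => a b /eqP.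
  rewrite addr_eq0 => /eqP ->; rewrite mulrNN mulrA ii; ring.
rewrite (le_trans (rnormD _ _))// rnormM rnormN i1n mul1r.
rewrite (le_trans (lerD (le_trans (rnormB _ _) (lerD h0 h1)) h2))//.
rewrite le_eqVlt; apply/orP; left; apply/eqP; field.
by rewrite gt_eqF.
Qed.

Lemma G_line_ccontinuous : ccontinuous (fun w => G (line w)).
Proof.
move=> w; apply: (@cdiff_ccontinuous _ _ line) => [u|]; first exact: rnorm_v.
by apply: derivable_cdiff; apply: dG => /=.
Qed.

Lemma mirror_integral s : 2 < Re s ->
  cint setT (fun w => 1 / ((line w - s) * (line w - mirror s))) =
  - (pi / (Re s - 1))%:C.
Proof.
move=> s2; have s1 : 0 < Re s - 1 by lra.
have [ip iE] := poisson_integral (Im s) s1.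
have -> : - (pi / (Re s - 1))%:C = cint setT (fun w => (-1 * poisson (Re s - 1) (Im s) w)%:C).
  have E : rint setT (fun w => -1 * poisson (Re s - 1) (Im s) w) =
    -1 * rint setT (poisson (Re s - 1) (Im s)) by exact: rintZ.
  rewrite (_ : cint _ _ = (rint setT (fun w => -1 * poisson (Re s - 1) (Im s) w))%:C).
    by rewrite E iE mulN1r rmorphN.
  exact: cint_real.
apply: eq_cint => w _.
rewrite /poisson; set d := _ ^+ 2 + _.
have -> : (line w - s) * (line w - mirror s) = (- d)%:C.
  apply: complex_ext; rewrite !(ReM, ImM, ReD, ImD, ReN, ImN) /= /d; ring.
by rewrite mulN1r -invrN fmorphV div1r.
Qed.

(** Cauchy's formula on the line Re = 1 for divided differences, which unlike
    the values of G come with an absolutely convergent kernel. *)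
Lemma cauchy_line s z : 2 < Re s -> 2 < Re z -> s != z ->
  cint setT (fun w => G (line w) / ((s - line w) * (z - line w))) =
  (2 * pi)%:C * ((G s - G z) / (z - s)).
Proof.
move=> s2 z2 sz.
have iG p q : Re p != 1 -> Re q != 1 ->
    cintegrable setT (fun w => G (line w) / ((line w - p) * (line w - q))).
  move=> p1 q1; apply: (@cintegrable_line2 _ M) => //.
    exact: ccontinuous_cmeasurable G_line_ccontinuous.
  by move=> w; apply: bG.
have i1 p q : Re p != 1 -> Re q != 1 ->
    cintegrable setT (fun w => 1 / ((line w - p) * (line w - q))).
  move=> p1 q1; apply: (@cintegrable_line2 (fun=> 1) 1) => //.
  by move=> w; rewrite rnorm1.
have ns : Re s != 1 by rewrite gt_eqF//; lra.
have nz : Re z != 1 by rewrite gt_eqF//; lra.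
have nms : Re (mirror s) != 1 by rewrite lt_eqF//=; lra.
have nmz : Re (mirror z) != 1 by rewrite lt_eqF//=; lra.
have iF : cintegrable setT (fun w => (s - z) * (G (line w) / ((line w - s) * (line w - z)))
    - G s * (s - mirror s) * (1 / ((line w - s) * (line w - mirror s)))
    + G z * (z - mirror z) * (1 / ((line w - z) * (line w - mirror z)))).
  by apply: cintegrableD => //; [apply: cintegrableB|]=> //;
    apply: cintegrableZ => //; first [exact: iG | exact: i1].
have FE w : F s z (line w) = (s - z) * (G (line w) / ((line w - s) * (line w - z)))
    - G s * (s - mirror s) * (1 / ((line w - s) * (line w - mirror s)))
    + G z * (z - mirror z) * (1 / ((line w - z) * (line w - mirror z))).
  by apply: phi_expand => //=; apply: neq_Re; rewrite eq_sym.
have F0 : cint setT (fun w => F s z (line w)) = 0.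
  have iF' : cintegrable setT (fun w => F s z (line w)).
    by under [X in cintegrable _ X]eq_fun do rewrite FE.
  have c1 := cvg_cint_sym iF'.
  apply: rnorm_eq0; apply/eqP; rewrite eq_le rnorm_ge0 andbT.
  have c2 : 4 * bound s z / n%:R @[n --> \oo] --> (4 * bound s z * 0 : R).
    apply: cvgM; first exact: cvg_cst.
    by rewrite -cvg_shiftS; exact: cvg_harmonic.
  rewrite mulr0 in c2.
  have c3 := cvgD c1 c2; rewrite addr0 in c3.
  apply: ler_cvg_to (cvg_cst _) (c3 _) _; near=> n.
  rewrite fctE /=; set I := cint setT _; set In := cint _ _.
  have tri := rnormD (- (In - I)) In.
  rewrite rnormN (_ : - (In - I) + In = I) in tri; last by ring.
  rewrite (le_trans tri)// lerD2l.
  apply: vint_phi => //; near: n; first exact: nbhs_infty_gt.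
  exact: nbhs_infty_gtr.
have := F0; rewrite (eq_cint (fun w _ => FE w)).
have i_1 := iG s z ns nz.
have i_2 := i1 _ _ ns nms; have i_3 := i1 _ _ nz nmz.
have k_1 := cintegrableZ measurable_line (s - z) i_1.
have k_2 := cintegrableZ measurable_line (G s * (s - mirror s)) i_2.
have k_3 := cintegrableZ measurable_line (G z * (z - mirror z)) i_3.
rewrite (cintD measurable_line (cintegrableB measurable_line k_1 k_2) k_3).
rewrite (cintB measurable_line k_1 k_2) (cintZ _ _ i_1)//.
rewrite (cintZ _ _ i_2)// (cintZ _ _ i_3)// !mirror_integral//.
have -> : cint setT (fun w => G (line w) / ((s - line w) * (z - line w))) =
    cint setT (fun w => G (line w) / ((line w - s) * (line w - z))).
  by apply: eq_cint => w _; congr (_ / _); ring.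
have red u : 2 < Re u -> (u - mirror u) * - (pi / (Re u - 1))%:C = - (2 * pi)%:C.
  move=> u2; have u1 : Re u - 1 != 0 by rewrite gt_eqF//; lra.
  apply: complex_ext; rewrite !(ReM, ImM, ReN, ImN, ReD, ImD) /=.
    by rewrite mulrN subrr !mul0r subr0 -[LHS]mulrN; field.
  by rewrite subrr mul0r oppr0 mulr0 addr0.
rewrite -!mulrA !red//; set I := cint _ _ => E.
have sz0 : s - z != 0 by rewrite subr_eq0.
have zs0 : z - s != 0 by rewrite subr_eq0 eq_sym.
apply: (mulfI sz0).
move: E; move: (2 * pi)%:C => k E.
have -> : (s - z) * I = G z * k - G s * k.
  apply/eqP; rewrite -subr_eq0; apply/eqP; rewrite -E; ring.
by field.
Unshelve. all: by end_near. Qed.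

End CauchyFormula.
End WholeLine.

(** * The completion of a pre-Hilbert space *)

(** A semi-inner product: the completion identifies vectors at distance zero. *)
Record preHilbert (R : realType) := PreHilbert {
  ph_sort :> lmodType R[i];
  form : ph_sort -> ph_sort -> R[i];
  form_linearl : forall a u v w, form (a *: u + v) w = a * form u w + form v w;
  form_herm : forall u v, form v u = (form u v)^*;
  form_ge0 : forall u, 0 <= Re (form u u) }.

Section Seminorm.
Variables (R : realType) (P : preHilbert R).
Local Notation C := R[i].
Local Notation d := (@form R P).
Implicit Types u v w : P.

Lemma formDl u v w : d (u + v) w = d u w + d v w.
Proof. by rewrite -[u]scale1r form_linearl mul1r scale1r. Qed.

Lemma form0l w : d 0 w = 0.
Proof. by apply: (@addrI _ (d 0 w)); rewrite -formDl !addr0. Qed.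

Lemma formZl a u w : d (a *: u) w = a * d u w.
Proof. by rewrite -[_ *: _]addr0 form_linearl form0l addr0. Qed.

Lemma formNl u w : d (- u) w = - d u w.
Proof. by rewrite -scaleN1r formZl mulN1r. Qed.

Lemma formBl u v w : d (u - v) w = d u w - d v w.
Proof. by rewrite formDl formNl. Qed.

Lemma formDr w u v : d w (u + v) = d w u + d w v.
Proof. by rewrite form_herm formDl rmorphD /= -!form_herm. Qed.

Lemma formZr w a u : d w (a *: u) = a^* * d w u.
Proof. by rewrite form_herm formZl rmorphM /= -form_herm. Qed.

Lemma formNr w u : d w (- u) = - d w u.
Proof. by rewrite form_herm formNl rmorphN /= -form_herm. Qed.

Lemma formBr w u v : d w (u - v) = d w u - d w v.
Proof. by rewrite formDr formNr. Qed.

Definition sn u : R := Num.sqrt (Re (d u u)).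

Lemma sn_ge0 u : 0 <= sn u.
Proof. exact: sqrtr_ge0. Qed.

Lemma form_self u : d u u = (sn u ^+ 2)%:C.
Proof.
apply: complex_ext => /=; first by rewrite sqr_sqrtr// form_ge0.
have := congr1 (@complex.Im R) (form_herm u u); rewrite ImJ; lra.
Qed.

Lemma form_CS u v : rnorm (d u v) <= sn u * sn v.
Proof.
(* The square of the distance of u from a multiple of v; t is chosen below as
   the minimizer 1 / sn v ^ 2, or arbitrarily large if sn v = 0. *)
have quad (t : R) : 0 <= sn u ^+ 2 - 2 * t * rnorm (d u v) ^+ 2
    + t ^+ 2 * rnorm (d u v) ^+ 2 * sn v ^+ 2.
  have := form_ge0 (u - (t%:C * d u v) *: v).
  rewrite formBl !formBr formZl !formZr formZl (form_herm u v) !form_self.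
  have -> : (t%:C * d u v)^* = t%:C * (d u v)^* by apply: complex_ext; rewrite !(ReJ, ImJ, ReM, ImM) /=; ring.
  have -> : (t%:C * (d u v)^*) * d u v = (t * rnorm (d u v) ^+ 2)%:C.
    by rewrite -mulrA [_^* * _]mulrC mulcJ -rmorphM.
  have -> : t%:C * d u v * (d u v)^* = (t * rnorm (d u v) ^+ 2)%:C.
    by rewrite -mulrA mulcJ -rmorphM.
  have -> : t%:C * (d u v)^* * (t%:C * d u v * (sn v ^+ 2)%:C) =
      (t ^+ 2 * rnorm (d u v) ^+ 2 * sn v ^+ 2)%:C.
    rewrite (_ : _ * _ = t%:C * t%:C * (d u v * (d u v)^*) * (sn v ^+ 2)%:C).
      by rewrite mulcJ -!rmorphM /= expr2.
    ring.
  rewrite !(ReD, ReN) /=; lra.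
have a0 := sn_ge0 u; have b0 := sn_ge0 v; have r0 := rnorm_ge0 (d u v).
move: (rnorm (d u v)) (sn u) (sn v) r0 quad a0 b0 => r a b r0 quad a0 b0.
have [b_0|b_0] := eqVneq b 0.
  rewrite b_0 mulr0; rewrite b_0 in quad.
  rewrite leNgt; apply/negP => rp.
  have r2 : 0 < r ^+ 2 by rewrite exprn_gt0.
  have := quad ((a ^+ 2 + 1) / r ^+ 2).
  rewrite (_ : _ + _ = - (a ^+ 2) - 2); last by field; rewrite gt_eqF.
  have := sqr_ge0 a; lra.
have b2 : 0 < b ^+ 2 by rewrite exprn_gt0// lt_def b_0.
have := quad (b ^- 2).
have -> : a ^+ 2 - 2 * b ^- 2 * r ^+ 2 + b ^- 2 ^+ 2 * r ^+ 2 * b ^+ 2 =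
    (a ^+ 2 * b ^+ 2 - r ^+ 2) / b ^+ 2 by field.
rewrite pmulr_lge0 ?invr_gt0// subr_ge0 -exprMn.
by rewrite ler_pXn2r ?nnegrE// mulr_ge0.
Qed.

(** An element of the completion is the functional w |-> <x, w> on P that a
    limit x of elements of P defines. *)
Definition approximable (F : P -> C^o) :=
  forall e : R, 0 < e -> exists v, forall w, rnorm (F w - d v w) <= e * sn w.

Definition completion_pred : pred (P -> C^o) := fun F => `[< approximable F >].

Lemma completion_predP F : reflect (approximable F) (F \in completion_pred).
Proof. exact: asboolP. Qed.

Lemma completion_submod : submod_closed completion_pred.
Proof.
split.
  apply/completion_predP => e e0; exists 0 => w.
  by rewrite form0l subr0 rnorm0 mulr_ge0 ?sn_ge0 ?ltW.
move=> a F G /completion_predP hF /completion_predP hG; apply/completion_predP.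
move=> e e0; have a1 : 0 < rnorm a + 1 by rewrite ltr_wpDl// rnorm_ge0.
have [u hu] := hF (e / 2 / (rnorm a + 1)) (divr_gt0 (divr_gt0 e0 (ltr0Sn _ 1)) a1).
have [v hv] := hG (e / 2) (divr_gt0 e0 (ltr0Sn _ 1)).
exists (a *: u + v) => w; rewrite form_linearl.
have -> : (a *: F + G) w - (a * d u w + d v w) = a * (F w - d u w) + (G w - d v w).
  by rewrite -[(_ + _) w]/(a * F w + G w); ring.
rewrite (le_trans (rnormD _ _))// rnormM.
have -> : e * sn w = (e / 2) * sn w + (e / 2) * sn w by field.
apply: lerD; last exact: hv.
apply: le_trans (ler_wpM2l (rnorm_ge0 a) (hu w)) _.
rewrite mulrA ler_wpM2r ?sn_ge0// mulrCA ger_pMr ?divr_gt0//.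
by rewrite ler_pdivrMr// mul1r lerDl.
Qed.

End Seminorm.

HB.instance Definition _ (R : realType) (P : preHilbert R) :=
  GRing.isSubmodClosed.Build R[i] (P -> R[i]^o) (@completion_pred R P)
    (completion_submod P).

Record completion (R : realType) (P : preHilbert R) := Completion {
  cval :> P -> R[i]^o;
  _ : cval \in @completion_pred R P }.

HB.instance Definition _ (R : realType) (P : preHilbert R) :=
  [isSub for @cval R P].
HB.instance Definition _ (R : realType) (P : preHilbert R) :=
  [Choice of completion P by <:].
HB.instance Definition _ (R : realType) (P : preHilbert R) :=
  [SubChoice_isSubLmodule of completion P by <:].

Section CompletionNorm.
Variables (R : realType) (P : preHilbert R).
Local Notation C := R[i].
Local Notation d := (@form R P).
Local Notation H := (completion P).
Implicit Types (F G : H) (u v w : P).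

Lemma completion_ext F G : (forall w, F w = G w) -> F = G.
Proof. by move=> FG; apply: val_inj; apply/funext. Qed.

Lemma cvalD F G w : (F + G) w = F w + G w.
Proof. by []. Qed.

Lemma cvalZ (a : C) F w : (a *: F) w = a * F w.
Proof. by []. Qed.

Lemma cvalB F G w : (F - G) w = F w - G w.
Proof. by []. Qed.

Lemma completionP F e : 0 < e ->
  exists v, forall w, rnorm (F w - d v w) <= e * sn w.
Proof. by move=> e0; have /completion_predP/(_ _ e0) := valP F. Qed.

Definition bounds F : set R := [set K | 0 <= K /\ forall w, rnorm (F w) <= K * sn w].

Definition hnorm F : R := locked (inf (bounds F)).

Lemma hnormE F : hnorm F = inf (bounds F).
Proof. by rewrite /hnorm -lock. Qed.

Lemma bounds_nonempty F : bounds F !=set0.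
Proof.
have [v hv] := completionP F ltr01; exists (1 + sn v); split.
  by rewrite addr_ge0// sn_ge0.
move=> w; rewrite -(subrK (d v w) (F w)) (le_trans (rnormD _ _))//.
by rewrite mulrDl lerD ?hv ?form_CS.
Qed.

Lemma bounds_lb F : has_lbound (bounds F).
Proof. by exists 0 => K []. Qed.

Lemma hnorm_ge0 F : 0 <= hnorm F.
Proof. by rewrite hnormE; apply: lb_le_inf; [exact: bounds_nonempty|move=> K []]. Qed.

Lemma hnorm_le F K : 0 <= K -> (forall w, rnorm (F w) <= K * sn w) -> hnorm F <= K.
Proof. by move=> K0 FK; rewrite hnormE; apply: ge_inf => //; exact: bounds_lb. Qed.

Lemma hnormP F w : rnorm (F w) <= hnorm F * sn w.
Proof.
have [w0|w0] := eqVneq (sn w) 0.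
  by have [K [_ /(_ w)]] := bounds_nonempty F; rewrite w0 !mulr0.
have wp : 0 < sn w by rewrite lt_def w0 sn_ge0.
rewrite -ler_pdivrMr// hnormE; apply: lb_le_inf; first exact: bounds_nonempty.
by move=> K [_ hK]; rewrite ler_pdivrMr.
Qed.

Lemma hnormD F G : hnorm (F + G) <= hnorm F + hnorm G.
Proof.
apply: hnorm_le; first by rewrite addr_ge0 ?hnorm_ge0.
move=> w; rewrite cvalD (le_trans (rnormD _ _))// mulrDl.
by rewrite lerD ?hnormP.
Qed.

Lemma hnormZ (a : C) F : hnorm (a *: F) = rnorm a * hnorm F.
Proof.
have le_ b X : hnorm (b *: X) <= rnorm b * hnorm X.
  apply: hnorm_le; first by rewrite mulr_ge0 ?rnorm_ge0 ?hnorm_ge0.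
  by move=> w; rewrite cvalZ rnormM -mulrA ler_wpM2l ?rnorm_ge0 ?hnormP.
apply/eqP; rewrite eq_le le_ /=.
have [->|a0] := eqVneq a 0.
  by rewrite rnorm0 mul0r hnorm_ge0.
rewrite -{1}[F]scale1r -(mulVf a0) -scalerA.
rewrite -ler_pdivlMl ?rnorm_neq0// -rnormV; exact: le_.
Qed.

Lemma hnorm0_eq0 F : hnorm F = 0 -> F = 0.
Proof.
move=> F0; apply: completion_ext => w; apply: rnorm_eq0; apply/eqP.
by rewrite eq_le rnorm_ge0 andbT (le_trans (hnormP _ _))// F0 mul0r.
Qed.

Lemma chnormD F G : (hnorm (F + G))%:C <= (hnorm F)%:C + (hnorm G)%:C.
Proof. by rewrite -rmorphD lecR hnormD. Qed.

Lemma chnormZ (a : C) F : (hnorm (a *: F))%:C = `|a| * (hnorm F)%:C.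
Proof. by rewrite hnormZ rmorphM /= -rnormE. Qed.

Lemma chnorm0_eq0 F : (hnorm F)%:C = 0 :> C -> F = 0.
Proof. by move=> /complexI/hnorm0_eq0. Qed.

End CompletionNorm.

HB.instance Definition _ (R : realType) (P : preHilbert R) :=
  Lmodule_isNormed.Build R[i] (completion P)
    (@chnormD R P) (@chnormZ R P) (@chnorm0_eq0 R P).

Section CompletionTheory.
Variables (R : realType) (P : preHilbert R).
Local Notation C := R[i].
Local Notation d := (@form R P).
Local Notation H := (completion P).
Implicit Types (F G : H) (u v w : P).

Lemma rnormP F w : rnorm (F w) <= rnorm F * sn w.
Proof. exact: hnormP. Qed.

Lemma rnorm_completion_le F K : 0 <= K ->
  (forall w, rnorm (F w) <= K * sn w) -> rnorm F <= K.
Proof. exact: hnorm_le. Qed.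

Lemma emb_subproof v : (d v : P -> C^o) \in @completion_pred R P.
Proof.
apply/completion_predP => e e0; exists v => w.
by rewrite subrr rnorm0 mulr_ge0 ?sn_ge0 ?ltW.
Qed.

Definition emb v : H := Completion (emb_subproof v).

Lemma embE v w : emb v w = d v w.
Proof. by []. Qed.

Lemma emb_is_linear : linear emb.
Proof. by move=> a u v; apply: completion_ext => w; exact: form_linearl. Qed.

HB.instance Definition _ := GRing.isLinear.Build C P H _ emb emb_is_linear.

Lemma rnorm_emb v : rnorm (emb v) = sn v.
Proof.
apply/eqP; rewrite eq_le; apply/andP; split.
  by apply: rnorm_completion_le; [exact: sn_ge0|move=> w; exact: form_CS].
have [->|v0] := eqVneq (sn v) 0; first exact: rnorm_ge0.
have vp : 0 < sn v by rewrite lt_def v0 sn_ge0.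
have := rnormP (emb v) v; rewrite embE form_self rnorm_real.
by rewrite ger0_norm ?sqr_ge0// expr2 ler_pM2r.
Qed.

Lemma emb_dense F e : 0 < e -> exists v, rnorm (F - emb v) <= e.
Proof.
move=> e0; have [v hv] := completionP F e0; exists v.
by apply: rnorm_completion_le => [|w]; [exact: ltW|exact: hv].
Qed.

Lemma cvalB_arg F u v : F (u - v) = F u - F v.
Proof.
apply/eqP; rewrite -subr_eq0; apply/eqP/rnorm_eq0/eqP.
rewrite eq_le rnorm_ge0 andbT.
apply: (@harmonic_le _ _ _ (sn (u - v) + sn u + sn v)) => n; rewrite add0r.
have [x hx] := completionP F (harmonic_gt0 n).
have -> : F (u - v) - (F u - F v) =
    (F (u - v) - d x (u - v)) - (F u - d x u) + (F v - d x v).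
  by rewrite formBr; ring.
rewrite (le_trans (rnormD _ _))// (le_trans (lerD (rnormB _ _) (lexx _)))//.
by rewrite mulrC !mulrDr !lerD ?hx.
Qed.

Lemma cvalZ_arg F a u : F (a *: u) = a^* * F u.
Proof.
apply/eqP; rewrite -subr_eq0; apply/eqP/rnorm_eq0/eqP.
rewrite eq_le rnorm_ge0 andbT.
apply: (@harmonic_le _ _ _ (sn (a *: u) + rnorm a * sn u)) => n; rewrite add0r.
have [x hx] := completionP F (harmonic_gt0 n).
have -> : F (a *: u) - a^* * F u =
    (F (a *: u) - d x (a *: u)) - a^* * (F u - d x u).
  by rewrite formZr; ring.
rewrite (le_trans (rnormB _ _))// rnormM rnormJ [leRHS]mulrC mulrDr lerD ?hx//.
by rewrite mulrCA ler_wpM2l ?rnorm_ge0.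
Qed.

Lemma cvalD_arg F u v : F (u + v) = F u + F v.
Proof. by rewrite -{1}[v]opprK cvalB_arg -(scaleN1r v) cvalZ_arg rmorphN rmorph1 mulN1r opprK. Qed.

(** A Cauchy filter of functionals converges pointwise, and the limit is
    approximable because the convergence is uniform relative to sn. *)
Lemma completion_complete (Phi : set_system H) :
  ProperFilter Phi -> cauchy Phi -> cvg Phi.
Proof.
move=> PF /cauchyP cPhi.
pose r n : R := n.+1%:R^-1.
have r0 n : 0 < r n by rewrite invr_gt0.
have ex_n n : exists x : H, Phi (ball x (r n)%:C).
  by apply: cPhi; rewrite ltcR.
have [Fn hFn] := choice ex_n.
have dist m n : rnorm (Fn m - Fn n) <= r m + r n.
  have [x [hm hn]] := filter_ex (filterI (hFn m) (hFn n)).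
  move: hm hn => /rballP hm /rballP hn.
  by rewrite (le_trans (ler_rnormBD _ x _))// (rnorm_distC x) lerD// ltW.
have rcvg : r @ \oo --> (0 : R) by exact: cvg_harmonic.
have ex_w w : exists l : C, forall n, rnorm (l - Fn n w) <= r n * sn w.
  apply: complex_limit => [m n|].
    rewrite -mulrDl -cvalB (le_trans (rnormP _ _))//.
    by rewrite ler_wpM2r ?sn_ge0.
  by rewrite -(mul0r (sn w)); apply: cvgM => //; exact: cvg_cst.
have [L hL] := choice ex_w.
have rsmall e : 0 < e -> exists n, r n <= e.
  move=> e0; move/cvgrPdist_le : rcvg => /(_ _ e0)[N _ /(_ N (leqnn N))].
  rewrite sub0r normrN ger0_norm; last exact: ltW.
  by move=> rN; exists N.
have Lp : (L : P -> C^o) \in @completion_pred R P.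
  apply/completion_predP => e e0; have e2 : 0 < e / 2 by rewrite divr_gt0.
  have [n rn] := rsmall _ e2; have [v hv] := completionP (Fn n) e2.
  exists v => w; rewrite (le_trans (ler_rnormBD _ (Fn n w) _))//.
  rewrite [e in e * _](splitr e) mulrDl lerD//.
  by rewrite (le_trans (hL _ n))// ler_wpM2r ?sn_ge0.
pose F : H := Completion Lp.
have FFn n : rnorm (F - Fn n) <= r n.
  by apply: rnorm_completion_le => [|w]; [exact: ltW|exact: hL].
apply/cvg_ex; exists F; apply/cvg_ballP => e e0.
have e0' : 0 < Re e by move: e0; rewrite ltcE => /andP[].
have eE : e = (Re e)%:C by rewrite RRe_real// gtr0_real.
have e2 : 0 < Re e / 2 by rewrite divr_gt0.
have [n rn] := rsmall _ e2.
near=> x; rewrite eE; apply/rballP.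
have hx : ball (Fn n) (r n)%:C x by near: x; exact: hFn.
move: hx => /rballP hx.
rewrite (le_lt_trans (ler_rnormBD _ (Fn n) _))// (splitr (Re e)).
by rewrite ler_ltD// ?(le_trans (FFn n))// (lt_le_trans hx).
Unshelve. all: by end_near. Qed.

End CompletionTheory.
HB.instance Definition _ (R : realType) (P : preHilbert R) :=
  Uniform_isComplete.Build (completion P) (@completion_complete R P).

Section CompletionDot.
Variables (R : realType) (P : preHilbert R).
Local Notation C := R[i].
Local Notation d := (@form R P).
Local Notation H := (completion P).
Implicit Types (F G : H) (u v w : P).

Let arith (f e g a b c : R) : a <= f * e -> b <= f * c ->
  f * c <= f * (e + g) -> a + b <= f * g + 2 * f * e.
Proof. move=> h1 h2 h3; lra. Qed.

(** F is Lipschitz on the dense image of P, hence has a limit along any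
    approximation of G. *)
Lemma dot_subproof F G : exists l : C, forall v,
  rnorm (l - F v) <= rnorm F * rnorm (G - emb v).
Proof.
have h n : 0 < n.+1%:R^-1 :> R by rewrite invr_gt0.
have [v hv] := choice (fun n => emb_dense G (h n)).
have Fv x y : rnorm (F x - F y) <= rnorm F * rnorm (emb x - emb y).
  by rewrite -cvalB_arg -raddfB rnorm_emb rnormP.
have [l hl] : exists l : C, forall n, rnorm (l - F (v n)) <= rnorm F * n.+1%:R^-1.
  apply: complex_limit => [m n|].
    rewrite (le_trans (Fv _ _))// -mulrDr ler_wpM2l ?rnorm_ge0//.
    by rewrite (le_trans (ler_rnormBD _ G _))// (rnorm_distC _ G) lerD.
  by rewrite -[X in _ --> X](mulr0 (rnorm F)); apply: cvgM; [exact: cvg_cst|exact: cvg_harmonic].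
exists l => x; apply: (@harmonic_le _ _ _ (2 * rnorm F)) => n.
rewrite (le_trans (ler_rnormBD _ (F (v n)) _))//.
have := hl n; have := hv n; move: (n.+1%:R^-1) => e hve h1.
have h2 := Fv (v n) x; have h3 := ler_rnormBD (emb (v n)) G (emb x).
rewrite (rnorm_distC _ G) in h3; have h5 := rnorm_ge0 F.
have h6 : rnorm F * rnorm (emb (v n) - emb x) <= rnorm F * (e + rnorm (G - emb x)).
  by apply: (ler_wpM2l h5); apply: le_trans h3 _; rewrite lerD2r.
exact: arith h1 h2 h6.
Qed.

Definition dot F G : C := sval (cid (dot_subproof F G)).

Lemma dotP F G v : rnorm (dot F G - F v) <= rnorm F * rnorm (G - emb v).
Proof. by rewrite /dot; case: cid. Qed.

Lemma dot_embr F v : dot F (emb v) = F v.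
Proof.
apply/eqP; rewrite -subr_eq0; apply/eqP/rnorm_eq0/eqP.
rewrite eq_le rnorm_ge0 andbT (le_trans (dotP _ _ v))//.
by rewrite subrr rnorm0 mulr0.
Qed.

(* Identities between inner products hold for the dense image of P, and the
   error of approximating by it is linear in the distance. *)
Lemma approx_eq (x y : C) (K : R) :
  (forall e, 0 < e -> e <= 1 -> rnorm (x - y) <= K * e) -> x = y.
Proof.
move=> h; apply/eqP; rewrite -subr_eq0; apply/eqP/rnorm_eq0/eqP.
rewrite eq_le rnorm_ge0 andbT; apply: (@harmonic_le _ _ _ K) => n; rewrite add0r.
by apply: h; rewrite ?invr_gt0// invf_le1// ler1n.
Qed.

Lemma dot_linearl a F F' G : dot (a *: F + F') G = a * dot F G + dot F' G.
Proof.
apply: (@approx_eq _ _ (rnorm (a *: F + F') + rnorm a * rnorm F + rnorm F')).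
move=> e e0 _; have [v hv] := emb_dense G e0.
have -> : dot (a *: F + F') G - (a * dot F G + dot F' G) =
   (dot (a *: F + F') G - (a *: F + F') v) - a * (dot F G - F v) - (dot F' G - F' v).
  by rewrite cvalD cvalZ; ring.
rewrite (le_trans (rnormB _ _))// !mulrDl lerD//; last first.
  by rewrite (le_trans (dotP _ _ v))// ler_wpM2l ?rnorm_ge0.
rewrite (le_trans (rnormB _ _))// lerD//.
  by rewrite (le_trans (dotP _ _ v))// ler_wpM2l ?rnorm_ge0.
rewrite rnormM -mulrA ler_wpM2l ?rnorm_ge0//.
by rewrite (le_trans (dotP _ _ v))// ler_wpM2l ?rnorm_ge0.
Qed.

Lemma dot_near F G u v e : 0 < e -> e <= 1 ->
  rnorm (F - emb u) <= e -> rnorm (G - emb v) <= e ->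
  rnorm (dot F G - d u v) <= (rnorm F + rnorm G + 1) * e.
Proof.
move=> e0 e1 hu hv; rewrite (le_trans (ler_rnormBD _ (F v) _))//.
have h1 := dotP F G v.
have h2 : rnorm (F v - d u v) <= e * sn v.
  by rewrite -embE -cvalB (le_trans (rnormP _ _))// ler_wpM2r ?sn_ge0.
have h3 : sn v <= rnorm G + 1.
  rewrite -rnorm_emb -(subrK G (emb v)) (le_trans (rnormD _ _))// addrC lerD2l.
  by rewrite rnorm_distC (le_trans hv).
have h4 : rnorm F * rnorm (G - emb v) <= rnorm F * e by rewrite ler_wpM2l ?rnorm_ge0.
have h5 : e * sn v <= e * (rnorm G + 1) by rewrite ler_wpM2l// ltW.
lra.
Qed.

Lemma dot_herm F G : dot G F = (dot F G)^*.
Proof.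
apply: (@approx_eq _ _ (2 * (rnorm F + rnorm G + 1))) => e e0 e1.
have [u hu] := emb_dense F e0; have [v hv] := emb_dense G e0.
have h1 := dot_near e0 e1 hu hv; have h2 := dot_near e0 e1 hv hu.
have := ler_rnormBD (dot G F) (d v u) (dot F G)^*.
have -> : rnorm (d v u - (dot F G)^*) = rnorm (dot F G - d u v).
  by rewrite form_herm -rmorphB rnormJ rnorm_distC.
lra.
Qed.

Lemma dot_self F : dot F F = (rnorm F ^+ 2)%:C.
Proof.
apply: (@approx_eq _ _ (4 * rnorm F + 2)) => e e0 e1.
have [v hv] := emb_dense F e0.
have h1 := dot_near e0 e1 hv hv.
have h2 := ler_rnormBD (dot F F) (d v v) (rnorm F ^+ 2)%:C.
have h3 := ler_rdist F (emb v).
move: h2; rewrite form_self in h1 *; rewrite -rmorphB rnorm_real => h2.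
rewrite rnorm_emb in h3.
have F0 := rnorm_ge0 F; have v0 := sn_ge0 v.
have h4 : `|sn v ^+ 2 - rnorm F ^+ 2| <= e * (2 * rnorm F + 1).
  rewrite subr_sqr normrM distrC ler_pM//; first exact: le_trans hv.
  rewrite ger0_norm ?addr_ge0//.
  by move: (le_trans h3 hv); rewrite ler_norml => /andP[]; lra.
lra.
Qed.

Lemma dot_CS F G : rnorm (dot F G) <= rnorm F * rnorm G.
Proof.
apply: (@harmonic_le _ _ _ (2 * rnorm F)) => n.
have : 0 < n.+1%:R^-1 :> R by rewrite invr_gt0.
move: (n.+1%:R^-1) => e e0; have [v hv] := emb_dense G e0.
have h1 := dotP F G v; have h2 := rnormP F v.
have h3 : sn v <= rnorm G + e.
  rewrite -rnorm_emb -(subrK G (emb v)) (le_trans (rnormD _ _))// addrC lerD2l.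
  by rewrite rnorm_distC.
have h4 := rnormD (dot F G - F v) (F v); rewrite subrK in h4.
have F0 := rnorm_ge0 F.
have h5 : rnorm F * sn v <= rnorm F * (rnorm G + e) by rewrite ler_wpM2l.
have h6 : rnorm F * rnorm (G - emb v) <= rnorm F * e by rewrite ler_wpM2l.
lra.
Qed.

Lemma dot_linearr F a G G' : dot F (a *: G + G') = a^* * dot F G + dot F G'.
Proof.
by rewrite dot_herm dot_linearl rmorphD rmorphM /= -!dot_herm.
Qed.

Lemma dot_bilinear :
  bilinear_for (GRing.Scale.Law.clone _ _ *%R _)
    (GRing.Scale.Law.clone _ _ (Num.conj \; *%R) _) (dot : H -> H -> C).
Proof.
split=> [G a F F'|F a G G'] /=; first exact: dot_linearl.
exact: dot_linearr.
Qed.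

HB.instance Definition _ := bilinear_isBilinear.Build C H H C _ _ dot dot_bilinear.

Lemma dot_hermitian F G : dot F G = (-1) ^+ false * Num.conj (dot G F).
Proof. by rewrite expr0 mul1r; exact: dot_herm. Qed.

HB.instance Definition _ :=
  isHermitianSesquilinear.Build C H false Num.conj dot dot_hermitian.

Lemma dot_gt0 F : F != 0 -> 0 < dot F F.
Proof.
move=> F0; rewrite dot_self ltcR exprn_gt0// lt_def rnorm_ge0 andbT.
by apply: contra_neq F0 => /rnorm_eq0.
Qed.

HB.instance Definition _ := isDotProduct.Build C H dot dot_gt0.

Lemma completion_hilbert : is_hilbert H.
Proof.
exists dot => F; rewrite rnormE -rmorphXn.
exact/esym/dot_self.
Qed.

Lemma dotDl F F' G : dot (F + F') G = dot F G + dot F' G.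
Proof. by rewrite -[F]scale1r dot_linearl mul1r scale1r. Qed.

Lemma dotZl a F G : dot (a *: F) G = a * dot F G.
Proof.
have d0 : dot 0 G = 0.
  by apply: (@addrI _ (dot 0 G)); rewrite -dotDl !addr0.
by rewrite -[_ *: _]addr0 dot_linearl d0 addr0.
Qed.

Lemma dotBl F F' G : dot (F - F') G = dot F G - dot F' G.
Proof. by rewrite -scaleN1r addrC dot_linearl mulN1r addrC. Qed.

End CompletionDot.

Section Lift.
Variables (R : realType) (P : preHilbert R) (A A' : P -> P) (K : R).
Hypothesis adj : forall v w, form (A v) w = form v (A' w).
Hypothesis bndA' : forall w, sn (A' w) <= K * sn w.
Local Notation C := R[i].
Local Notation H := (completion P).

Lemma lift_subproof (F : H) : ((fun w => F (A' w)) : P -> C^o) \in @completion_pred R P.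
Proof.
apply/completion_predP => e e0; have K1 : 0 < `|K| + 1 by rewrite ltr_wpDl.
have [v hv] := completionP F (divr_gt0 e0 K1).
exists (A v) => w; rewrite adj (le_trans (hv _))//.
rewrite (le_trans (ler_wpM2l _ (bndA' w)))//; first by rewrite divr_ge0 ?ltW.
rewrite mulrA ler_wpM2r ?sn_ge0// mulrAC ler_pdivrMr// ler_wpM2l ?ltW//.
by rewrite (le_lt_trans (ler_norm _))// ltrDl.
Qed.

(** The bounded extension of A to the completion. On functionals it is
    composition with the adjoint, so no limit has to be taken. *)
Definition lift (F : H) : H := Completion (lift_subproof F).

Lemma lift_is_linear : linear lift.
Proof. by move=> a F G; apply: completion_ext. Qed.

HB.instance Definition _ := GRing.isLinear.Build C H H _ lift lift_is_linear.

Lemma lift_emb v : lift (emb v) = emb (A v).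
Proof. by apply: completion_ext => w; rewrite embE adj. Qed.

End Lift.

(** * Multiplication operators on the square-integrable functions *)

(* Convergence of errors to zero is always proved by an upper bound. *)
Lemma ge0_cvg0P (R : realType) (T : Type) (F : set_system T) (FF : Filter F)
    (f : T -> R) : (forall x, 0 <= f x) ->
  f @ F --> (0 : R) <-> forall e, 0 < e -> \forall x \near F, f x <= e.
Proof.
move=> f0; split=> [/cvgrPdist_le fF e /fF|fF].
  by apply: filterS => x; rewrite sub0r normrN ger0_norm.
apply/cvgrPdist_le => e /fF; apply: filterS => x.
by rewrite sub0r normrN ger0_norm.
Qed.

Section SquareIntegrable.
Variable R : realType.
Local Notation C := R[i].
Implicit Types (f g : R -> C).

(** Continuous representatives suffice, because the completion supplies the
    remaining elements of L2; products with bounded continuous functions are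
    then measurable because they are continuous. *)
Definition L2c (f : R -> C^o) :=
  ccontinuous f /\ rintegrable [set: R] (fun w => rnorm (f w) ^+ 2).

Definition L2c_pred : pred (R -> C^o) := fun f => `[< L2c f >].

Lemma L2c_predP f : reflect (L2c f) (f \in L2c_pred).
Proof. exact: asboolP. Qed.

Lemma ccontinuous_rnorm2 f : ccontinuous f ->
  measurable_fun [set: R] (fun w => rnorm (f w) ^+ 2).
Proof.
move=> cf; apply: measurable_funX; apply: measurable_rnorm.
exact: ccontinuous_cmeasurable.
Qed.

Lemma L2c_submod : submod_closed L2c_pred.
Proof.
split.
  apply/L2c_predP; split; first by move=> x; exact: ccontinuous_at_cst.
  have -> : (fun w : R => rnorm ((0 : R -> C^o) w) ^+ 2) = fun=> 0.
    by apply/funext => w; rewrite rnorm0 expr0n.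
  exact: rintegrable0.
move=> a f g /L2c_predP[cf jf] /L2c_predP[cg jg]; apply/L2c_predP.
have cafg : ccontinuous (a *: f + g).
  move=> x; apply: ccontinuous_atD => //.
  by apply: ccontinuous_atM => //; exact: ccontinuous_at_cst.
split => //.
apply: (@le_rintegrable _ _ measurable_line _
  (fun w => 2 * (rnorm a ^+ 2 * rnorm (f w) ^+ 2) + 2 * rnorm (g w) ^+ 2)).
- exact: ccontinuous_rnorm2.
- apply: rintegrableD => //; apply: rintegrableZ => //.
  exact: rintegrableZ.
- move=> w _; rewrite ger0_norm ?sqr_ge0//.
  have h : rnorm ((a *: f + g) w) <= rnorm a * rnorm (f w) + rnorm (g w).
    by rewrite -rnormM rnormD.
  have h0 := rnorm_ge0 ((a *: f + g) w).
  have h1 : rnorm ((a *: f + g) w) ^+ 2 <= (rnorm a * rnorm (f w) + rnorm (g w)) ^+ 2.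
    by rewrite ler_pXn2r ?nnegrE// (le_trans h0).
  apply: le_trans h1 _; rewrite -exprMn.
  have := sqr_ge0 (rnorm a * rnorm (f w) - rnorm (g w)); rewrite sqrrB sqrrD; lra.
Qed.

End SquareIntegrable.

HB.instance Definition _ (R : realType) :=
  GRing.isSubmodClosed.Build R[i] (R -> R[i]^o) (@L2c_pred R) (@L2c_submod R).

Record L2fun (R : realType) := L2Fun {
  lval :> R -> R[i]^o;
  _ : lval \in @L2c_pred R }.

HB.instance Definition _ (R : realType) := [isSub for @lval R].
HB.instance Definition _ (R : realType) := [Choice of L2fun R by <:].
HB.instance Definition _ (R : realType) := [SubChoice_isSubLmodule of L2fun R by <:].

Section SquareIntegrableForm.
Variable R : realType.
Local Notation C := R[i].
Implicit Types (f g : L2fun R).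

Lemma L2fun_ext f g : (forall w, f w = g w) -> f = g.
Proof. by move=> fg; apply: val_inj; apply/funext. Qed.

Lemma L2fun_cont f : ccontinuous f.
Proof. by have /L2c_predP[] := valP f. Qed.

Lemma L2fun_int f : rintegrable [set: R] (fun w => rnorm (f w) ^+ 2).
Proof. by have /L2c_predP[] := valP f. Qed.

Lemma lvalB f g w : (f - g) w = f w - g w.
Proof. by []. Qed.

Lemma L2fun_cmeas f : cmeasurable [set: R] f.
Proof. exact/ccontinuous_cmeasurable/L2fun_cont. Qed.

Lemma L2fun_mul_int f g : cintegrable [set: R] (fun w => f w * (g w)^*).
Proof.
apply: (@cintegrable_le _ _ measurable_line _
  (fun w => rnorm (f w) ^+ 2 + rnorm (g w) ^+ 2)).
- by apply: cmeasurableM; [exact: L2fun_cmeas|apply: cmeasurableJ; exact: L2fun_cmeas].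
- by apply: rintegrableD => //; exact: L2fun_int.
- move=> w _; rewrite rnormM rnormJ.
  have := sqr_ge0 (rnorm (f w) - rnorm (g w)); rewrite sqrrB.
  have := mulr_ge0 (rnorm_ge0 (f w)) (rnorm_ge0 (g w)); lra.
Qed.

Definition L2form f g : C := cint [set: R] (fun w => f w * (g w)^*).

Lemma L2form_linear a f g h : L2form (a *: f + g) h = a * L2form f h + L2form g h.
Proof.
have i1 := L2fun_mul_int f h; have i2 := L2fun_mul_int g h.
rewrite -(cintZ measurable_line a i1) -cintD//; last exact: cintegrableZ.
by apply: eq_cint => w _; rewrite mulrA -mulrDl.
Qed.

Lemma L2form_herm f g : L2form g f = (L2form f g)^*.
Proof.
rewrite -(cintJ measurable_line (L2fun_mul_int f g)).
by apply: eq_cint => w _; rewrite rmorphM /= conjcK mulrC.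
Qed.

Lemma L2form_self f : L2form f f = (rint [set: R] (fun w => rnorm (f w) ^+ 2))%:C.
Proof. rewrite -(cint_real measurable_line); apply: eq_cint => w _; by rewrite mulcJ. Qed.

Lemma L2form_ge0 f : 0 <= Re (L2form f f).
Proof. by rewrite L2form_self /=; apply: rint_ge0 => x _; exact: sqr_ge0. Qed.

Definition L2pre : preHilbert R := PreHilbert L2form_linear L2form_herm L2form_ge0.

Lemma sn_L2 (f : L2pre) : sn f ^+ 2 = rint [set: R] (fun w => rnorm (f w) ^+ 2).
Proof. by apply: complexI; rewrite -form_self -L2form_self. Qed.

End SquareIntegrableForm.

Section Multipliers.
Variable R : realType.
Local Notation C := R[i].
Local Notation P := (L2pre R).
Local Notation H := (completion P).

Record multiplier := Multiplier {
  mval :> R -> C;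
  mcont : ccontinuous mval;
  mbound : exists K, forall w, rnorm (mval w) <= K }.

Implicit Types (m k l : multiplier) (f g : P) (F G : H).

Lemma mulm_subproof m f : ((fun w => m w * f w) : R -> C^o) \in @L2c_pred R.
Proof.
have [K hK] := mbound m.
have cmf : ccontinuous (fun w => m w * f w).
  move=> w; apply: ccontinuous_atM; [exact: mcont|exact: L2fun_cont].
apply/L2c_predP; split => //.
apply: (@le_rintegrable _ _ measurable_line _ (fun w => K ^+ 2 * rnorm (f w) ^+ 2)).
- exact: ccontinuous_rnorm2.
- by apply: rintegrableZ => //; exact: L2fun_int.
- move=> w _; rewrite ger0_norm ?sqr_ge0// -exprMn rnormM.
  have K0 : 0 <= K by rewrite (le_trans _ (hK w))// rnorm_ge0.
  by rewrite ler_pXn2r ?nnegrE ?mulr_ge0 ?rnorm_ge0// ler_wpM2r ?rnorm_ge0.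
Qed.

Definition mulm m f : P := L2Fun (mulm_subproof m f).

Lemma mulmE m f w : mulm m f w = m w * f w.
Proof. by []. Qed.

Lemma sn_mulm m f K : (forall w, rnorm (m w) <= K) -> sn (mulm m f) <= K * sn f.
Proof.
move=> hK; have K0 : 0 <= K by rewrite (le_trans _ (hK 0))// rnorm_ge0.
rewrite -(@ler_pXn2r _ 2) ?nnegrE ?mulr_ge0 ?sn_ge0// exprMn !sn_L2.
rewrite -(rintZ measurable_line _ (L2fun_int f)); apply: le_rint => //.
- exact: L2fun_int.
- by apply: rintegrableZ => //; exact: L2fun_int.
- move=> w _; rewrite -exprMn ler_pXn2r ?nnegrE ?mulr_ge0 ?rnorm_ge0//.
  by rewrite rnormM ler_wpM2r ?rnorm_ge0.
Qed.

Lemma conjm_cont m : ccontinuous (fun w => (m w)^*).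
Proof. by move=> w; apply: ccontinuous_atJ; exact: mcont. Qed.

Lemma conjm_bound m : exists K, forall w, rnorm ((m w)^*) <= K.
Proof. by have [K hK] := mbound m; exists K => w; rewrite rnormJ. Qed.

Definition conjm m := Multiplier (conjm_cont m) (conjm_bound m).

Lemma mulm_adj m f g : form (mulm m f) g = form f (mulm (conjm m) g).
Proof.
by apply: eq_cint => w _; rewrite !mulmE rmorphM /= conjcK mulrAC mulrC mulrA.
Qed.

Definition mbnd m : R := sval (cid (mbound m)).

Lemma mbndP m w : rnorm (m w) <= mbnd m.
Proof. by rewrite /mbnd; case: cid => /= K; exact. Qed.

Lemma conjm_sn m f : sn (mulm (conjm m) f) <= mbnd m * sn f.
Proof. by apply: sn_mulm => w; rewrite rnormJ mbndP. Qed.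

(** Multiplication by a bounded continuous function on the Hilbert space;
    all operators below are of this form, so that operator identities reduce
    to pointwise identities of functions. *)
Definition mult m : {linear H -> H} := lift (mulm_adj m) (conjm_sn m).

Lemma multE m F f : mult m F f = F (mulm (conjm m) f).
Proof. by []. Qed.

Lemma mult_emb m f : mult m (emb f) = emb (mulm m f).
Proof. exact: lift_emb. Qed.

Lemma rnorm_mult m F K : (forall w, rnorm (m w) <= K) -> rnorm (mult m F) <= K * rnorm F.
Proof.
move=> hK; have K0 : 0 <= K by rewrite (le_trans _ (hK 0))// rnorm_ge0.
apply: rnorm_completion_le; first by rewrite mulr_ge0 ?rnorm_ge0.
move=> f; rewrite multE; apply: le_trans (rnormP F _) _.
rewrite [K * _]mulrC -mulrA ler_wpM2l ?rnorm_ge0//.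
by apply: sn_mulm => w; rewrite rnormJ.
Qed.

Lemma mult_eq m k F : m =1 k -> mult m F = mult k F.
Proof.
move=> mk; apply: completion_ext => f; rewrite !multE; congr (cval F _).
by apply: L2fun_ext => w; rewrite !mulmE /= mk.
Qed.

Lemma mult_commute m k F : mult m (mult k F) = mult k (mult m F).
Proof.
apply: completion_ext => f; rewrite !multE; congr (cval F _).
by apply: L2fun_ext => w; rewrite !mulmE mulrCA.
Qed.

Lemma cstm_bound (c : C) : exists K : R, forall w : R, rnorm c <= K.
Proof. by exists (rnorm c). Qed.

Definition cstm (c : C) : multiplier :=
  Multiplier (fun x => ccontinuous_at_cst c x) (cstm_bound c).

Lemma mult_cst (c : C) F : mult (cstm c) F = c *: F.
Proof.
apply: completion_ext => f; rewrite cvalZ multE -[in RHS](conjcK c) -cvalZ_arg.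
by congr (cval F _); exact: L2fun_ext.
Qed.

Lemma prodm_cont m k : ccontinuous (fun w => m w * k w).
Proof. by move=> w; apply: ccontinuous_atM; exact: mcont. Qed.

Lemma prodm_bound m k : exists K, forall w, rnorm (m w * k w) <= K.
Proof.
have [K hK] := mbound m; have [L hL] := mbound k; exists (K * L) => w.
by rewrite rnormM ler_pM ?rnorm_ge0.
Qed.

Definition prodm m k : multiplier := Multiplier (prodm_cont m k) (prodm_bound m k).

Lemma mult_prodm m k F : mult m (mult k F) = mult (prodm m k) F.
Proof.
apply: completion_ext => f; rewrite !multE; congr (cval F _).
by apply: L2fun_ext => w; rewrite !mulmE /= rmorphM /=; ring.
Qed.

Lemma linm_cont a m k : ccontinuous (fun w => a * m w + k w).
Proof.
move=> w; apply: ccontinuous_atD; last exact: mcont.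
by apply: ccontinuous_atM; [exact: ccontinuous_at_cst|exact: mcont].
Qed.

Lemma linm_bound a m k : exists K, forall w, rnorm (a * m w + k w) <= K.
Proof.
have [K hK] := mbound m; have [L hL] := mbound k; exists (rnorm a * K + L) => w.
by rewrite (le_trans (rnormD _ _))// lerD// rnormM ler_wpM2l ?rnorm_ge0.
Qed.

Definition linm a m k : multiplier := Multiplier (linm_cont a m k) (linm_bound a m k).

Lemma mult_linm a m k F : mult (linm a m k) F = a *: mult m F + mult k F.
Proof.
apply: completion_ext => f; rewrite cvalD cvalZ !multE.
have -> : mulm (conjm (linm a m k)) f = a^* *: mulm (conjm m) f + mulm (conjm k) f.
  by apply: L2fun_ext => w; rewrite !mulmE /= rmorphD rmorphM /= mulrDl -mulrA.
by rewrite cvalD_arg cvalZ_arg conjcK.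
Qed.

Let arith (a b x K e : R) : a <= K * x -> b <= K * x ->
  x * (4 * (K + 1)) <= e -> 0 <= x -> a + b <= e / 2.
Proof. by move=> h1 h2 h3 x0; lra. Qed.

Lemma split_diff (S T : {linear H -> H}) F G :
  S F - T F = (S (F - G) - T (F - G)) + (S G - T G).
Proof.
by rewrite (raddfB S) (raddfB T) opprB -addrA (addrC (T G - T F)) !subrKA.
Qed.

(** Bounded pointwise convergence of multipliers is strong convergence of the
    operators, by dominated convergence on the dense subspace. *)
Lemma mult_cvg (m_ : nat -> multiplier) m K F :
  (forall n w, rnorm (m_ n w) <= K) -> (forall w, rnorm (m w) <= K) ->
  (forall w, rnorm (m_ n w - m w) @[n --> \oo] --> (0 : R)) ->
  rnorm (mult (m_ n) F - mult m F) @[n --> \oo] --> (0 : R).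
Proof.
move=> hm_ hm cm; have K0 : 0 <= K by rewrite (le_trans _ (hm 0))// rnorm_ge0.
have core f : rnorm (mult (m_ n) (emb f) - mult m (emb f)) @[n --> \oo] --> (0 : R).
  have sqE n : rnorm (mult (m_ n) (emb f) - mult m (emb f)) =
      Num.sqrt (rint [set: R] (fun w => rnorm (m_ n w - m w) ^+ 2 * rnorm (f w) ^+ 2)).
    rewrite !mult_emb -raddfB rnorm_emb -[sn _]ger0_norm ?sn_ge0// -sqrtr_sqr.
    rewrite sn_L2; congr Num.sqrt; apply: eq_rint => w _.
    by rewrite lvalB !mulmE -mulrBl rnormM exprMn.
  rewrite (_ : (fun _ => _) = (fun n => Num.sqrt (rint [set: R]
    (fun w => rnorm (m_ n w - m w) ^+ 2 * rnorm (f w) ^+ 2)))); last first.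
    by apply/funext => n; exact: sqE.
  rewrite -[X in _ --> X](sqrtr0 R).
  apply: continuous_cvg; first exact: sqrt_continuous.
  apply: (@rint_abs_DCT _ _ measurable_line _ (fun w => (2 * K) ^+ 2 * rnorm (f w) ^+ 2)).
  - move=> n; apply: measurable_funM; apply: ccontinuous_rnorm2.
      by move=> w; apply: ccontinuous_atB; exact: mcont.
    exact: L2fun_cont.
  - by apply: rintegrableZ => //; exact: L2fun_int.
  - move=> w _; rewrite -[X in _ --> X](mul0r (rnorm (f w) ^+ 2)).
    apply: cvgM; last exact: cvg_cst.
    rewrite -[X in _ --> X](mul0r 0); rewrite (_ : (fun _ => _) =
      (fun n => rnorm (m_ n w - m w) * rnorm (m_ n w - m w))).
      by apply: cvgM; exact: cm.
    by apply/funext => n; rewrite expr2.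
  - move=> n w _; rewrite ger0_norm; last exact: mulr_ge0 (sqr_ge0 _) (sqr_ge0 _).
    apply: ler_wpM2r; first exact: sqr_ge0.
    rewrite ler_pXn2r ?nnegrE ?rnorm_ge0//; last exact: mulr_ge0.
    by rewrite (le_trans (rnormB _ _))// mulr_natl mulr2n lerD.
apply/ge0_cvg0P => [n|e e0]; first exact: rnorm_ge0.
have K1 : 0 < 4 * (K + 1) by rewrite mulr_gt0// ltr_wpDl.
have [f hf] := emb_dense F (divr_gt0 e0 K1).
have e2 : 0 < e / 2 by rewrite divr_gt0.
have /ge0_cvg0P/(_ _ e2) := core f.
move=> /(_ (fun=> rnorm_ge0 _)); apply: filterS => n hn.
have -> : mult (m_ n) F - mult m F = (mult (m_ n) (F - emb f) - mult m (F - emb f))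
    + (mult (m_ n) (emb f) - mult m (emb f)).
  exact: split_diff.
apply: le_trans (rnormD _ _) _; rewrite (splitr e); apply: lerD => //.
apply: le_trans (rnormB _ _) _.
have h1 := rnorm_mult (F - emb f) (hm_ n); have h2 := rnorm_mult (F - emb f) hm.
rewrite ler_pdivlMr// in hf.
move: h1 h2 hf (rnorm_ge0 (F - emb f)); exact: arith.
Qed.

End Multipliers.

(** * The semigroup exp (t (1 + iw)) and its resolvent *)

Section Exponential.
Variable R : realType.
Local Notation C := R[i].

(** exp (t (1 + iw)) *)
Definition cexp (t w : R) : C := (expR t * cos (t * w)) +i* (expR t * sin (t * w)).

Lemma cexpD s t w : cexp (s + t) w = cexp s w * cexp t w.
Proof.
apply: complex_ext; rewrite ?ReM ?ImM /cexp /= expRD mulrDl ?cosD ?sinD; ring.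
Qed.

Lemma cexp0 w : cexp 0 w = 1.
Proof. by rewrite /cexp mul0r expR0 cos0 sin0 mulr1 mulr0. Qed.

Lemma rnorm_cexp t w : rnorm (cexp t w) = expR t.
Proof.
rewrite rnormC /cexp /= !exprMn -mulrDr cos2Dsin2 mulr1.
by rewrite sqrtr_sqr ger0_norm// expR_ge0.
Qed.

Lemma cexp_contw t : ccontinuous (cexp t).
Proof.
move=> w; split; apply: cvgM; try exact: cvg_cst.
  apply: continuous_comp; last exact: continuous_cos.
  by apply: cvgM; [exact: cvg_cst|exact: cvg_id].
apply: continuous_comp; last exact: continuous_sin.
by apply: cvgM; [exact: cvg_cst|exact: cvg_id].
Qed.

Lemma cexp_contt w : ccontinuous (cexp ^~ w).
Proof.
move=> t; split; apply: cvgM; try exact: continuous_expR.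
  apply: continuous_comp; last exact: continuous_cos.
  by apply: cvgM; [exact: cvg_id|exact: cvg_cst].
apply: continuous_comp; last exact: continuous_sin.
by apply: cvgM; [exact: cvg_id|exact: cvg_cst].
Qed.

Lemma lipschitz1 (f df : R -> R) (x : R) :
  (forall y : R, is_derive y (1 : R) f (df y)) -> (forall y, `|df y| <= 1) ->
  `|f x - f 0| <= `|x|.
Proof.
move=> hd hb; have cf : continuous f.
  move=> y; apply: differentiable_continuous; apply/derivable1_diffP.
  by have [] := hd y.
have [x0|x0] := leP 0 x.
  have [c _ ->] := @MVT_segment R f df 0 x x0 (fun y _ => hd y) (continuous_subspaceT cf).
  by rewrite subr0 normrM ler_piMl.
have [c _ h] := @MVT_segment R f df x 0 (ltW x0) (fun y _ => hd y) (continuous_subspaceT cf).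
by rewrite distrC h sub0r normrM normrN ler_piMl.
Qed.

(** The factor 1 + iw on the right is compensated by one resolvent. *)
Lemma cexp_sub1 h w : 0 <= h -> rnorm (cexp h w - 1) <= 3 * h * expR h * rnorm (line w).
Proof.
move=> h0; have e0 := expR_ge0 h.
have e1 : expR h - 1 <= h * expR h.
  have := expR_ge1Dx (- h); rewrite expRN => k.
  have := ler_wpM2r e0 k; rewrite mulVf ?gt_eqF ?expR_gt0//; lra.
have e2 : 1 <= expR h by have := expR_ge1Dx h; lra.
have l1 : 1 <= rnorm (line w).
  by rewrite (le_trans _ (ler_Re _))//= normr1.
have l2 : `|w| <= rnorm (line w) by exact: ler_Im (line w).
have c1 : `|cos (h * w) - 1| <= h * rnorm (line w).
  rewrite -cos0 (le_trans (@lipschitz1 cos (fun y => - sin y) _ _ _))//.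
    by move=> y; rewrite normrN sin_max.
  by rewrite normrM ger0_norm// ler_wpM2l.
have c2 : `|sin (h * w)| <= h * rnorm (line w).
  rewrite -[sin _]subr0 -sin0 (le_trans (@lipschitz1 sin cos _ _ _))//.
    by move=> y; rewrite cos_max.
  by rewrite normrM ger0_norm// ler_wpM2l.
rewrite (le_trans (rnorm_le _))// !(ReD, ImD, ReN, ImN) /= oppr0 addr0.
rewrite normrM (ger0_norm e0).
have -> : expR h * cos (h * w) - 1 = (expR h - 1) + expR h * (cos (h * w) - 1) by ring.
rewrite (le_trans (lerD (ler_normD _ _) (lexx _)))//.
have e3 : `|expR h - 1| = expR h - 1 by rewrite ger0_norm// subr_ge0.
rewrite e3 !normrM (ger0_norm e0).
have := ler_wpM2l e0 c1; have := ler_wpM2l e0 c2.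
have : h * expR h <= h * expR h * rnorm (line w) by rewrite ler_peMr// mulr_ge0.
lra.
Qed.

(** Dominated convergence is about sequences, and the bounds hold for times
    in ]0, 1] only. *)
Lemma cvg_right0 (f : R -> R) :
  (forall u : nat -> R, (forall n, 0 < u n <= 1) -> u @ \oo --> (0 : R) ->
     f (u n) @[n --> \oo] --> (0 : R)) ->
  f t @[t --> 0^'+] --> (0 : R).
Proof.
move=> hf; apply/cvg_at_rightP => u [up u0].
pose v n := Num.min (u n) 1.
have vu : \forall n \near \oo, u n = v n.
  move/cvgrPdist_lt : u0 => /(_ _ ltr01); apply: filterS => n.
  rewrite sub0r normrN => un; rewrite /v minEle ifT//.
  exact: le_trans (ler_norm _) (ltW un).
have v0 : v @ \oo --> (0 : R).
  apply: cvg_trans u0; apply: near_eq_cvg; apply: filterS vu => n ->//.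
have vp n : 0 < v n <= 1 by rewrite /v lt_min up ltr01 /= ge_min lexx orbT.
apply: cvg_trans (hf v vp v0).
by apply: near_eq_cvg; apply: filterS vu => n ->.
Qed.

Lemma cexp_right0 w : rnorm (cexp t w - 1) @[t --> 0] --> (0 : R).
Proof.
have [c1 c2] := cexp_contt w 0; rewrite cexp0 in c1 c2.
have -> : (fun t => rnorm (cexp t w - 1)) =
    (fun t => Num.sqrt ((Re (cexp t w) - 1) * (Re (cexp t w) - 1)
       + Im (cexp t w) * Im (cexp t w))).
  by apply/funext => t; rewrite rnormC !(ReD, ImD, ReN, ImN) /= oppr0 addr0 !expr2.
rewrite -[X in _ --> X](sqrtr0 R); apply: continuous_cvg; first exact: sqrt_continuous.
have z : (1 - 1) * (1 - 1) + 0 * 0 = 0 :> R by ring.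
rewrite -[X in _ --> X]z; apply: cvgD; apply: cvgM; try exact: c2;
  by apply: cvgB; [exact: c1|exact: cvg_cst].
Qed.

Lemma cexp_derive w :
  rnorm ((t^-1)%:C * (cexp t w - 1) - line w) @[t --> 0^'+] --> (0 : R).
Proof.
have dR : is_derive (0 : R) (1 : R) (fun t => expR t * cos (t * w)) 1.
  apply: is_derive_eq; rewrite /GRing.scale /= !mul0r expR0 cos0 sin0; ring.
have dI : is_derive (0 : R) (1 : R) (fun t => expR t * sin (t * w)) w.
  apply: is_derive_eq; rewrite /GRing.scale /= !mul0r expR0 cos0 sin0; ring.
have quot (f : R -> R) l : is_derive (0 : R) (1 : R) f l ->
    t^-1 * (f t - f 0) @[t --> 0^'+] --> l.
  case=> df <-; have := df; rewrite /derivable => /cvg_ex[/= m hm].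
  have -> : 'D_1 f 0 = m by apply/cvg_lim.
  apply: (@cvg_trans _ (t^-1 *: (f (t *: (1 : R) + 0) - f 0) @[t --> 0^'+])).
    apply: near_eq_cvg; near=> t.
    by rewrite /GRing.scale /= mulr1 addr0.
  exact: cvg_dnbhs_at_right hm.
have qR := quot _ _ dR; have qI := quot _ _ dI.
rewrite mul0r expR0 cos0 mulr1 in qR; rewrite mul0r expR0 sin0 mulr0 in qI.
have -> : (fun t => rnorm ((t^-1)%:C * (cexp t w - 1) - line w)) =
    (fun t => Num.sqrt
      ((t^-1 * (expR t * cos (t * w) - 1) - 1) * (t^-1 * (expR t * cos (t * w) - 1) - 1)
       + (t^-1 * (expR t * sin (t * w) - 0) - w) * (t^-1 * (expR t * sin (t * w) - 0) - w))).
  apply/funext => t; rewrite rnormC !(ReD, ImD, ReN, ImN, ReM, ImM) /= !expr2.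
  by rewrite !mul0r !oppr0 !addr0.
rewrite -[X in _ --> X](sqrtr0 R); apply: continuous_cvg; first exact: sqrt_continuous.
have z : (1 - 1) * (1 - 1) + (w - w) * (w - w) = 0 :> R by ring.
rewrite -[X in _ --> X]z; apply: cvgD; apply: cvgM;
  by apply: cvgB; [exact: qR || exact: qI|exact: cvg_cst].
Unshelve. all: by end_near. Qed.

End Exponential.

Section OperatorFacts.
Variables (R : realType).
Local Notation C := R[i].

Lemma dense_rnormP (V : normedModType C) (S : set V) :
  (forall x (e : R), 0 < e -> exists2 y, S y & rnorm (x - y) < e) -> dense S.
Proof.
move=> hS A [x Ax] Ao; have : nbhs x A by exact: open_nbhs_nbhs.
rewrite -nbhs_ballE => -[e e0 eA].
have e0' : 0 < Re e by move: e0; rewrite /= ltcE => /andP[].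
have eE : e = (Re e)%:C by rewrite RRe_real// gtr0_real.
have [y Sy xy] := hS x (Re e) e0'.
by exists y; split => //; apply: eA; rewrite eE; apply/rballP.
Qed.

Lemma denseP_rnorm (V : normedModType C) (S : set V) : dense S ->
  forall x (e : R), 0 < e -> exists2 y, S y & rnorm (x - y) < e.
Proof.
move=> dS x e e0; have e0' : 0 < e%:C by rewrite ltcR.
have [y [xy Sy]] : (ball x e%:C)^° `&` S !=set0.
  apply: dS; last exact: open_interior.
  by exists x; apply: nbhsx_ballx.
by exists y => //; apply/rballP; exact: interior_subset xy.
Qed.

Lemma linear_continuous (V W : normedModType C) (S : {linear V -> W}) (K : R) :
  (forall x, rnorm (S x) <= K * rnorm x) -> continuous S.
Proof.
move=> hS x; apply/rcvgP.
apply: (@squeeze_cvgr _ _ _ _ (fun=> 0) (fun y => K * rnorm (y - x))).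
- by apply: nearW => y; rewrite rnorm_ge0 /= -raddfB; exact: hS.
- exact: cvg_cst.
- rewrite -[X in _ --> X](mulr0 K); apply: cvgM; first exact: cvg_cst.
  by apply/rcvgP; exact: cvg_id.
Qed.

(** A bounded extension along a dense embedding is unique. *)
Lemma extension_eq (H Hm1 V : completeNormedModType C) (iota : {linear H -> Hm1})
    (f : H -> V) (F : Hm1 -> V) : dense (range iota) -> linear F -> continuous F ->
  (forall x, F (iota x) = f x) -> extension iota f = F.
Proof.
move=> di lF cF Ff; apply: xget_unique => // F' [lF' cF' F'f].
apply/funext => y.
have [x hx] := choice (fun n => let: ex_intro2 z (ex_intro2 t _ tz) yz :=
   denseP_rnorm di y (harmonic_gt0 n) in ex_intro
    (fun t => rnorm (y - iota t) < @harmonic R n) t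
    (eq_ind_r (fun z => rnorm (y - z) < @harmonic R n) yz tz)).
have cx : iota (x n) @[n --> \oo] --> y.
  apply/rcvgP; apply: (@squeeze_cvgr _ _ _ _ (fun=> 0) harmonic).
  - by apply: nearW => n; rewrite rnorm_ge0 /= rnorm_distC ltW.
  - exact: cvg_cst.
  - exact: cvg_harmonic.
have c1 : F (iota (x n)) @[n --> \oo] --> F y by apply: (continuous_cvg _ (cF y)).
have c2 : F' (iota (x n)) @[n --> \oo] --> F' y by apply: (continuous_cvg _ (cF' y)).
have e : (fun n => F' (iota (x n))) = (fun n => F (iota (x n))).
  by apply/funext => n; rewrite Ff F'f.
rewrite e in c2; exact: cvg_unique c2 c1.
Qed.

End OperatorFacts.

Section Semigroup.
Variable R : realType.
Local Notation C := R[i].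
Local Notation H := (completion (L2pre R)).
Implicit Types (m k l : multiplier R) (F : H).

Lemma mult_continuous m : continuous (mult m).
Proof.
by apply: (@linear_continuous _ _ _ _ (mbnd m)) => F; apply: rnorm_mult => w; exact: mbndP.
Qed.

Lemma expm_bound t : exists K : R, forall w, rnorm (cexp t w) <= K.
Proof. by exists (expR t) => w; rewrite rnorm_cexp. Qed.

Definition expm t := Multiplier (@cexp_contw R t) (expm_bound t).

Definition exp_semigroup (t : R) : {linear H -> H} := mult (expm t).

Lemma exp_semigroup_C0 : C0_semigroup exp_semigroup.
Proof.
split.
- by move=> t _; exact: mult_continuous.
- move=> x; rewrite -[RHS]scale1r -mult_cst; apply: mult_eq => w; exact: cexp0.
- by move=> s t x _ _; rewrite /exp_semigroup mult_prodm; apply: mult_eq => w; exact: cexpD.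
- move=> x; apply/rcvgP; apply: cvg_right0 => u hu u0.
  rewrite (_ : (fun n => _) = (fun n => rnorm (mult (expm (u n)) x - mult (cstm 1) x))); last first.
    by apply/funext => n; rewrite mult_cst scale1r.
  apply: (@mult_cvg _ _ _ (expR 1)).
  + by move=> n w /=; rewrite rnorm_cexp ler_expR; case/andP: (hu n).
  + by move=> w /=; rewrite rnorm1 -expR0 ler_expR.
  + move=> w /=; have := @cexp_right0 R w => c.
    exact: (@cvg_comp _ _ _ u (fun t => rnorm (cexp t w - 1)) _ _ _ u0 c).
Qed.

Section Resolvent.
Variables (z : C) (z1 : 1 < Re z).

Lemma line_far w : Re z - 1 <= rnorm (z - line w).
Proof.
rewrite (le_trans _ (ler_Re _))// ReD ReN /=.
exact: ler_norm.
Qed.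

Lemma line_far_gt0 : 0 < Re z - 1. Proof. by rewrite subr_gt0. Qed.

Lemma line_far_neq0 w : z - line w != 0.
Proof.
apply: contraTneq (line_far w) => ->; rewrite rnorm0 -ltNge; exact: line_far_gt0.
Qed.

Lemma rnorm_resm w : rnorm (z - line w)^-1 <= (Re z - 1)^-1.
Proof.
rewrite rnormV lef_pV2 ?posrE ?line_far_gt0//; first exact: line_far.
by rewrite rnorm_neq0// line_far_neq0.
Qed.

Lemma resm_cont : ccontinuous (fun w => (z - line w)^-1).
Proof.
move=> w; apply: ccontinuous_atV; last exact: line_far_neq0.
by apply: ccontinuous_atB; [exact: ccontinuous_at_cst|exact: line_ccontinuous].
Qed.

Definition resm := Multiplier resm_cont (ex_intro _ (Re z - 1)^-1 rnorm_resm).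

(* Resolvent identities between multipliers, with a = 1 + iw. *)
Lemma resm_frac (p : C) w : (p - z) * (z - line w)^-1 + 1 = (p - line w) / (z - line w).
Proof.
have z0 := line_far_neq0 w; apply: (mulIf z0).
by rewrite mulrDl !divfK// mul1r addrA subrK.
Qed.

Definition genresm := linm z resm (cstm (-1)).

Lemma genresmE w : genresm w = line w * (z - line w)^-1.
Proof.
have := resm_frac 0 w; rewrite !sub0r !mulNr => h.
by rewrite -[RHS]opprK -h opprD opprK.
Qed.

Lemma rnorm_genresm w : rnorm (line w) * rnorm (z - line w)^-1 <=
  1 + rnorm z * (Re z - 1)^-1.
Proof.
rewrite -rnormM -genresmE (le_trans (rnormD _ _))//= rnormN rnorm1 addrC lerD2l.
by rewrite rnormM ler_wpM2l ?rnorm_ge0// rnorm_resm.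
Qed.

(** The difference quotient of the semigroup on the range of the resolvent. *)
Definition quotm h : multiplier R :=
  prodm (linm (h^-1)%:C (expm h) (cstm (- (h^-1)%:C))) resm.

Lemma quotmE h w : quotm h w = (h^-1)%:C * (cexp h w - 1) * (z - line w)^-1.
Proof. by rewrite mulrBr mulr1. Qed.

Lemma mult_quotm h F :
  mult (quotm h) F = (h^-1)%:C *: (exp_semigroup h (mult resm F) - mult resm F).
Proof. by rewrite -mult_prodm mult_linm mult_cst scaleNr scalerBr. Qed.

Lemma quotm_le h w : 0 < h <= 1 -> rnorm (quotm h w) <=
  3 * expR 1 * (1 + rnorm z * (Re z - 1)^-1).
Proof.
move=> /andP[h0 h1]; rewrite quotmE.
rewrite !rnormM rnorm_real (ger0_norm (_ : 0 <= h^-1)); last by rewrite invr_ge0 ltW.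
have e1 := cexp_sub1 w (ltW h0); have e2 := rnorm_genresm w.
have e3 : expR h <= expR 1 by rewrite ler_expR.
apply: (@le_trans _ _ (3 * expR h * (rnorm (line w) * rnorm (z - line w)^-1))).
  rewrite [leRHS]mulrA ler_wpM2r ?rnorm_ge0// ler_pdivrMl//.
  by rewrite (_ : h * _ = 3 * h * expR h * rnorm (line w)) ?e1//; ring.
apply: ler_pM => //; rewrite ?mulr_ge0 ?expR_ge0 ?rnorm_ge0//.
by rewrite ler_wpM2l.
Qed.

(** On the range of the resolvent the difference quotients are multiplications
    by functions that converge boundedly, since (1 + iw) / (z - 1 - iw) is
    bounded. *)
Lemma quot_cvg F : mult (quotm h) F @[h --> (0 : R)^'+] --> mult genresm F.
Proof.
apply/rcvgP; apply: cvg_right0 => u hu u0.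
apply: (@mult_cvg _ (fun n => quotm (u n)) _ (3 * expR 1 * (1 + rnorm z * (Re z - 1)^-1))).
- by move=> n w; exact: quotm_le.
- move=> w; rewrite genresmE rnormM (le_trans (rnorm_genresm w))//.
  rewrite ler_peMl//; last by have := expR_ge1Dx (1 : R); lra.
  by rewrite addr_ge0// mulr_ge0 ?rnorm_ge0// invr_ge0 ltW// line_far_gt0.
- move=> w; have c := @cexp_derive R w.
  have u0' : u n @[n --> \oo] --> (0 : R)^'+.
    move=> A hA; have h : \forall n \near \oo, 0 < u n -> A (u n) := u0 _ hA.
    by apply: filterS h => n; apply; case/andP: (hu n).
  have cc := @cvg_comp _ _ _ u
    (fun t => rnorm ((t^-1)%:C * (cexp t w - 1) - line w)) _ _ _ u0' c.
  rewrite (_ : (fun n => _) = (fun n => rnorm (((u n)^-1)%:C * (cexp (u n) w - 1) - line w)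
     * rnorm (z - line w)^-1)); last first.
    by apply/funext => n; rewrite -rnormM quotmE genresmE mulrBl.
  rewrite -[X in _ --> X](mul0r (rnorm (z - line w)^-1)); apply: cvgM; last exact: cvg_cst.
  exact: cc.
Qed.

Lemma generator_limit F :
  (h^-1)%:C *: (exp_semigroup h (mult resm F) - mult resm F) @[h --> (0 : R)^'+]
    --> z *: mult resm F - F.
Proof.
have := @quot_cvg F; rewrite mult_linm mult_cst scaleN1r.
by under eq_fun do rewrite mult_quotm.
Qed.

Lemma resm_dom F : generator_dom exp_semigroup (mult resm F).
Proof. by apply/cvg_ex; exists (z *: mult resm F - F); exact: generator_limit. Qed.

Lemma generator_resm F : generator exp_semigroup (mult resm F) = z *: mult resm F - F.
Proof. by apply: cvg_lim; [exact: norm_hausdorff|exact: generator_limit]. Qed.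

(** The bounded operator mult resm commutes with the difference quotients, so
    it can be applied to the limit that defines the generator. *)
Lemma resm_left x : generator_dom exp_semigroup x ->
  mult resm (z *: x - generator exp_semigroup x) = x.
Proof.
move=> hx; have cx : (h^-1)%:C *: (exp_semigroup h x - x) @[h --> (0 : R)^'+] --> generator exp_semigroup x.
  exact: hx.
have c1 : mult resm ((h^-1)%:C *: (exp_semigroup h x - x)) @[h --> (0 : R)^'+] -->
    mult resm (generator exp_semigroup x).
  by apply: (continuous_cvg _ (@mult_continuous resm (generator exp_semigroup x))).
have e : (fun h => mult resm ((h^-1)%:C *: (exp_semigroup h x - x))) =
   (fun h => (h^-1)%:C *: (exp_semigroup h (mult resm x) - mult resm x)).
  by apply/funext => h; rewrite linearZ linearB /= mult_commute.
rewrite e in c1; have := cvg_unique (@norm_hausdorff _ _) c1 (@generator_limit x).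
by rewrite linearB linearZ /= => ->; rewrite opprB addrCA subrr addr0.
Qed.

Lemma resolvent_unique x y : generator_dom exp_semigroup y /\ z *: y - generator exp_semigroup y = x ->
  y = mult resm x.
Proof. by move=> [dy <-]; rewrite resm_left. Qed.

Lemma resolvent_resm x : generator_dom exp_semigroup (mult resm x) /\
  z *: mult resm x - generator exp_semigroup (mult resm x) = x.
Proof.
split; first exact: resm_dom.
by rewrite generator_resm opprB addrCA subrr addr0.
Qed.

Lemma resolventE x : resolvent exp_semigroup z x = mult resm x.
Proof.
apply: xget_unique; first exact: resolvent_resm.
by move=> y; exact: resolvent_unique.
Qed.

Lemma resolvent_setP : resolvent_set exp_semigroup z.
Proof.
split.
  move=> x; exists (mult resm x); split; first exact: resolvent_resm.
  by move=> y /resolvent_unique ->.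
have -> : resolvent exp_semigroup z = mult resm by apply/funext => x; exact: resolventE.
exact: mult_continuous.
Qed.

End Resolvent.

Lemma beta1 : 1 < Re (2 : C).
Proof. by rewrite ReD /= ltrDl ltr01. Qed.

(** Every element of the completion of H for the norm of (2 - A)^-1 x is
    2 - A applied to an element of H. Hence H itself serves as H_{-1}, with
    (2 - A)^-1 as the embedding of H; the extension of the semigroup is the
    semigroup. *)
Definition embm1 : {linear H -> H} := mult (resm beta1).

Section Approximation.
Variable n : nat.

Lemma apx_gap : n.+1%:R <= Re (n.+1%:R + 2 : C) - 1.
Proof. by rewrite !ReD -(rmorph_nat (real_complex R)) /= addrA addrK lerDl. Qed.

Lemma apx1 : 1 < Re (n.+1%:R + 2 : C).
Proof. by rewrite -subr_gt0 (lt_le_trans _ apx_gap). Qed.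

Lemma rnorm_nat : rnorm (n.+1%:R : C) = n.+1%:R.
Proof. by rewrite -[n.+1%:R](rmorph_nat (real_complex R)) rnorm_real ger0_norm. Qed.

Lemma rnorm_apx w : rnorm (n.+1%:R + 2 - line w : C)^-1 <= n.+1%:R^-1.
Proof.
by rewrite (le_trans (rnorm_resm apx1 w))// lef_pV2 ?posrE ?apx_gap// line_far_gt0 ?apx1.
Qed.

(** Yosida approximation: N (N + 2 - A)^-1 tends to the identity, and its
    values are in the range of (2 - A)^-1. *)
Definition apxm : multiplier R := prodm (cstm n.+1%:R) (resm apx1).

Lemma apxm_le w : rnorm (apxm w) <= 1.
Proof.
by rewrite rnormM rnorm_nat -ler_pdivlMl// mulr1; exact: rnorm_apx.
Qed.

Lemma apxm_range w :
  apxm w = (2 - line w)^-1 * (n.+1%:R * (- n.+1%:R * (n.+1%:R + 2 - line w)^-1 + 1)).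
Proof.
have h := resm_frac apx1 2 w; rewrite opprD addrCA subrr addr0 in h.
rewrite h mulrCA mulKf//; exact: line_far_neq0 beta1 w.
Qed.

Lemma apxm_sub1 w : rnorm (apxm w - 1) <= rnorm (2 - line w) * n.+1%:R^-1.
Proof.
have h := resm_frac apx1 2 w; rewrite opprD addrCA subrr addr0 mulNr in h.
have -> : apxm w - 1 = - ((2 - line w) / (n.+1%:R + 2 - line w)).
  by rewrite -h opprD opprK.
by rewrite rnormN rnormM ler_wpM2l ?rnorm_ge0// rnorm_apx.
Qed.

End Approximation.

Lemma embm1_dense : dense (range embm1).
Proof.
apply: dense_rnormP => x e e0.
have c : rnorm (mult (apxm n) x - mult (cstm 1) x) @[n --> \oo] --> (0 : R).
  apply: (@mult_cvg _ _ _ 1) => [n w|w|w]; rewrite ?apxm_le ?[mval _ _]/= ?rnorm1//.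
  apply: (@squeeze_cvgr _ _ _ _ (fun=> 0) (fun n => rnorm (2 - line w) * n.+1%:R^-1)).
  - by apply: nearW => n; rewrite rnorm_ge0 apxm_sub1.
  - exact: cvg_cst.
  - rewrite -[X in _ --> X](mulr0 (rnorm (2 - line w))).
    by apply: cvgM; [exact: cvg_cst|exact: cvg_harmonic].
move/cvgrPdist_lt : c => /(_ e e0)[N _ /(_ N (leqnn N))].
rewrite mult_cst scale1r sub0r normrN ger0_norm ?rnorm_ge0// => h.
exists (mult (apxm N) x); last by rewrite rnorm_distC.
exists (mult (prodm (cstm N.+1%:R) (linm (- N.+1%:R) (resm (apx1 N)) (cstm 1))) x) => //.
by rewrite /embm1 mult_prodm; apply: mult_eq => w; rewrite apxm_range.
Qed.

Lemma embm1_Hm1 : is_Hm1 exp_semigroup 2 embm1.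
Proof.
split; last exact: embm1_dense.
by move=> x; rewrite (resolventE beta1).
Qed.

Lemma semigroup_m1E t : semigroup_m1 embm1 exp_semigroup t = exp_semigroup t.
Proof.
apply: extension_eq; first exact: embm1_dense.
- exact: linearP.
- exact: mult_continuous.
- by move=> x; exact: mult_commute.
Qed.

Section ResolventM1.
Variables (z : C) (z1 : 1 < Re z).

Definition resm1 : multiplier R := linm (2 - z) (resm z1) (cstm 1).

Lemma resm1E w : resm1 w = (2 - line w) / (z - line w).
Proof. exact: resm_frac. Qed.

Lemma resolvent_m1E : resolvent_m1 embm1 exp_semigroup z = mult resm1.
Proof.
apply: extension_eq; first exact: embm1_dense.
- exact: linearP.
- exact: mult_continuous.
- move=> x; rewrite (resolventE z1) /embm1 mult_prodm; apply: mult_eq => w.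
  by rewrite -[LHS]/(resm1 w * _) resm1E mulrAC mulfV ?mul1r// line_far_neq0// beta1.
Qed.

End ResolventM1.
End Semigroup.

(** * Bessel's inequality and half of Plancherel's theorem *)

Section Bessel.
Variable R : realType.
Local Notation C := R[i].
Local Notation mu := (@lebesgue_measure R).

Lemma rint_split (h : R -> R) (a c b : R) : a <= c <= b ->
  rintegrable `[a, b] h -> rint `[a, b] h = rint `[a, c] h + rint `[c, b] h.
Proof.
move=> acb ih; apply: complexI; rewrite rmorphD /=.
have := @cint_split _ (fun x => (h x)%:C) a c b acb.
by rewrite !(cint_real (measurable_itv _)); apply; exact: cintegrable_real.
Qed.

Lemma rint_shift (h : R -> R) (a : R) : continuous h ->
  rint `[a, a + 1] h = rint `[0, 1] (fun x => h (x + a)).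
Proof.
move=> ch; pose F x := x + a : R.
have dF (x : R) : is_derive x (1 : R) F 1.
  by apply: is_derive_eq; rewrite addr0.
have F1 : derive1 F = fun=> 1.
  by apply/funext => x; rewrite derive1E; have [_ ->] := dF x.
have -> : `[a, a + 1]%classic = `[F 0, F 1]%classic.
  by rewrite /F add0r addrC.
have cF : continuous F by move=> x; apply: cvgD; [exact: cvg_id|exact: cvg_cst].
rewrite /rint /Rintegral (@integration_by_substitution_increasing _ F h 0 1)//.
- by congr fine; apply: eq_integral => x _; rewrite F1 /= mulr1.
- by move=> x y _ _ xy; rewrite /F ltrD2r.
- by rewrite F1 => x _; exact: cvg_cst.
- by rewrite F1; apply/cvg_ex; exists 1; exact: cvg_cst.
- by rewrite F1; apply/cvg_ex; exists 1; exact: cvg_cst.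
- split; first by move=> x _; have [] := dF x.
  + by apply: cvg_at_right_filter; exact: cF.
  + by apply: cvg_at_left_filter; exact: cF.
- exact: continuous_subspaceT.
Qed.

Lemma rintegrable_translate (h : R -> R) (b : R) : continuous h ->
  rintegrable `[0, 1] (fun x => h (x + b)).
Proof.
move=> ch; apply: continuous_rintegrable => x _.
apply: (@continuous_comp _ _ _ (fun x : R => x + b)); last exact: ch.
by apply: cvgD; [exact: cvg_id|exact: cvg_cst].
Qed.

Lemma rintegrable_fold (h : R -> R) (a : R) n : continuous h ->
  rintegrable `[0, 1] (fun x => \sum_(j < n) h (x + (a + j%:R))).
Proof.
move=> ch; elim: n => [|n ih].
  under [X in rintegrable _ X]eq_fun do rewrite big_ord0.
  exact: rintegrable0.
under [X in rintegrable _ X]eq_fun do rewrite big_ord_recr.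
by apply: rintegrableD => //; exact: rintegrable_translate.
Qed.

(** The integral over n unit intervals is one over [0, 1] of the sum of the
    translates. *)
Lemma rint_fold (h : R -> R) (a : R) n : continuous h ->
  rint `[a, a + n%:R] h = rint `[0, 1] (fun x => \sum_(j < n) h (x + (a + j%:R))).
Proof.
move=> ch; elim: n => [|n ih].
  rewrite addr0 /rint set_itv1 Rintegral_set1.
  transitivity (rint `[0 : R, 1] (fun=> 0)); first by rewrite rint_cst// mul0r.
  by apply: eq_rint => x _; rewrite big_ord0.
have cs := @rintegrable_fold h a n ch.
rewrite (@rint_split _ _ (a + n%:R)).
- rewrite ih -natr1 addrA rint_shift// -rintD//; last exact: rintegrable_translate.
  by apply: eq_rint => x _; rewrite big_ord_recr.
- by rewrite lerDl ler0n lerD2l ler_nat leqnSn.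
- by apply: continuous_rintegrable => x _; exact: ch.
Qed.

(** exp (ix) *)
Definition cis (x : R) : C := cos x +i* sin x.

Lemma cisD x y : cis (x + y) = cis x * cis y.
Proof. by apply: complex_ext; rewrite ?ReM ?ImM /= ?cosD ?sinD//; ring. Qed.

Lemma rnorm_cis x : rnorm (cis x) = 1.
Proof. by rewrite rnormC /= cos2Dsin2 sqrtr1. Qed.

Lemma cisJ x : (cis x)^* = cis (- x).
Proof. by apply: complex_ext; rewrite ?ReJ ?ImJ /= ?cosN ?sinN. Qed.

Lemma cis_cont (k c : R) : ccontinuous (fun r => cis ((c - r) * k)).
Proof.
move=> r.
have cl : {for r, continuous (fun r => (c - r) * k)}.
  apply: cvgM; last exact: cvg_cst.
  by apply: cvgB; [exact: cvg_cst|exact: cvg_id].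
split; apply: continuous_comp => //; [exact: continuous_cos|exact: continuous_sin].
Qed.

Lemma cis_lip x y : rnorm (cis x - cis y) <= 2 * `|x - y|.
Proof.
have -> : cis x - cis y = cis y * (cis (x - y) - 1).
  by rewrite mulrBr -cisD mulr1; congr (cis _ - _); ring.
rewrite rnormM rnorm_cis mul1r (le_trans (rnorm_le _))//.
rewrite !(ReD, ImD, ReN, ImN) /= oppr0 addr0 mulr_natl mulr2n lerD//.
  rewrite -cos0 (le_trans (@lipschitz1 _ cos (fun y => - sin y) _ _ _))//.
  by move=> u; rewrite normrN sin_max.
rewrite -[sin _]subr0 -sin0 (le_trans (@lipschitz1 _ sin cos _ _ _))//.
by move=> u; rewrite cos_max.
Qed.

Definition tau : R := 2 * pi.

Lemma tau_gt0 : 0 < tau.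
Proof. by rewrite mulr_gt0// pi_gt0. Qed.

Lemma cis_tau n : cis (tau * n%:R) = 1.
Proof.
elim: n => [|n ih]; first by rewrite mulr0 /cis cos0 sin0.
rewrite -natr1 mulrDr cisD ih mulr1 mul1r /cis /tau mulr_natl.
by rewrite cos2pi sin2pi.
Qed.

Lemma cis_tauB m n : cis (tau * (m%:R - n%:R)) = 1.
Proof.
rewrite mulrBr cisD cis_tau mul1r -cisJ cis_tau; exact: rmorph1.
Qed.

Definition period : set R := `]0, tau[.

Lemma measurable_period : measurable period.
Proof. exact: measurable_itv. Qed.
Local Notation mD := measurable_period.
#[local] Hint Resolve measurable_period : core.

Lemma cont_period (h : R -> R) : continuous h ->
  rintegrable period h /\ rint period h = rint `[0, tau] h.
Proof.
move=> ch; have ih : rintegrable `[0, tau] h by apply: continuous_rintegrable => x _; exact: ch.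
have i1 : rintegrable `]0, tau] h.
  by apply: rintegrableS ih => //; apply: subset_itv; rewrite bnd_simp.
have i2 : rintegrable period h.
  apply: rintegrableS ih => // x; rewrite /period /= !in_itv /= => /andP[x0 x1].
  by rewrite !ltW.
split => //; rewrite /rint /period Rintegral_itv_bndo_bndc//.
exact: Rintegral_itv_obnd_cbnd.
Qed.

Lemma rint_period1 : rint period (fun=> 1) = tau.
Proof.
have [_ ->] := cont_period (fun x => cvg_cst (1 : R)).
by rewrite rint_cst ?mul1r ?subr0// ltW// tau_gt0.
Qed.

Lemma cis_orthogonal m n : m != n ->
  cint period (fun r => cis ((tau - r) * (m%:R - n%:R))) = 0.
Proof.
move=> mn; set k : R := m%:R - n%:R.
have k0 : k != 0 by rewrite subr_eq0 eqr_nat.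
have cc r := @cis_cont k tau r.
have dl (x : R) : is_derive x (1 : R) (fun r => (tau - r) * k) (- k).
  by apply: is_derive_eq; rewrite /GRing.scale /=; ring.
have k1 := cis_tauB m n; rewrite -/k in k1.
have s1 : sin (tau * k) = 0 by move/(congr1 (@complex.Im R)) : k1.
have c1 : cos (tau * k) = 1 by move/(congr1 (@complex.Re R)) : k1.
apply: complex_ext => /=.
  have [_ ->] := cont_period (fun x => proj1 (cc x)).
  pose H r := - k^-1 * sin ((tau - r) * k).
  suff -> : rint `[0, tau] (fun r => Re (cis ((tau - r) * k))) = H tau - H 0.
    by rewrite /H subrr mul0r sin0 subr0 s1 !mulr0 subrr.
  apply: rint_FTC => [|x|x]; first by rewrite ltW// tau_gt0.
    exact: (proj1 (cc x)).
  by apply: is_derive_eq; rewrite /GRing.scale /=; field.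
have [_ ->] := cont_period (fun x => proj2 (cc x)).
pose H r := k^-1 * cos ((tau - r) * k).
suff -> : rint `[0, tau] (fun r => Im (cis ((tau - r) * k))) = H tau - H 0.
  by rewrite /H subrr mul0r cos0 subr0 c1 subrr.
apply: rint_FTC => [|x|x]; first by rewrite ltW// tau_gt0.
  exact: (proj2 (cc x)).
by apply: is_derive_eq; rewrite /GRing.scale /=; field.
Qed.

Definition sqint (u : R -> C) :=
  cmeasurable period u /\ rintegrable period (fun r => rnorm (u r) ^+ 2).

Lemma sqint_mul u v : sqint u -> sqint v -> cintegrable period (fun r => u r * (v r)^*).
Proof.
move=> [mu_ iu] [mv iv].
apply: (@cintegrable_le _ _ mD _ (fun w => rnorm (u w) ^+ 2 + rnorm (v w) ^+ 2)).
- by apply: cmeasurableM => //; exact: cmeasurableJ.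
- exact: rintegrableD.
- move=> w _; rewrite rnormM rnormJ.
  have := sqr_ge0 (rnorm (u w) - rnorm (v w)); rewrite sqrrB.
  have := mulr_ge0 (rnorm_ge0 (u w)) (rnorm_ge0 (v w)); lra.
Qed.

Lemma sqint_bounded v K : cmeasurable period v -> (forall r, rnorm (v r) <= K) -> sqint v.
Proof.
move=> mv vK; split => //.
have [i1 _] := cont_period (fun x => cvg_cst (K ^+ 2)).
apply: (@le_rintegrable _ _ mD _ (fun=> K ^+ 2)) => //.
  by apply: measurable_funX; exact: measurable_rnorm.
move=> x _; rewrite ger0_norm ?sqr_ge0// ler_pXn2r ?nnegrE ?rnorm_ge0//.
by rewrite (le_trans _ (vK x))// rnorm_ge0.
Qed.

Lemma sqintD a u v : sqint u -> sqint v -> sqint (fun r => u r - a * v r).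
Proof.
move=> [mu_ iu] [mv iv].
have m : cmeasurable period (fun r => u r - a * v r).
  by apply: cmeasurableB => //; apply: cmeasurableM => //; exact: cmeasurable_cst.
split=> //.
apply: (@le_rintegrable _ _ mD _
  (fun w => 2 * rnorm (u w) ^+ 2 + 2 * (rnorm a ^+ 2 * rnorm (v w) ^+ 2))).
- by apply: measurable_funX; exact: measurable_rnorm.
- by apply: rintegrableD => //; apply: rintegrableZ => //; exact: rintegrableZ.
- move=> w _; rewrite ger0_norm ?sqr_ge0//.
  have h := rnormB (u w) (a * v w); rewrite rnormM in h.
  have h1 : rnorm (u w - a * v w) ^+ 2 <= (rnorm (u w) + rnorm a * rnorm (v w)) ^+ 2.
    by rewrite ler_pXn2r ?nnegrE ?rnorm_ge0// (le_trans _ h)// rnorm_ge0.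
  apply: le_trans h1 _; rewrite -exprMn.
  have := sqr_ge0 (rnorm (u w) - rnorm a * rnorm (v w)); rewrite sqrrB sqrrD; lra.
Qed.

Let arith (f a e : C) :
  rnorm (f - a * e) ^+ 2 = rnorm f ^+ 2 - 2 * Re (a^* * (f * e^*)) + rnorm a ^+ 2 * rnorm e ^+ 2.
Proof. by rewrite !rnorm_sqr !(ReD, ImD, ReN, ImN, ReM, ImM, ReJ, ImJ); ring. Qed.

(* One step of the Gram-Schmidt process. *)
Lemma project_out f e : sqint f -> sqint e -> (forall r, rnorm (e r) = 1) ->
  rint period (fun r => rnorm (f r - cint period (fun r => f r * (e r)^*) / tau%:C * e r) ^+ 2)
  = rint period (fun r => rnorm (f r) ^+ 2)
    - rnorm (cint period (fun r => f r * (e r)^*)) ^+ 2 / tau.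
Proof.
move=> hf he e1; set c := cint _ _; set a := c / tau%:C.
have ife := sqint_mul hf he.
have [iR _] := cintegrableZ mD (a^*) ife.
have [i1 _] := cont_period (fun x => cvg_cst (rnorm a ^+ 2)).
have -> : rint period (fun r => rnorm (f r - a * e r) ^+ 2) =
  rint period (fun r => (rnorm (f r) ^+ 2 - 2 * Re (a^* * (f r * (e r)^*))) + rnorm a ^+ 2 * 1).
  by apply: eq_rint => r _; rewrite arith// e1 expr1n.
have [_ if2] := hf.
have i3 : rintegrable period (fun r => 2 * Re (a^* * (f r * (e r)^*))) by exact: rintegrableZ.
have [i4 _] := cont_period (fun x => cvg_cst (1 : R)).
rewrite (rintD mD); [|exact: rintegrableB|exact: rintegrableZ].
rewrite (rintB mD)// !(rintZ mD)// rint_period1.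
have -> : rint period (fun r => Re (a^* * (f r * (e r)^*))) = Re (a^* * c).
  by rewrite -(cintZ mD _ ife).
have t0 := tau_gt0.
have aE : a = (tau^-1)%:C * c by rewrite /a mulrC fmorphV.
rewrite aE rnormM rnorm_real ger0_norm ?invr_ge0 ?ltW//.
rewrite exprMn rnorm_sqr !(ReM, ImM, ReJ, ImJ) /=.
by field; rewrite gt_eqF.
Qed.

Definition fourier (u : R -> C) (w : R) : C :=
  cint period (fun r => u r * cis ((tau - r) * w)).

Let e_ (th : R) (j : nat) r : C := (cis ((tau - r) * (th + j%:R)))^*.

Let e_sqint th j : sqint (e_ th j).
Proof.
apply: (@sqint_bounded _ 1); last by move=> r; rewrite rnormJ rnorm_cis.
rewrite /e_; apply: cmeasurableJ; apply: ccontinuous_cmeasurable => //; exact: cis_cont.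
Qed.

(** Bessel's inequality for the orthogonal functions exp (i (th + j) r) on a
    period, by removing one component at a time. *)
Lemma bessel u th n : sqint u ->
  \sum_(j < n) rnorm (fourier u (th + j%:R)) ^+ 2
    <= tau * rint period (fun r => rnorm (u r) ^+ 2).
Proof.
move=> hu; have t0 := tau_gt0.
suff [f [hf fE _]] : exists f, [/\ sqint f,
    rint period (fun r => rnorm (f r) ^+ 2) = rint period (fun r => rnorm (u r) ^+ 2)
      - (\sum_(j < n) rnorm (fourier u (th + j%:R)) ^+ 2) / tau
  & forall m, (n <= m)%N -> cint period (fun r => f r * (e_ th m r)^*) =
      fourier u (th + m%:R)].
  have : 0 <= rint period (fun r => rnorm (f r) ^+ 2).
    by apply: rint_ge0 => x _; exact: sqr_ge0.
  by rewrite fE subr_ge0 ler_pdivrMr// mulrC.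
elim: n => [|n [f [hf fE fm]]].
  exists u; split=> //; first by rewrite big_ord0 mul0r subr0.
  by move=> m _; apply: eq_cint => r _; rewrite conjcK.
pose a := cint period (fun r => f r * (e_ th n r)^*) / tau%:C.
exists (fun r => f r - a * e_ th n r); split.
- by apply: sqintD.
- rewrite project_out// ?fE ?fm//; last by move=> r; rewrite rnormJ rnorm_cis.
  by rewrite big_ord_recr /= mulrDl opprD addrA.
- move=> m nm; rewrite -(fm m (ltnW nm)).
  have i1 := sqint_mul hf (e_sqint th m).
  have i2 := sqint_mul (e_sqint th n) (e_sqint th m).
  transitivity (cint period (fun r => f r * (e_ th m r)^* - a * (e_ th n r * (e_ th m r)^*))).
    by apply: eq_cint => r _; rewrite mulrBl mulrA.
  rewrite (cintB mD)//; last exact: cintegrableZ.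
  rewrite (cintZ mD)//.
  suff -> : cint period (fun r => e_ th n r * (e_ th m r)^*) = 0 by rewrite mulr0 subr0.
  rewrite -(@cis_orthogonal m n) ?gtn_eqF//; apply: eq_cint => r _.
  rewrite /e_ conjcK cisJ -cisD; congr cis; ring.
Qed.

Lemma sqint_int u : sqint u -> cintegrable period u.
Proof.
move=> hu; have h1 : sqint (fun=> 1).
  by apply: (@sqint_bounded _ 1) => [|r]; [exact: cmeasurable_cst|rewrite rnorm1].
by apply: (eq_cintegrable mD _ (sqint_mul hu h1)) => r _; rewrite rmorph1 mulr1.
Qed.

Lemma fourier_integrand u w : sqint u -> cintegrable period (fun r => u r * cis ((tau - r) * w)).
Proof.
move=> hu; apply: (@cintegrable_le _ _ mD _ (fun r => rnorm (u r))).
- apply: cmeasurableM; first exact: hu.1.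
  by apply: ccontinuous_cmeasurable => //; exact: cis_cont.
- exact/cintegrable_rnorm/sqint_int.
- by move=> r _; rewrite rnormM rnorm_cis mulr1.
Qed.

Lemma fourier_le u w : sqint u -> rnorm (fourier u w) <= rint period (fun r => rnorm (u r)).
Proof.
move=> hu; rewrite (le_trans (rnorm_cint mD (fourier_integrand w hu)))//.
apply: le_rint => //; try exact/cintegrable_rnorm/fourier_integrand.
  exact/cintegrable_rnorm/sqint_int.
by move=> r _; rewrite rnormM rnorm_cis mulr1.
Qed.

Lemma fourier_lip u v w : sqint u ->
  rnorm (fourier u v - fourier u w) <=
  2 * tau * rint period (fun r => rnorm (u r)) * `|v - w|.
Proof.
move=> hu; have i1 := fourier_integrand v hu; have i2 := fourier_integrand w hu.
rewrite -(cintB mD)//.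
rewrite (le_trans (rnorm_cint mD _))//; first exact: cintegrableB.
rewrite mulrAC -(rintZ mD); last exact/cintegrable_rnorm/sqint_int.
apply: le_rint => //; first exact/cintegrable_rnorm/cintegrableB.
  exact/rintegrableZ/cintegrable_rnorm/sqint_int.
move=> r; rewrite /period /= in_itv /= => /andP[r0 rt].
rewrite -mulrBr rnormM mulrC ler_wpM2r ?rnorm_ge0//.
rewrite (le_trans (cis_lip _ _))// -mulrBr normrM mulrA ler_wpM2r//.
rewrite ler_wpM2l// ger0_norm; lra.
Qed.

Lemma lip_ccontinuous (f : R -> C) (L : R) :
  (forall v w, rnorm (f v - f w) <= L * `|v - w|) -> ccontinuous f.
Proof.
move=> fL w; apply/ccontinuous_atP.
have c : L * `|y - w| @[y --> w] --> L * `|w - w|.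
  apply: cvgM; first exact: cvg_cst.
  by apply: cvg_norm; apply: cvgB; [exact: cvg_id|exact: cvg_cst].
rewrite subrr normr0 mulr0 in c.
apply: (@squeeze_cvgr _ _ _ _ (fun=> 0) (fun y => L * `|y - w|)).
- by apply: nearW => y; rewrite rnorm_ge0 fL.
- exact: cvg_cst.
- exact: c.
Qed.

Lemma fourier_cont u : sqint u -> ccontinuous (fourier u).
Proof. by move=> hu; apply: lip_ccontinuous => v w; exact: fourier_lip. Qed.

(** The half of Plancherel's theorem that is used: folding the line onto
    [0, 1] reduces it to Bessel's inequality for th + n, n an integer. *)
Lemma plancherel_le u : sqint u ->
  rintegrable setT (fun w => rnorm (fourier u w) ^+ 2) /\
  rint setT (fun w => rnorm (fourier u w) ^+ 2)
    <= tau * rint period (fun r => rnorm (u r) ^+ 2).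
Proof.
move=> hu.
have ch := continuous_rnorm2 (fourier_cont hu).
apply: rintegrableT_bound.
- exact: continuous_measurable_fun.
- by move=> w; exact: sqr_ge0.
- by move=> n; apply: continuous_rintegrable => x _; exact: ch.
- move=> n; rewrite /sym_itv.
  have {2}-> : n%:R = - n%:R + (n + n)%:R :> R by rewrite natrD addKr.
  rewrite rint_fold//.
  set K := tau * _.
  have -> : K = rint `[0 : R, 1] (fun=> K) by rewrite rint_cst// subr0 mulr1.
  apply: le_rint => //.
  + exact: (@rintegrable_fold (fun w => rnorm (fourier u w) ^+ 2)).
  + by apply: continuous_rintegrable => x _; exact: cvg_cst.
  + move=> x _; have := @bessel u (x - n%:R) (n + n) hu.
    by under eq_bigr do rewrite -addrA.
Qed.

End Bessel.

(** * Separability *)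

Section UniformContinuity.
Variable R : realType.

(** Heine-Cantor theorem on a segment. *)
Lemma uniformly_continuous (V : normedZmodType R[i]) (f : R -> V) (a b e : R) :
  (forall x, rnorm (f y - f x) @[y --> x] --> (0 : R)) -> 0 < e ->
  exists2 d, 0 < d & forall x y, a <= x <= b -> `|x - y| <= d -> rnorm (f x - f y) <= e.
Proof.
move=> cf e0.
pose Q (d x : R) := forall y, `|x - y| <= d -> rnorm (f x - f y) <= e.
have /compact_near_coveringP := @segment_compact R a b.
move=> /(_ R (0 : R)^'+ Q _) h.
have : \forall d \near (0 : R)^'+, `[a, b] `<=` Q d.
  apply: h => x _.
  have e2 : 0 < e / 2 by rewrite divr_gt0.
  have /cvgrPdist_le/(_ _ e2) /nbhs_ballP[r /= r0 hr] := cf x.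
  have close y : `|x - y| < r -> rnorm (f y - f x) <= e / 2.
    by move=> xy; have := hr y xy; rewrite sub0r normrN ger0_norm// rnorm_ge0.
  have r2 : 0 < r / 2 by rewrite divr_gt0.
  exists ([set z | `|x - z| < r / 2], [set d : R | d < r / 2]) => /=.
    split; first exact: (@nbhsx_ballx _ _ x (r / 2) r2).
    exact: nbhs_right_lt.
  move=> [z d] /= [xz dr] y zy.
  rewrite (le_trans (ler_rnormBD _ (f x) _))// (splitr e).
  rewrite lerD ?close// 1?rnorm_distC ?close//.
  - by rewrite (lt_trans xz)// ltr_pdivrMr// ltr_pMr// ltr1n.
  - have := ler_distD z x y; lra.
move=> hd; have [d [d0 hd']] := filter_ex (filterI (nbhs_right_gt (0 : R)) hd).
by exists d => // x y xab; exact: hd'.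
Qed.

End UniformContinuity.

Section Separable.
Variable R : realType.
Local Notation C := R[i].
Local Notation P := (L2pre R).
Local Notation H := (completion P).

(** Half-width of an interval, inverse mesh of a grid on it, and approximate
    values at the grid points. *)
Definition code := (nat * nat * seq (rat * rat))%type.

Definition step_value (c : code) (w : R) : C :=
  let p := nth (0, 0) c.2 (Num.truncn ((w + c.1.1%:R) * c.1.2%:R)) in
  ratr p.1 +i* ratr p.2.

Definition tail (f : R -> C) N : R :=
  rint setT (fun w => rnorm (f w) ^+ 2) - rint (sym_itv N) (fun w => rnorm (f w) ^+ 2).

(** The step function with code c is within e of f in a sense that bounds the
    L2-distance of two functions with the same code. *)
Definition coded (e : R) (c : code) (f : P) :=
  tail f c.1.1 <= e /\
  forall w, sym_itv c.1.1 w -> rnorm (f w - step_value c w) ^+ 2 * (2 * c.1.1%:R + 1) <= e.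

Let arith (a b e : R) : a ^+ 2 <= e -> b ^+ 2 <= e -> 0 <= a -> 0 <= b ->
  (a + b) ^+ 2 <= 4 * e.
Proof.
by move=> h1 h2 a0 b0; rewrite sqrrD; have := sqr_ge0 (a - b); rewrite sqrrB; lra.
Qed.

Lemma coded_close e c f g : 0 < e -> coded e c f -> coded e c g ->
  sn (f - g) ^+ 2 <= 8 * e.
Proof.
move=> e0 [tf cf] [tg cg]; rewrite sn_L2.
have m2 := @measurable_sym R c.1.1.
have sub := @subsetT _ (sym_itv c.1.1 : set R).
have ifg := L2fun_int (f - g); have ifx := L2fun_int f; have ig := L2fun_int g.
have idom : rintegrable [set: R] (fun w => 2 * rnorm (f w) ^+ 2 + 2 * rnorm (g w) ^+ 2).
  by apply: rintegrableD => //; exact: rintegrableZ.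
have resS h : rintegrable [set: R] h -> rintegrable (sym_itv c.1.1) h.
  exact: rintegrableS.
have t1 : tail (f - g) c.1.1 <= 2 * tail f c.1.1 + 2 * tail g c.1.1.
  rewrite /tail -subr_ge0.
  have k : rint (sym_itv c.1.1) (fun w => 2 * rnorm (f w) ^+ 2 + 2 * rnorm (g w) ^+ 2 - rnorm ((f - g) w) ^+ 2)
     <= rint setT (fun w => 2 * rnorm (f w) ^+ 2 + 2 * rnorm (g w) ^+ 2 - rnorm ((f - g) w) ^+ 2).
    apply: le_rint_set => //; last exact: rintegrableB.
    move=> w _; rewrite lvalB subr_ge0.
    have h := rnormB (f w) (g w).
    have h1 : rnorm (f w - g w) ^+ 2 <= (rnorm (f w) + rnorm (g w)) ^+ 2.
      by rewrite ler_pXn2r ?nnegrE ?rnorm_ge0// (le_trans _ h)// rnorm_ge0.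
    apply: le_trans h1 _.
    have := sqr_ge0 (rnorm (f w) - rnorm (g w)); rewrite sqrrB sqrrD; lra.
  have expand (D : set R) : measurable D ->
      rint D (fun w => 2 * rnorm (f w) ^+ 2 + 2 * rnorm (g w) ^+ 2 - rnorm ((f - g) w) ^+ 2)
      = 2 * rint D (fun w => rnorm (f w) ^+ 2) + 2 * rint D (fun w => rnorm (g w) ^+ 2)
        - rint D (fun w => rnorm ((f - g) w) ^+ 2).
    move=> mD; have res h : rintegrable [set: R] h -> rintegrable D h.
      by apply: rintegrableS => //; exact: subsetT.
    rewrite (rintB mD (res _ idom) (res _ ifg)) (rintD mD) ?(rintZ mD)//.
    - exact: res.
    - exact: res.
    - exact: (res _ (rintegrableZ measurable_line _ ifx)).
    - exact: (res _ (rintegrableZ measurable_line _ ig)).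
  rewrite (expand _ m2) (expand _ measurable_line) in k; lra.
have t2 : rint (sym_itv c.1.1) (fun w => rnorm ((f - g) w) ^+ 2) <= 4 * e.
  have N1 : 0 < 2 * c.1.1%:R + 1 :> R by rewrite ltr_pwDr// mulr_ge0.
  apply: (@le_trans _ _ (rint (sym_itv c.1.1) (fun=> 4 * (e / (2 * c.1.1%:R + 1))))).
    apply: le_rint => //; first exact: resS.
      by apply: continuous_rintegrable => x _; exact: cvg_cst.
    move=> w hw; have := cf w hw; have := cg w hw; rewrite -!(ler_pdivlMr _ _ N1) => h1 h2.
    have h3 := ler_rnormBD (f w) (step_value c w) (g w).
    rewrite (rnorm_distC (step_value c w)) in h3.
    apply: le_trans (arith h2 h1 (rnorm_ge0 _) (rnorm_ge0 _)).
    by rewrite ler_pXn2r ?nnegrE ?rnorm_ge0// addr_ge0 ?rnorm_ge0.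
  rewrite rint_cst; last by rewrite ge0_cp.
  rewrite opprK -mulrA ler_wpM2l// mulrAC ler_pdivrMr// ler_wpM2l ?(ltW e0)//; lra.
rewrite /tail in t1; rewrite /tail in tf; rewrite /tail in tg; lra.
Qed.

Lemma coded_exists e (f : P) : 0 < e -> exists c, coded e c f.
Proof.
move=> e0.
have /cvgrPdist_le/(_ e e0)[N _ /(_ N (leqnn N)) hN] := cvg_rint_sym (L2fun_int f).
pose L : R := 2 * N%:R + 1.
have L0 : 0 < L by rewrite ltr_pwDr// mulr_ge0.
pose eta := Num.sqrt (e / L).
have eta0 : 0 < eta by rewrite sqrtr_gt0 divr_gt0.
have eta3 : 0 < eta / 3 by rewrite divr_gt0.
have [d d0 hd] := uniformly_continuous (- N%:R) N%:R
  (fun x => proj1 (ccontinuous_atP f x) (@L2fun_cont R f x)) eta3.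
have [m md] : exists m : nat, m.+1%:R^-1 <= d.
  exists (Num.bound d^-1); rewrite invf_ple ?posrE//.
  rewrite ltW// (lt_le_trans (archi_boundP _))// ?invr_ge0 ?(ltW d0)//.
  by rewrite ler_nat.
pose pt (j : nat) : R := - N%:R + j%:R / m.+1%:R.
have approx (x : R) : exists q : rat, `|x - ratr q| <= eta / 3.
  have : x - eta / 3 < x + eta / 3 by lra.
  move=> /rat_in_itvoo[q]; rewrite in_itv /= => /andP[q1 q2]; exists q.
  by rewrite ler_norml; apply/andP; split; lra.
have approx2 j : exists p : rat * rat,
    rnorm (f (pt j) - (ratr p.1 +i* ratr p.2)) <= eta / 3 + eta / 3.
  have [q1 h1] := approx (Re (f (pt j))); have [q2 h2] := approx (Im (f (pt j))).
  exists (q1, q2); rewrite (le_trans (rnorm_le _))//.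
  by rewrite !(ReD, ImD, ReN, ImN) /= lerD.
have [q hq] := choice approx2.
(* At least 2 N (m + 1) + 1 grid points, so that every point of the interval
   has one to its left. *)
exists (N, m.+1, [seq q j | j <- iota 0%N (N + N * m.+1 + N * m.+1 + 1)%N]).
split => /=; first by rewrite /tail (le_trans (ler_norm _)).
move=> w; rewrite /sym_itv /= in_itv /= => /andP[w1 w2].
have m0 : 0 < m.+1%:R :> R by [].
have x0 : 0 <= (w + N%:R) * m.+1%:R by rewrite mulr_ge0//; lra.
have /andP[j1 j2] := truncn_itv x0.
set j := Num.truncn _ in j1 j2.
have jlt : (j < N + N * m.+1 + N * m.+1 + 1)%N.
  rewrite -(ltr_nat R) !natrD natrM (le_lt_trans j1)// mulrDl.
  have := ler_wpM2r (ltW m0) w2; have := ler0n R N; lra.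
have -> : step_value (N, m.+1, [seq q j | j <- iota 0%N (N + N * m.+1 + N * m.+1 + 1)%N]) w
    = ratr (q j).1 +i* ratr (q j).2.
  by rewrite /step_value /= (nth_map 0%N) ?size_iota// nth_iota// add0n.
rewrite -/L -ler_pdivlMr// -[leRHS]sqr_sqrtr; last by rewrite ltW// divr_gt0.
rewrite -/eta ler_pXn2r ?nnegrE ?rnorm_ge0 ?(ltW eta0)//.
have wp : `|w - pt j| <= d.
  apply: le_trans md; rewrite /pt ler_norml.
  have k1 : j%:R / m.+1%:R <= w + N%:R by rewrite ler_pdivrMr.
  have k2 : w + N%:R <= j%:R / m.+1%:R + m.+1%:R^-1.
    have -> : j%:R / m.+1%:R + m.+1%:R^-1 = j.+1%:R / m.+1%:R :> R.
      by rewrite -[j.+1%:R]natr1 mulrDl mul1r.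
    by rewrite ler_pdivlMr// ltW.
  have k3 : 0 < m.+1%:R^-1 :> R by rewrite invr_gt0.
  move: k1 k2 k3; move: (m.+1%:R^-1) (j%:R / _) => u v k1 k2 k3.
  by apply/andP; split; lra.
have := hd w (pt j); rewrite w1 w2 => /(_ isT wp) h1.
have := ler_rnormBD (f w) (f (pt j)) (ratr (q j).1 +i* ratr (q j).2).
have := hq j; lra.
Qed.

(** There are countably many codes, and functions with the same code are close
    to each other, so it suffices to choose one function for each code. *)
Theorem completion_separable : separable H.
Proof.
pose rep (kc : nat * code) : H := emb (xget 0 [set f | coded kc.1.+1%:R^-1 kc.2 f]).
exists (range rep); split.
  exact: sub_countable (card_image_le _ _) (countableP _).
apply: dense_rnormP => x e e0.
have e2 : 0 < e / 2 by rewrite divr_gt0.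
have e3 : 0 < e / 3 by rewrite divr_gt0.
have [f hf] := emb_dense x e2.
pose k := Num.bound (8 / (e / 3) ^+ 2).
have kp : 0 < k.+1%:R^-1 :> R by rewrite invr_gt0.
have [c hc] := coded_exists f kp.
exists (rep (k, c)); first by exists (k, c).
rewrite /rep /=; set g := xget _ _.
have hg : coded k.+1%:R^-1 c g by exact: (xgetI _ hc).
have h := coded_close kp hc hg.
have h' : sn (f - g) <= e / 3.
  rewrite -(@ler_pXn2r _ 2) ?nnegrE ?sn_ge0 ?(ltW e3)// (le_trans h)//.
  rewrite ler_pdivrMr// mulrC -ler_pdivrMr ?exprn_gt0//.
  rewrite (le_trans (ltW (archi_boundP _)))// ?ler_nat//.
  by rewrite divr_ge0// sqr_ge0.
rewrite (le_lt_trans (ler_rnormBD _ (emb f) _))//.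
rewrite -raddfB rnorm_emb; lra.
Qed.

End Separable.

(** * Approximation by simple functions *)

Section SimpleFunctions.
Variable R : realType.
Local Notation C := R[i].
Local Notation mu := (@lebesgue_measure R).
Local Notation D := (@period R).
Local Notation mD := (@measurable_period R).
#[local] Hint Resolve measurable_period : core.

Definition within_period (V : eqType) (s : seq (set R * V)) :=
  forall p, p \in s -> measurable p.1 /\ p.1 `<=` D.

Lemma within_period_cons (V : eqType) p (s : seq (set R * V)) :
  within_period (p :: s) -> (measurable p.1 /\ p.1 `<=` D) /\ within_period s.
Proof.
move=> ts; split; first by apply: ts; rewrite inE eqxx.
by move=> q qs; apply: ts; rewrite inE qs orbT.
Qed.

(** The complex-valued case of simple functions, with ordinary products. *)
Definition cstep (s : seq (set R * C^o)) (x : R) : C :=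
  \sum_(p <- s) (\1_(p.1) x : R)%:C * p.2.

Lemma cstep_cons p s x : cstep (p :: s) x = (\1_(p.1) x : R)%:C * p.2 + cstep s x.
Proof. exact: big_cons. Qed.

Lemma indic_measurable (E : set R) : measurable E ->
  measurable_fun D (\1_E : R -> R).
Proof. by move=> mE; apply: measurable_indic; exact: mE. Qed.

Lemma period_lty (E : set R) : measurable E -> E `<=` D -> (mu E < +oo)%E.
Proof.
move=> mE ED; apply: (@le_lt_trans _ _ (mu D)).
  by apply: le_measure => //; rewrite inE; [exact: mE|exact: mD].
by rewrite /period lebesgue_measure_itv /=; case: ifP => // _; rewrite ltry.
Qed.

Lemma rintegrable_indic (E : set R) : measurable E -> rintegrable D (\1_E : R -> R).
Proof.
move=> mE; have [i1 _] := cont_period (fun x => cvg_cst (1 : R)).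
apply: (@le_rintegrable _ _ mD _ (fun=> 1) (indic_measurable mE) i1).
by move=> x _; rewrite indicE ger0_norm ?ler0n// -[leRHS]/(1%:R) ler_nat leq_b1.
Qed.

Lemma rint_indic (E : set R) : measurable E -> E `<=` D ->
  rint D (\1_E : R -> R) = fine (mu E).
Proof.
move=> mE ED; rewrite /rint /Rintegral (@integral_indic _ _ R mu D mD E mE).
congr (fine (mu _)).
exact: setIidl.
Qed.

Lemma cstep_integral (s : seq (set R * C^o)) : within_period s ->
  cintegrable D (cstep s) /\ cint D (cstep s) = simple_int s.
Proof.
elim: s => [_|p s ih /within_period_cons[[mp pD] ts]].
  rewrite (_ : cstep _ = fun=> 0); last first.
    by apply/funext => x; exact: big_nil.
  by rewrite /simple_int big_nil (cint0 mD); split => //; exact: cintegrable0.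
have [i1 e1] := ih ts.
rewrite (_ : cstep _ = fun x => p.2 * (\1_(p.1) x : R)%:C + cstep s x); last first.
  by apply/funext => x; rewrite cstep_cons mulrC.
have i2 := cintegrable_real (rintegrable_indic mp).
have i3 := cintegrableZ mD p.2 i2.
split; first exact: cintegrableD.
rewrite (cintD mD)// (cintZ mD)// (cint_real mD) rint_indic// e1.
by rewrite /simple_int big_cons mulrC.
Qed.

Import HBSimple.

Lemma simple_approx_real (h : R -> R) (e : R) : rintegrable D h -> 0 < e ->
  exists2 s : seq (set R * C^o), within_period s &
    rint D (fun x => rnorm ((h x)%:C - cstep s x)) <= e.
Proof.
move=> ih e0.
have [g_ [ig _ /fine_cvgP[_ /cvgrPdist_le/(_ _ e0)[N _ /(_ N (leqnn N))]]]] :=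
  @approximation_sfun_integrable _ _ R mu D mD _ ih.
set g := g_ N => hN.
exists [seq (g @^-1` [set y] `&` D, y%:C : C^o) | y <- finmap.enum_fset (fset_set (range g))].
  move=> p /mapP[y _ ->] /=; split; last exact: subIsetr.
  apply: measurableI => //; exact: (measurable_funPTI g (measurable_set1 y)).
have gE x : D x -> cstep [seq (g @^-1` [set y] `&` D, y%:C : C^o)
    | y <- finmap.enum_fset (fset_set (range g))] x = (g x)%:C.
  move=> Dx; rewrite fimfunE fsbig_finite//= raddf_sum /cstep big_map.
  apply: eq_bigr => y _ /=; rewrite indicI /= [\1_D x]indicE mem_set// mulr1.
  by rewrite mulrC rmorphM.
rewrite (@eq_rint _ _ _ (fun x => `|h x - g x|)); last first.
  by move=> x Dx; rewrite gE// -rmorphB rnorm_real.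
move: hN; rewrite sub0r normrN; apply: le_trans.
rewrite /rint /Rintegral; apply: le_trans (ler_norm _) => //.
Qed.

Lemma simple_approx (u : R -> C) (e : R) : cintegrable D u -> 0 < e ->
  exists2 s : seq (set R * C^o), within_period s &
    rint D (fun x => rnorm (u x - cstep s x)) <= e.
Proof.
move=> iu e0; have e2 : 0 < e / 2 by rewrite divr_gt0.
have [s1 t1 h1] := simple_approx_real iu.1 e2.
have [s2 t2 h2] := simple_approx_real iu.2 e2.
pose rot (p : set R * C^o) : set R * C^o := (p.1, 'i * p.2).
have t2' : within_period [seq rot p | p <- s2].
  by move=> p /mapP[q qs ->]; exact: t2 q qs.
exists (s1 ++ [seq rot p | p <- s2]).
  by move=> p; rewrite mem_cat => /orP[/t1//|/t2'].
have sE x : cstep (s1 ++ [seq rot p | p <- s2]) x =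
    cstep s1 x + 'i * cstep s2 x.
  rewrite /cstep big_cat big_map /= mulr_sumr; congr (_ + _).
  by apply: eq_bigr => p _; rewrite /= mulrCA.
have [i1 _] := cstep_integral t1; have [i2 _] := cstep_integral t2.
have i1' : cintegrable D (fun x => (Re (u x))%:C - cstep s1 x).
  by apply: cintegrableB => //; apply: cintegrable_real; exact: iu.1.
have i2' : cintegrable D (fun x => (Im (u x))%:C - cstep s2 x).
  by apply: cintegrableB => //; apply: cintegrable_real; exact: iu.2.
have i3 : cintegrable D (fun x => u x - cstep (s1 ++ [seq rot p | p <- s2]) x).
  apply: cintegrableB => //.
  rewrite (_ : cstep _ = fun x => cstep s1 x + 'i * cstep s2 x); last first.
    by apply/funext => x; exact: sE.
  by apply: cintegrableD => //; exact: cintegrableZ.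
rewrite (splitr e); apply: le_trans (lerD h1 h2).
rewrite -(rintD mD); [|exact: cintegrable_rnorm..].
apply: le_rint => //; first exact: cintegrable_rnorm.
  by apply: rintegrableD => //; exact: cintegrable_rnorm.
move=> x _; rewrite sE.
have -> : u x - (cstep s1 x + 'i * cstep s2 x) =
    ((Re (u x))%:C - cstep s1 x) + 'i * ((Im (u x))%:C - cstep s2 x).
  rewrite mulrBr opprD addrACA; congr (_ + _).
  by apply: complex_ext; rewrite !(ReD, ImD, ReM, ImM) /=; ring.
rewrite (le_trans (rnormD _ _))// lerD2l rnormM.
rewrite (_ : rnorm 'i = 1) ?mul1r// rnormC /=.
by rewrite expr0n add0r expr1n sqrtr1.
Qed.

Section Refinement.

(** The cells partition the positive half-line. *)
Definition cell (n j : nat) : set R := [set r | Num.truncn (r * n.+1%:R) = j /\ 0 < r].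

(* More than tau * (n + 1), hence enough to cover the period. *)
Definition cells n : nat := (Num.truncn (@tau R)).+1 * n.+1.

(** A scalar simple function q, cut along the cells and tagged with the left
    endpoints of the cells. *)
Definition tagged_refine n (q : seq (set R * C^o)) : seq (set R * (C * R)) :=
  [seq (p.1 `&` cell n j, (p.2 : C, j%:R / n.+1%:R)) | p <- q, j <- index_iota 0 (cells n)].

Definition refine (V : normedModType C) (P : R -> V) n q : seq (set R * V) :=
  [seq (x.1, x.2.1 *: P x.2.2) | x <- tagged_refine n q].

Lemma measurable_cell n j : measurable (cell n j).
Proof.
have -> : cell n j = `[j%:R / n.+1%:R, j.+1%:R / n.+1%:R[ `&` `]0, +oo[.
  apply/seteqP; split=> r; rewrite /cell /= !in_itv /= andbT.
    move=> [<- r0]; split => //; rewrite ler_pdivrMr// ltr_pdivlMr//.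
    by apply: truncn_itv; rewrite mulr_ge0// ltW.
  move=> [h r0]; split => //; apply: truncn_def.
  by rewrite -ler_pdivrMr// -ltr_pdivlMr.
exact: measurableI.
Qed.

Lemma tagged_refine_within n q : within_period q -> within_period (tagged_refine n q).
Proof.
move=> tq p /allpairsP[[x j] /= [xq _ ->]] /=; have [mx xD] := tq x xq.
split; first by apply: measurableI => //; exact: measurable_cell.
by move=> r [/xD].
Qed.

Lemma refine_within (V : normedModType C) (P : R -> V) n q :
  within_period q -> within_period (refine P n q).
Proof.
by move=> /(@tagged_refine_within n) tq p /mapP[x /tq h ->].
Qed.

Lemma refine_int (V : normedModType C) (P : R -> V) n q :
  simple_int (refine P n q) =
  \sum_(x <- tagged_refine n q) (((fine (mu x.1))%:C * x.2.1) *: P x.2.2).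
Proof. by rewrite /simple_int big_map; apply: eq_bigr => x _; rewrite scalerA. Qed.

Definition mesh_pt n (r : R) : R := (Num.truncn (r * n.+1%:R))%:R / n.+1%:R.

Lemma mesh_ptP n r : D r -> 0 <= mesh_pt n r <= @tau R /\ `|r - mesh_pt n r| <= n.+1%:R^-1.
Proof.
rewrite /period /= in_itv /= => /andP[r0 rt].
have x0 : 0 <= r * n.+1%:R by rewrite mulr_ge0// ltW.
have /andP[j1 j2] := truncn_itv x0.
have k1 : mesh_pt n r <= r by rewrite /mesh_pt ler_pdivrMr.
have k2 : r <= mesh_pt n r + n.+1%:R^-1.
  have -> : mesh_pt n r + n.+1%:R^-1 = (Num.truncn (r * n.+1%:R)).+1%:R / n.+1%:R.
    by rewrite -[(Num.truncn _).+1%:R]natr1 mulrDl mul1r.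
  by rewrite ler_pdivlMr// ltW.
split; first by rewrite divr_ge0//= (le_trans k1)// ltW.
by rewrite ler_norml; move: (n.+1%:R^-1) k2 (invr_ge0 (n.+1%:R : R)) => e k2 _; apply/andP; split; lra.
Qed.

Lemma mesh_pt_cells n r : D r -> (Num.truncn (r * n.+1%:R) < cells n)%N.
Proof.
rewrite /period /= in_itv /= => /andP[r0 rt].
have x0 : 0 <= r * n.+1%:R by rewrite mulr_ge0// ltW.
have /andP[j1 j2] := truncn_itv x0.
have /andP[_ t2] := truncn_itv (ltW (@tau_gt0 R)).
rewrite -(ltr_nat R) /cells natrM (le_lt_trans j1)// ltr_pM2r//.
exact: lt_trans rt t2.
Qed.

Lemma refine_fun (V : normedModType C) (P : R -> V) n q r : D r ->
  simple_fun (refine P n q) r = cstep q r *: P (mesh_pt n r).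
Proof.
move=> Dr; have Dr0 : 0 < r by move: Dr; rewrite /period /= in_itv /= => /andP[].
rewrite /simple_fun /cstep scaler_suml /refine /tagged_refine.
rewrite big_map big_allpairs_dep /=; apply: eq_bigr => p _.
set j := Num.truncn (r * n.+1%:R).
have jc : j \in index_iota 0 (cells n) by rewrite mem_index_iota mesh_pt_cells.
rewrite (bigD1_seq j jc (iota_uniq _ _)) /=.
rewrite big1 ?addr0.
  rewrite indicI /= [\1_(cell _ _) r]indicE mem_set// mulr1 scalerA.
  by rewrite /mesh_pt -/j.
move=> i ij; rewrite indicI /= [\1_(cell _ _) r]indicE memNset ?mulr0 ?scale0r//.
by move=> [ji _]; move: ij; rewrite -ji eqxx.
Qed.

Variables (V : normedModType C) (P : R -> V) (K : R).
Hypothesis P_cont : forall x, rnorm (P y - P x) @[y --> x] --> (0 : R).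
Hypothesis P_bound : forall r, 0 <= r <= @tau R -> rnorm (P r) <= K.
Variables (u : R -> C) (q : nat -> seq (set R * C^o)).
Hypothesis u_int : cintegrable D u.
Hypothesis q_within : forall n, within_period (q n).
Hypothesis q_approx : forall n,
  rint D (fun x => rnorm (u x - cstep (q n) x)) <= n.+1%:R^-1.

Let K_ge0 : 0 <= K.
Proof.
apply: le_trans (rnorm_ge0 (P 0)) (P_bound _); rewrite lexx /= ltW//.
exact: tau_gt0.
Qed.

Let diff_int n : cintegrable D (fun r => u r - cstep (q n) r).
Proof. by apply: cintegrableB => //; have [] := cstep_integral (@q_within n). Qed.

Let split_error (a b : C) (x y : V) : a *: x - b *: y = (a - b) *: y + a *: (x - y).
Proof. by rewrite scalerBl scalerBr [RHS]addrC addrA subrK. Qed.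

(** P is uniformly continuous, which bounds the error of freezing it at the
    tags; the error of replacing u by its scalar approximations is small in L1. *)
Lemma refine_L1 :
  (forall n, measurable_fun D (fun r => rnorm (u r *: P r - simple_fun (refine P n (q n)) r))) ->
  (forall n, rintegrable D (fun r => rnorm (u r *: P r - simple_fun (refine P n (q n)) r))) /\
  rint D (fun r => rnorm (u r *: P r - simple_fun (refine P n (q n)) r)) @[n --> \oo] --> (0 : R).
Proof.
move=> mf.
have bnd eta n : (forall r, D r -> rnorm (P r - P (mesh_pt n r)) <= eta) ->
    forall r, D r -> rnorm (u r *: P r - simple_fun (refine P n (q n)) r) <=
      K * rnorm (u r - cstep (q n) r) + eta * rnorm (u r).
  move=> hP r Dr; rewrite refine_fun// split_error (le_trans (rnormD _ _))//.
  have [h1 _] := @mesh_ptP n r Dr.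
  rewrite !rnormZ lerD//; first by rewrite mulrC ler_wpM2r ?rnorm_ge0// P_bound.
  by rewrite mulrC ler_wpM2r ?rnorm_ge0// hP.
have ibnd eta n : rintegrable D (fun r => K * rnorm (u r - cstep (q n) r) + eta * rnorm (u r)).
  by apply: rintegrableD => //; apply: rintegrableZ => //; exact: cintegrable_rnorm.
have inn n : rintegrable D (fun r => rnorm (u r *: P r - simple_fun (refine P n (q n)) r)).
  apply: (@le_rintegrable _ _ mD _ _ _ (ibnd (K + K) n)) => // r Dr.
  rewrite ger0_norm ?rnorm_ge0//; apply: bnd => // x Dx.
  have [h1 _] := @mesh_ptP n x Dx.
  rewrite (le_trans (rnormB _ _))// lerD ?P_bound//.
  by move: Dx; rewrite /period /= in_itv /= => /andP[? ?]; rewrite !ltW.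
split => //; apply/ge0_cvg0P => [n|e e0].
  by apply: rint_ge0 => x _; exact: rnorm_ge0.
set U := rint D (fun r => rnorm (u r)).
have U0 : 0 <= U by apply: rint_ge0 => x _; exact: rnorm_ge0.
have e2 : 0 < e / 2 by rewrite divr_gt0.
have U1 : 0 < U + 1 by rewrite ltr_wpDl.
have K1 : 0 < K + 1 by rewrite ltr_wpDl.
have [d d0 hd] := uniformly_continuous 0 (@tau R) P_cont (divr_gt0 e2 U1).
have h1 : \forall n \near \oo, n.+1%:R^-1 <= d.
  have /cvgrPdist_le/(_ d d0) := @cvg_harmonic R.
  by apply: filterS => n; rewrite sub0r normrN ger0_norm// invr_ge0.
have h2 : \forall n \near \oo, n.+1%:R^-1 <= e / 2 / (K + 1).
  have /cvgrPdist_le/(_ _ (divr_gt0 e2 K1)) := @cvg_harmonic R.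
  by apply: filterS => n; rewrite sub0r normrN ger0_norm// invr_ge0.
apply: filterS2 h1 h2 => n n1 n2.
apply: (@le_trans _ _ (rint D (fun r => K * rnorm (u r - cstep (q n) r)
    + e / 2 / (U + 1) * rnorm (u r)))).
  apply: le_rint => //; apply: bnd => r Dr.
  have [_ h3] := @mesh_ptP n r Dr.
  apply: hd; last exact: le_trans h3 n1.
  by move: Dr; rewrite /period /= in_itv /= => /andP[? ?]; rewrite !ltW.
have i1 := cintegrable_rnorm mD (diff_int n); have i2 := cintegrable_rnorm mD u_int.
rewrite (rintD mD); [|exact: rintegrableZ..].
rewrite !(rintZ mD)// [leRHS]splitr lerD//.
  apply: le_trans (ler_wpM2l K_ge0 (le_trans (q_approx n) n2)) _.
  rewrite mulrA ler_pdivrMr// mulrC ler_wpM2l ?(ltW e2)//; lra.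
by rewrite mulrAC ler_pdivrMr// ler_wpM2l ?(ltW e2)// lerDl.
Qed.

End Refinement.

Section ScalarLimit.
Variables (P : R -> C) (K : R).
Hypothesis P_cont : ccontinuous P.
Hypothesis P_bound : forall r, 0 <= r <= @tau R -> rnorm (P r) <= K.
Variables (u : R -> C) (q : nat -> seq (set R * C^o)).
Hypothesis u_int : cintegrable D u.
Hypothesis q_within : forall n, within_period (q n).
Hypothesis q_approx : forall n,
  rint D (fun x => rnorm (u x - cstep (q n) x)) <= n.+1%:R^-1.

Lemma scalar_integrand : cintegrable D (fun r => u r * P r).
Proof.
apply: (@cintegrable_le _ _ mD _ (fun r => K * rnorm (u r))).
- apply: cmeasurableM; first exact: cintegrable_cmeasurable u_int.
  exact: ccontinuous_cmeasurable.
- exact/rintegrableZ/cintegrable_rnorm.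
- move=> r; rewrite /period /= in_itv /= => /andP[r0 rt].
  by rewrite rnormM mulrC ler_wpM2r ?rnorm_ge0// P_bound// !ltW.
Qed.

Lemma refine_scalar_cvg :
  rnorm (simple_int (refine (P : R -> C^o) n (q n)) - cint D (fun r => u r * P r))
    @[n --> \oo] --> (0 : R).
Proof.
have tq n := @refine_within C^o P n (q n) (@q_within n).
have sf n := cstep_integral (tq n).
have ip := scalar_integrand.
have id n : cintegrable D (fun r => u r * P r - simple_fun (refine (P : R -> C^o) n (q n)) r).
  by apply: cintegrableB => //; have [] := sf n.
have [||_ c0] := @refine_L1 C^o P K _ P_bound u q u_int q_within q_approx.
- by move=> x; exact/ccontinuous_atP.
- by move=> n; apply: measurable_rnorm; exact: cintegrable_cmeasurable (id n).
apply: (@squeeze_cvgr _ _ _ _ (fun=> 0) _ _ _ _ _ c0); last exact: cvg_cst.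
apply: nearW => n; rewrite rnorm_ge0 /=; have [i1 <-] := sf n.
by rewrite rnorm_distC -(cintB mD)// rnorm_cint.
Qed.

Lemma refine_scalar_bound n :
  rnorm (simple_int (refine (P : R -> C^o) n (q n))) <=
  K * (rint D (fun r => rnorm (u r)) + 1).
Proof.
have tq := @refine_within C^o P n (q n) (@q_within n).
have [i1 <-] := cstep_integral tq; have [i2 _] := cstep_integral (@q_within n).
rewrite (le_trans (rnorm_cint mD i1))//.
have K0 : 0 <= K.
  apply: le_trans (rnorm_ge0 (P 0)) (P_bound _); rewrite lexx /= ltW//.
  exact: tau_gt0.
apply: (@le_trans _ _ (rint D (fun r => K * (rnorm (u r) + rnorm (u r - cstep (q n) r))))).
  have i3 : rintegrable D (fun r => rnorm (u r) + rnorm (u r - cstep (q n) r)).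
    apply: rintegrableD => //; first exact: cintegrable_rnorm.
    by apply: cintegrable_rnorm => //; exact: cintegrableB.
  apply: le_rint => //; [exact: cintegrable_rnorm|exact: rintegrableZ|].
  move=> r Dr.
  have -> : cstep (refine (P : R -> C^o) n (q n)) r = cstep (q n) r * P (mesh_pt n r).
    exact: (refine_fun (P : R -> C^o)).
  rewrite rnormM mulrC ler_pM ?rnorm_ge0//.
    by apply: P_bound; have [] := @mesh_ptP n r Dr.
  rewrite -{1}(subrK (u r) (cstep _ r)) addrC.
  by rewrite (le_trans (rnormD _ _))// rnorm_distC.
have i4 := cintegrable_rnorm mD u_int.
have i5 := cintegrable_rnorm mD (cintegrableB mD u_int i2).
rewrite (rintZ mD); last exact: rintegrableD.
rewrite ler_wpM2l// (rintD mD)// lerD2l (le_trans (q_approx n))//.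
by rewrite invf_le1// ler1n.
Qed.

End ScalarLimit.
End SimpleFunctions.

(** * Bochner integrals along orbits *)

Section L2Norm.
Variable R : realType.
Local Notation C := R[i].
Local Notation mu := (@lebesgue_measure R).

Let L2norm_integral (D : set R) (f : R -> C) : measurable D ->
  (\int[mu]_x (`|((fun x => (rnorm (f x))%:E) \_ D) x| `^ 2))%E =
  (\int[mu]_(x in D) (rnorm (f x) ^+ 2)%:E)%E.
Proof.
move=> mD; rewrite [RHS]integral_mkcond; apply: eq_integral => x _.
rewrite !patchE; case: ifPn => _; last by rewrite abse0 poweR_EFin powR0// pnatr_eq0.
by rewrite gee0_abs ?lee_fin ?rnorm_ge0// poweR_EFin powR_mulrn ?rnorm_ge0.
Qed.

Lemma L2normE (D : set R) (f : R -> C) : measurable D ->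
  rintegrable D (fun x => rnorm (f x) ^+ 2) ->
  L2norm D f = (Num.sqrt (rint D (fun x => rnorm (f x) ^+ 2)))%:E.
Proof.
move=> mD ifx; rewrite /L2norm unlock L2norm_integral// rintE//.
rewrite poweR_EFin powR12_sqrt//.
by apply: rint_ge0 => x _; exact: sqr_ge0.
Qed.

Lemma L2norm_lty (D : set R) (f : R -> C) : measurable D -> cmeasurable D f ->
  (L2norm D f < +oo)%E -> rintegrable D (fun x => rnorm (f x) ^+ 2).
Proof.
move=> mD mf fin.
have mf2 : measurable_fun D (fun x => rnorm (f x) ^+ 2).
  by apply: measurable_funX; exact: measurable_rnorm.
apply/integrableP; split; first exact/measurable_EFinP.
have -> : (\int[mu]_(x in D) `|(rnorm (f x) ^+ 2)%:E|)%E =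
    (\int[mu]_(x in D) (rnorm (f x) ^+ 2)%:E)%E.
  by apply: eq_integral => x _; rewrite gee0_abs// lee_fin sqr_ge0.
rewrite -L2norm_integral// -poweR_Lnorm ?pnatr_eq0//.
by apply: poweR_lty.
Qed.

End L2Norm.

Section ShiftOrbits.
Variable R : realType.
Local Notation C := R[i].
Local Notation P := (L2pre R).
Local Notation H := (completion P).
Local Notation mu := (@lebesgue_measure R).
Local Notation D := (@period R).
Local Notation mD := (@measurable_period R).
Local Notation tau := (@tau R).
#[local] Hint Resolve measurable_period : core.
Implicit Types (F v : H) (m : multiplier R).

Lemma rnorm_exp_semigroup t F : rnorm (exp_semigroup t F) <= expR t * rnorm F.
Proof. by apply: rnorm_mult => w; rewrite /= rnorm_cexp. Qed.

Lemma exp_semigroup_continuous F s : rnorm (exp_semigroup t F - exp_semigroup s F) @[t --> s] --> (0 : R).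
Proof.
apply/(@cvg_nbhsP _ R^o) => u us.
pose v n := Num.min (u n) (s + 1).
have vu : \forall n \near \oo, u n = v n.
  move/cvgrPdist_lt : us => /(_ _ ltr01); apply: filterS => n.
  rewrite distrC => un; rewrite /v minEle ifT//.
  by have := ler_norm (u n - s); lra.
have vs : v @ \oo --> s.
  by apply: cvg_trans us; apply: near_eq_cvg; apply: filterS vu => n ->.
have cv : rnorm (exp_semigroup (v n) F - exp_semigroup s F) @[n --> \oo] --> (0 : R).
  apply: (@mult_cvg _ (fun n => expm (v n)) (expm s) (expR (s + 1))).
  - by move=> n w /=; rewrite rnorm_cexp ler_expR /v ge_min lexx orbT.
  - by move=> w /=; rewrite rnorm_cexp ler_expR lerDl.
  - move=> w /=; have /ccontinuous_atP c := @cexp_contt R w s.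
    exact: (@cvg_comp _ _ _ v (fun t => rnorm (cexp t w - cexp s w)) _ _ _ vs c).
apply: cvg_trans cv; apply: near_eq_cvg.
by apply: filterS vu => n ->.
Qed.

Lemma dot_ccontinuous (X : R -> H) v :
  (forall x, rnorm (X y - X x) @[y --> x] --> (0 : R)) ->
  ccontinuous (fun r => dot (X r) v).
Proof.
move=> cX x; apply/ccontinuous_atP.
apply: (@squeeze_cvgr _ _ _ _ (fun=> 0) (fun y => rnorm (X y - X x) * rnorm v)).
- by apply: nearW => y; rewrite rnorm_ge0 /= -dotBl dot_CS.
- exact: cvg_cst.
- rewrite -[X in _ --> X](mul0r (rnorm v)); apply: cvgM; last exact: cvg_cst.
  exact: cX.
Qed.

Lemma eval_ccontinuous (X : R -> H) (f : P) :
  (forall x, rnorm (X y - X x) @[y --> x] --> (0 : R)) ->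
  ccontinuous (fun r => X r f).
Proof.
move=> cX; have := dot_ccontinuous (emb f) cX.
by under eq_fun do rewrite dot_embr.
Qed.

Lemma dotBZr (F G E : H) a : dot F (G - a *: E) = dot F G - a^* * dot F E.
Proof. by rewrite dot_herm dotBl dotZl rmorphB rmorphM /= -!dot_herm. Qed.

(* Expanding the square of the norm along the list avoids any measurability
   of vector-valued maps. *)
Lemma measurable_error (X : R -> H) (a : R -> C) (s : seq (set R * H)) :
  (forall x, rnorm (X y - X x) @[y --> x] --> (0 : R)) ->
  cmeasurable D a -> within_period s ->
  measurable_fun D (fun r => rnorm (a r *: X r - simple_fun s r)).
Proof.
move=> cX ma ts.
suff [_ [mR _]] : (forall v, cmeasurable D (fun r => dot (a r *: X r - simple_fun s r) v)) /\
    cmeasurable D (fun r => dot (a r *: X r - simple_fun s r) (a r *: X r - simple_fun s r)).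
  have -> : (fun r => rnorm (a r *: X r - simple_fun s r)) =
      Num.sqrt \o (fun r => Re (dot (a r *: X r - simple_fun s r) (a r *: X r - simple_fun s r))).
    by apply/funext => r /=; rewrite dot_self /= sqrtr_sqr ger0_norm// rnorm_ge0.
  apply: measurableT_comp => //.
  by apply: continuous_measurable_fun; exact: sqrt_continuous.
elim: s ts => [_|p s ih /within_period_cons[[mp _] ts]].
  have E r : a r *: X r - simple_fun ([::] : seq (set R * H)) r = a r *: X r.
    by rewrite /simple_fun big_nil subr0.
  split.
    move=> v; under [X in cmeasurable _ X]eq_fun do rewrite E dotZl.
    apply: cmeasurableM => //; apply: ccontinuous_cmeasurable => //.
    exact: dot_ccontinuous.
  under [X in cmeasurable _ X]eq_fun do rewrite E dot_self rnormZ.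
  apply: cmeasurable_real; apply: measurable_funX; apply: measurable_funM.
    exact: measurable_rnorm.
  apply: measurable_funS (@subsetT _ D) _ => //; apply: continuous_measurable_fun => x.
  apply/cvgrPdist_le => e e0.
  move/cvgrPdist_le : (cX x) => /(_ e e0); apply: filterS => y.
  rewrite sub0r normrN ger0_norm ?rnorm_ge0// => h1.
  by rewrite distrC (le_trans (ler_rdist _ _)).
have [ih1 ih2] := ih ts.
have mi : cmeasurable D (fun r => (\1_(p.1) r : R)%:C).
  by apply: cmeasurable_real; exact: indic_measurable.
pose Y r := a r *: X r - simple_fun s r.
have E r : a r *: X r - simple_fun (p :: s) r = Y r - (\1_(p.1) r : R)%:C *: p.2.
  by rewrite /Y [simple_fun (p :: s) r]big_cons opprD addrCA [RHS]addrC.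
have m1 v : cmeasurable D (fun r => dot (a r *: X r - simple_fun (p :: s) r) v).
  under [X in cmeasurable _ X]eq_fun do rewrite E dotBl dotZl.
  exact: (cmeasurableB (ih1 v) (cmeasurableM mi (cmeasurable_cst _ _))).
split; first exact: m1.
have E2 r : dot (Y r - (\1_(p.1) r : R)%:C *: p.2) (Y r - (\1_(p.1) r : R)%:C *: p.2)
   = dot (Y r) (Y r) - (\1_(p.1) r : R)%:C * (dot (Y r) p.2)^*
     - (\1_(p.1) r : R)%:C * dot (Y r - (\1_(p.1) r : R)%:C *: p.2) p.2.
  rewrite dotBZr dotBl dotZl (dot_herm (Y r) p.2); congr (_ - _ * _).
  by apply: complex_ext; rewrite /= ?oppr0.
under [X in cmeasurable _ X]eq_fun do rewrite E E2 -E.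
apply: cmeasurableB; last exact: (cmeasurableM mi (m1 _)).
exact: (cmeasurableB ih2 (cmeasurableM mi (cmeasurableJ (ih1 _)))).
Qed.

(** Simple integrals of orbits are such combinations. The multiplier is chosen
    before the vector on which it acts. *)
Lemma mult_sum (I : Type) (l : seq I) (c : I -> C) (k : I -> multiplier R) :
  exists sigma : multiplier R, (forall w, sigma w = \sum_(x <- l) c x * k x w) /\
    forall F, \sum_(x <- l) c x *: mult (k x) F = mult sigma F.
Proof.
elim: l => [|x l [sigma [sE sF]]].
  exists (cstm 0); split => [w|F]; rewrite big_nil//.
  by rewrite mult_cst scale0r.
exists (linm (c x) (k x) sigma); split => [w|F]; rewrite big_cons; first by rewrite -sE.
by rewrite sF mult_linm.
Qed.

Section Convolution.
Variables (u : R -> C) (hu : sqint u).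

Definition weighted (r : R) : C := u r * (expR (tau - r))%:C.

Lemma expR_weight_cont : continuous (fun r : R => expR (tau - r)).
Proof.
move=> r; apply: (@continuous_comp _ _ _ (fun r : R => tau - r)); last exact: continuous_expR.
by apply: cvgB; [exact: cvg_cst|exact: cvg_id].
Qed.

Lemma weighted_le r : D r -> rnorm (weighted r) <= expR tau * rnorm (u r).
Proof.
rewrite /period /= in_itv /= => /andP[r0 _].
rewrite rnormM rnorm_real ger0_norm ?expR_ge0// mulrC ler_wpM2r ?rnorm_ge0//.
by rewrite ler_expR gerBl ltW.
Qed.

Lemma weighted_sqint : sqint weighted.
Proof.
have mw : cmeasurable D weighted.
  apply: cmeasurableM; first exact: hu.1.
  apply: ccontinuous_cmeasurable => // r; apply: ccontinuous_at_real.
  exact: expR_weight_cont.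
split => //; apply: (@le_rintegrable _ _ mD _ (fun r => expR tau ^+ 2 * rnorm (u r) ^+ 2)).
- by apply: measurable_funX; exact: measurable_rnorm.
- by apply: rintegrableZ => //; exact: hu.2.
- move=> r Dr; rewrite ger0_norm ?sqr_ge0// -exprMn.
  rewrite ler_pXn2r ?nnegrE ?rnorm_ge0 ?mulr_ge0 ?expR_ge0 ?rnorm_ge0//.
  exact: weighted_le.
Qed.

Lemma weighted_rint : rint D (fun r => rnorm (weighted r) ^+ 2) <=
  expR tau ^+ 2 * rint D (fun r => rnorm (u r) ^+ 2).
Proof.
rewrite -(rintZ mD); last exact: hu.2.
apply: le_rint => //; [exact: weighted_sqint.2|exact: (rintegrableZ mD _ hu.2)|].
move=> r Dr; rewrite -exprMn ler_pXn2r ?nnegrE ?rnorm_ge0 ?mulr_ge0 ?expR_ge0 ?rnorm_ge0//.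
exact: weighted_le.
Qed.

(** The symbol of the convolution of u with the semigroup at time tau. *)
Definition conv (w : R) : C := fourier weighted w.

Lemma convE w : conv w = cint D (fun r => u r * cexp (tau - r) w).
Proof.
apply: eq_cint => r _; rewrite /weighted -mulrA; congr (_ * _).
by apply: complex_ext; rewrite ?ReM ?ImM /cexp /=; ring.
Qed.

Lemma conv_bound : exists K : R, forall w, rnorm (conv w) <= K.
Proof.
by exists (rint D (fun r => rnorm (weighted r))) => w; exact: fourier_le weighted_sqint.
Qed.

Definition convm := Multiplier (fourier_cont weighted_sqint) conv_bound.

Lemma conv_L2 : (conv : R -> C^o) \in @L2c_pred R.
Proof.
apply/L2c_predP; split; first exact: fourier_cont weighted_sqint.
by have [] := plancherel_le weighted_sqint.
Qed.

Definition convf : P := L2Fun conv_L2.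

Lemma sn_convf : sn convf <= Num.sqrt tau * expR tau *
  Num.sqrt (rint D (fun r => rnorm (u r) ^+ 2)).
Proof.
have Q0 : 0 <= rint D (fun r => rnorm (u r) ^+ 2).
  by apply: rint_ge0 => r _; exact: sqr_ge0.
have t0 := tau_gt0 R.
rewrite -(@ler_pXn2r _ 2) ?nnegrE ?sn_ge0 ?mulr_ge0 ?sqrtr_ge0 ?expR_ge0//.
rewrite sn_L2 !exprMn !sqr_sqrtr ?(ltW t0)// -mulrA.
have [_ h] := plancherel_le weighted_sqint.
by rewrite (le_trans h)// ler_wpM2l ?(ltW t0)// weighted_rint.
Qed.

Variable q : nat -> seq (set R * C^o).
Hypothesis q_within : forall n, within_period (q n).
Hypothesis q_approx : forall n,
  rint D (fun x => rnorm (u x - cstep (q n) x)) <= n.+1%:R^-1.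

(** The integral of a simple approximation of an orbit is multiplication by the
    same integral for the scalar orbits exp ((tau - r) (1 + iw)). Thus only
    scalar limits and bounded pointwise convergence are needed. *)
Lemma simple_int_cvg F :
  rnorm (simple_int (refine (fun r => exp_semigroup (tau - r) F) n (q n)) - mult convm F)
    @[n --> \oo] --> (0 : R).
Proof.
have iu := sqint_int hu.
have cK r w : 0 <= r <= tau -> rnorm (cexp (tau - r) w) <= expR tau.
  by move=> /andP[r0 _]; rewrite rnorm_cexp ler_expR gerBl.
have cc w : ccontinuous (fun r => cexp (tau - r) w).
  move=> r; have cl : {for r, continuous (fun r : R => tau - r)}.
    by apply: cvgB; [exact: cvg_cst|exact: cvg_id].
  have [c1 c2] := @cexp_contt R w (tau - r).
  split; [exact: (@continuous_comp _ _ _ (fun r : R => tau - r) (fun t => Re (cexp t w)))|].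
  exact: (@continuous_comp _ _ _ (fun r : R => tau - r) (fun t => Im (cexp t w))).
have [sigma hs] := choice (fun n => mult_sum (tagged_refine n (q n))
  (fun x => (fine (mu x.1))%:C * x.2.1) (fun x => expm (tau - x.2.2))).
have sE n w : sigma n w = simple_int (refine (fun r => cexp (tau - r) w : C^o) n (q n)).
  by rewrite refine_int; have [-> _] := hs n.
rewrite (_ : (fun n => _) = (fun n => rnorm (mult (sigma n) F - mult convm F))); last first.
  by apply/funext => n; rewrite refine_int; have [_ ->] := hs n.
set K := expR tau * (rint D (fun r => rnorm (u r)) + 1).
have scal w := @refine_scalar_cvg R (fun r => cexp (tau - r) w) (expR tau) (cc w)
  (fun r => @cK r w) u q iu q_within q_approx.
have bs n w : rnorm (sigma n w) <= K.
  rewrite sE; apply: (@refine_scalar_bound R (fun r => cexp (tau - r) w)) => // r.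
  exact: cK.
apply: (@mult_cvg _ sigma convm K) => // w.
- rewrite (_ : convm w = conv w)// convE.
  apply: (@le_trans _ _ (rint D (fun r => expR tau * rnorm (u r)))).
    have ip := @scalar_integrand R _ _ (cc w) (fun r => @cK r w) u iu.
    rewrite (le_trans (rnorm_cint mD ip))//.
    apply: le_rint => //; first exact: cintegrable_rnorm.
      by apply: rintegrableZ => //; exact: cintegrable_rnorm.
    move=> r; rewrite /period /= in_itv /= => /andP[r0 rt].
    by rewrite rnormM mulrC ler_wpM2r ?rnorm_ge0// cK// !ltW.
  rewrite (rintZ mD); last exact: cintegrable_rnorm.
  by rewrite ler_wpM2l ?expR_ge0// lerDl.
- rewrite (_ : convm w = conv w)// convE.
  by under eq_fun do rewrite sE; exact: scal.
Qed.

End Convolution.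

Lemma reverse_orbit_cont F (x : R) :
  rnorm (exp_semigroup (tau - y) F - exp_semigroup (tau - x) F) @[y --> x] --> (0 : R).
Proof.
have cl : (fun r : R => tau - r) @ x --> tau - x.
  by apply: cvgB; [exact: cvg_cst|exact: cvg_id].
exact: (@cvg_comp _ _ _ (fun r : R => tau - r)
  (fun t => rnorm (exp_semigroup t F - exp_semigroup (tau - x) F)) _ _ _ cl (exp_semigroup_continuous F (tau - x))).
Qed.

Lemma reverse_orbit_bound F r : 0 <= r <= tau ->
  rnorm (exp_semigroup (tau - r) F) <= expR tau * rnorm F.
Proof.
move=> /andP[r0 _]; rewrite (le_trans (rnorm_exp_semigroup _ _))//.
by rewrite ler_wpM2r ?rnorm_ge0// ler_expR gerBl.
Qed.

Lemma approximants (u : R -> C) : sqint u -> exists q : nat -> seq (set R * C^o),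
  (forall n, within_period (q n)) /\
  forall n, rint D (fun x => rnorm (u x - cstep (q n) x)) <= n.+1%:R^-1.
Proof.
move=> hu; have h n : exists s : seq (set R * C^o), within_period s /\
    rint D (fun x => rnorm (u x - cstep s x)) <= n.+1%:R^-1.
  have n0 : 0 < n.+1%:R^-1 :> R by rewrite invr_gt0.
  by have [s ts hs] := simple_approx (sqint_int hu) n0; exists s.
by have [q hq] := choice h; exists q; split => n; have [] := hq n.
Qed.

(** The simple approximations of the orbit converge in L1, so their integrals
    converge to the Bochner integral, and they converge to a multiplication. *)
Lemma bochner_orbit (u : R -> C) (hu : sqint u) F :
  is_bochner_integral D (fun r => u r *: exp_semigroup (tau - r) F) (mult (convm hu) F).
Proof.
have [q [qt qa]] := approximants hu.
pose X r := exp_semigroup (tau - r) F.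
have tq n := @refine_within _ _ X n (q n) (@qt n).
have me n := measurable_error (reverse_orbit_cont F) hu.1 (@tq n).
have [int_n cvg_n] := refine_L1 (reverse_orbit_cont F) (@reverse_orbit_bound F)
  (sqint_int hu) qt qa me.
exists (fun n => refine X n (q n)); split.
- move=> n p pq; have [mp pD] := tq n p pq; split => //.
  exact: period_lty.
- exact: me.
- rewrite (_ : (fun n => _) = (fun n => (rint D (fun r =>
     rnorm (u r *: X r - simple_fun (refine X n (q n)) r)))%:E)); last first.
    by apply/funext => n; rewrite rintE.
  by apply: cvg_EFin => //; exact: nearW.
- exact/rcvgP/simple_int_cvg.
Qed.

End ShiftOrbits.

(** * The realization *)

Section Reflection.
Variable R : realType.

Lemma rint_reflect (h : R -> R) (T : R) : 0 <= T -> continuous h ->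
  rint `[0, T] (fun x => h (T - x)) = rint `[0, T] h.
Proof.
move=> T0 ch; pose F x := T - x : R.
have dF (x : R) : is_derive x (1 : R) F (-1).
  by apply: is_derive_eq; rewrite /GRing.scale /=; ring.
have F1 : derive1 F = fun=> -1.
  by apply/funext => x; rewrite derive1E; have [_ ->] := dF x.
have cF : continuous F by move=> x; apply: cvgB; [exact: cvg_cst|exact: cvg_id].
have <- : `[F T, F 0]%classic = `[0, T]%classic.
  by rewrite /F subrr subr0.
rewrite {2}/rint /Rintegral (@integration_by_substitution_decreasing _ F h 0 T)//.
- have <- : `[0, T]%classic = `[F T, F 0]%classic by rewrite /F subrr subr0.
  by congr fine; apply: eq_integral => x _; rewrite /= F1 /= opprK mulr1.
- by move=> x y _ _ xy; rewrite /F ltrD2l ltrN2.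
- by rewrite F1 => x _; exact: cvg_cst.
- by rewrite F1; apply/cvg_ex; exists (-1); exact: cvg_cst.
- by rewrite F1; apply/cvg_ex; exists (-1); exact: cvg_cst.
- split; first by move=> x _; have [] := dF x.
  + by apply: cvg_at_right_filter; exact: cF.
  + by apply: cvg_at_left_filter; exact: cF.
- exact: continuous_subspaceT.
Qed.

End Reflection.

Section Realization.
Variable R : realType.
Local Notation C := R[i].
Local Notation P := (L2pre R).
Local Notation H := (completion P).
Local Notation D := (@period R).
Local Notation mD := (@measurable_period R).
Local Notation tau := (@tau R).
#[local] Hint Resolve measurable_period : core.

Variables (G : C -> C) (M : R).
Hypothesis dG : forall z, 0 < Re z -> derivable (G : C^o -> C^o) z 1.
Hypothesis bG : forall z, 0 < Re z -> rnorm (G z) <= M.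

Lemma bound_ge0 : 0 <= M.
Proof. by rewrite (le_trans _ (@bG 1 _))//= ?rnorm_ge0// ltr01. Qed.

Lemma symbol_le w : rnorm (G (line w)) <= M.
Proof. exact: bG. Qed.

Definition symbol := Multiplier (G_line_ccontinuous dG) (ex_intro _ M symbol_le).

Lemma kernel_L2 : ((fun w => (2 - line w)^-1) : R -> C^o) \in @L2c_pred R.
Proof.
apply/L2c_predP; split; first exact: resm_cont (@beta1 R).
have R2 : `|1 - Re (2 : C)| = 1.
  by rewrite ReD /= opprD addrA subrr sub0r normrN normr1.
have [h _] := @poisson_integral R 1 (Im (2 : C)) ltr01.
apply: (@le_rintegrable _ _ (@measurable_line R) _ _ _ h).
  apply: ccontinuous_rnorm2; exact: resm_cont (@beta1 R).
move=> w _; rewrite ger0_norm ?sqr_ge0// rnormV exprVn rnorm_distC.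
by rewrite rnorm_line R2.
Qed.

(** The function 1 / (2 - a), a = 1 + iw: the decay that makes the input and
    output vectors square integrable. *)
Definition kernel : P := L2Fun kernel_L2.

Lemma kernelJ_L2 : ((fun w => ((2 - line w)^-1)^*) : R -> C^o) \in @L2c_pred R.
Proof.
apply/L2c_predP; have /L2c_predP[c i] := kernel_L2; split.
  by move=> w; apply: ccontinuous_atJ; exact: c.
by under [X in rintegrable _ X]eq_fun do rewrite rnormJ.
Qed.

(** The complex conjugate compensates the one in the inner product. *)
Definition output_vec : P := (tau^-1)%:C *: (L2Fun kernelJ_L2 : P).

Definition input_vec : H := emb (mulm symbol kernel).

(** Pairing of (2 - A) x with a vector: continuous for the graph norm. *)
Definition obs (x : H) : C := (2 *: x - generator (@exp_semigroup R) x) output_vec.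

Lemma obs_resm F : obs (mult (resm (@beta1 R)) F) = F output_vec.
Proof. by rewrite /obs; have [_ ->] := resolvent_resm (@beta1 R) F. Qed.

Lemma dom_resm x : generator_dom (@exp_semigroup R) x ->
  x = mult (resm (@beta1 R)) (2 *: x - generator (@exp_semigroup R) x).
Proof. by move=> dx; rewrite resm_left. Qed.

Lemma obs_H1 : H1_functional (@exp_semigroup R) 2 obs.
Proof.
split.
  move=> a x y dx dy; set X := 2 *: x - generator (@exp_semigroup R) x.
  set Y := 2 *: y - generator (@exp_semigroup R) y.
  rewrite {1}(dom_resm dx) {1}(dom_resm dy) -linearP obs_resm.
  by rewrite cvalD cvalZ.
exists (sn output_vec) => x _; rewrite mulrC; exact: rnormP.
Qed.

(** The input is mapped to G times conv u, whose norm Plancherel's theorem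
    controls; the factor 1 / (2 - a) of the input vector is absorbed by the
    embedding into H_{-1}. *)
Lemma control_admissible : admissible_control (@embm1 R) (@exp_semigroup R) input_vec.
Proof.
exists tau; split; first exact: tau_gt0.
exists (M * (Num.sqrt tau * expR tau)) => u [mR mI fin].
have mu_ : cmeasurable `]0, +oo[ u by [].
have iu := L2norm_lty (measurable_itv _) mu_ fin.
have sub : D `<=` `]0, +oo[.
  by move=> r; rewrite /period /= !in_itv /= andbT => /andP[].
have hu : sqint u.
  split; first by split; apply: measurable_funS sub _ => //.
  by apply: rintegrableS iu.
exists (emb (mulm symbol (convf hu))); split.
  have -> : (fun r => u r *: semigroup_m1 (@embm1 R) (@exp_semigroup R) (tau - r) input_vec) =
      (fun r => u r *: exp_semigroup (tau - r) input_vec).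
    by apply/funext => r; rewrite semigroup_m1E.
  have -> : embm1 R (emb (mulm symbol (convf hu))) = mult (convm hu) input_vec.
    rewrite /embm1 /input_vec !mult_emb; congr emb; apply: L2fun_ext => w.
    rewrite -[LHS]/((2 - line w)^-1 * (G (line w) * conv u w)).
    rewrite -[RHS]/(conv u w * (G (line w) * (2 - line w)^-1)).
    by rewrite mulrC -mulrA mulrCA.
  exact: bochner_orbit.
rewrite L2normE// -EFinM lee_fin rnorm_emb.
apply: le_trans (@sn_mulm _ symbol (convf hu) M symbol_le) _.
rewrite -!mulrA ler_wpM2l ?bound_ge0// mulrA.
apply: le_trans (sn_convf hu) _; rewrite ler_wpM2l ?mulr_ge0 ?sqrtr_ge0 ?expR_ge0//.
rewrite ler_wsqrtr//; apply: le_rint_set => //.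
by move=> x _; exact: sqr_ge0.
Qed.

Lemma sqint_continuous (u : R -> C) : ccontinuous u -> sqint u.
Proof.
move=> cu; split; first exact: ccontinuous_cmeasurable.
by have [] := cont_period (continuous_rnorm2 cu).
Qed.

(** A functional may be exchanged with the integral along an orbit: both sides
    are limits of the same simple integrals. *)
Lemma orbit_pairing (u : R -> C) (hu : sqint u) F (f : P) :
  (mult (convm hu) F) f = cint D (fun r => u r * (exp_semigroup (tau - r) F) f).
Proof.
have [q [qt qa]] := approximants hu.
pose p r := (exp_semigroup (tau - r) F) f.
have cp : ccontinuous p by apply: eval_ccontinuous => x; exact: reverse_orbit_cont.
have bp r : 0 <= r <= tau -> rnorm (p r) <= expR tau * rnorm F * sn f.
  move=> hr; rewrite (le_trans (rnormP _ _))// ler_wpM2r ?sn_ge0//.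
  exact: reverse_orbit_bound.
have c1 := refine_scalar_cvg cp bp (sqint_int hu) qt qa.
have c2 := simple_int_cvg hu qt qa F.
have ev n : simple_int (refine (p : R -> C^o) n (q n)) =
    (simple_int (refine (fun r => exp_semigroup (tau - r) F) n (q n))) f.
  rewrite !refine_int.
  elim: (tagged_refine n (q n)) => [|x l ih]; first by rewrite !big_nil.
  by rewrite !big_cons cvalD cvalZ -ih.
apply/eqP; rewrite -subr_eq0; apply/eqP/rnorm_eq0.
have c3 : rnorm ((mult (convm hu) F) f - cint D (fun r => u r * p r)) @[n --> \oo] --> (0 : R).
  have c4 : rnorm (simple_int (refine (fun r => exp_semigroup (tau - r) F) n (q n)) - mult (convm hu) F) * sn f
     + rnorm (simple_int (refine (p : R -> C^o) n (q n)) - cint D (fun r => u r * p r))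
     @[n --> \oo] --> (0 : R).
    rewrite -[X in _ --> X](addr0 0) -[X in X + _](mul0r (sn f)).
    by apply: cvgD => //; apply: cvgM => //; exact: cvg_cst.
  apply: (@squeeze_cvgr _ _ _ _ (fun=> 0) _ _ _ _ _ c4); last exact: cvg_cst.
  apply: nearW => n; rewrite rnorm_ge0 andTb.
  apply: le_trans (ler_rnormBD _ (simple_int (refine (p : R -> C^o) n (q n))) _) _.
  by rewrite lerD2r rnorm_distC ev -cvalB rnormP.
by apply: cvg_unique c3; first exact: Rhausdorff; exact: cvg_cst.
Qed.

(** Duality: the squared norm Q of the output is its pairing with an input u,
    namely its own time reversal and conjugate. By orbit_pairing this is a
    pairing of the state with conv u, hence at most a multiple of the norm of
    the state times the square root of Q. *)
Lemma observation_bound y :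
  Num.sqrt (rint D (fun r => rnorm ((exp_semigroup r y) output_vec) ^+ 2)) <=
  tau^-1 * (Num.sqrt tau * expR tau) * rnorm (mult (resm (@beta1 R)) y).
Proof.
pose g r := (exp_semigroup r y) output_vec.
have cg : ccontinuous g by apply: eval_ccontinuous => x; exact: exp_semigroup_continuous.
have cg2 := continuous_rnorm2 cg.
pose u r := (g (tau - r))^*.
have cu : ccontinuous u.
  move=> r; apply: ccontinuous_atJ.
  by apply: (eval_ccontinuous (X := fun r => exp_semigroup (tau - r) y)) => x; exact: reverse_orbit_cont.
have hu := sqint_continuous cu.
pose Q := rint D (fun r => rnorm (g r) ^+ 2).
change (Num.sqrt Q <= tau^-1 * (Num.sqrt tau * expR tau) * rnorm (mult (resm (@beta1 R)) y)).
have QE : rint D (fun r => rnorm (u r) ^+ 2) = Q.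
  have [_ e1] := cont_period cg2; rewrite /Q e1.
  have [_ ->] := cont_period (continuous_rnorm2 cu).
  rewrite -(rint_reflect (ltW (@tau_gt0 R)) cg2).
  by apply: eq_rint => r _; rewrite /u rnormJ.
have Q0 : 0 <= Q by apply: rint_ge0 => r _; exact: sqr_ge0.
have pair : (mult (convm hu) y) output_vec = Q%:C.
  rewrite orbit_pairing -QE -(cint_real mD); apply: eq_cint => r _.
  by rewrite mulrC /u rnormJ -mulcJ.
have JL2 : ((fun w => (conv u w)^*) : R -> C^o) \in @L2c_pred R.
  apply/L2c_predP; have /L2c_predP[c i] := conv_L2 hu; split.
    by move=> w; apply: ccontinuous_atJ; exact: c.
  by under [X in rintegrable _ X]eq_fun do rewrite rnormJ.
pose uJ : P := L2Fun JL2.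
have move_ : (mult (convm hu) y) output_vec =
    (tau^-1)%:C * (mult (resm (@beta1 R)) y) uJ.
  rewrite !multE.
  have -> : mulm (conjm (convm hu)) output_vec = (tau^-1)%:C *: mulm (conjm (resm (@beta1 R))) uJ.
    apply: L2fun_ext => w.
    rewrite -[RHS]/((tau^-1)%:C * (((2 - line w)^-1)^* * (conv u w)^*)).
    by rewrite mulmE -[output_vec w]/((tau^-1)%:C * ((2 - line w)^-1)^*) /= mulrCA [X in _ * X]mulrC.
  by rewrite cvalZ_arg; congr (_ * _); apply: complex_ext; rewrite /= ?oppr0.
have t0 := @tau_gt0 R.
have bnd : Q <= tau^-1 * (rnorm (mult (resm (@beta1 R)) y) *
    (Num.sqrt tau * expR tau * Num.sqrt Q)).
  have e : rnorm (Q%:C : C) = Q by rewrite rnorm_real ger0_norm.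
  have e' : rnorm ((tau^-1)%:C : C) = tau^-1.
    by rewrite rnorm_real ger0_norm// invr_ge0 ltW.
  rewrite -[leLHS]e -pair move_ rnormM e'.
  rewrite ler_wpM2l ?invr_ge0 ?(ltW t0)// (le_trans (rnormP _ _))// ler_wpM2l ?rnorm_ge0//.
  have -> : sn uJ = sn (convf hu).
    apply/eqP; rewrite -(@eqrXn2 _ 2) ?sn_ge0//; apply/eqP; rewrite !sn_L2.
    by apply: eq_rint => w _; congr (_ ^+ 2); exact: rnormJ.
  by rewrite (le_trans (sn_convf hu))// QE.
have [sQ|sQ] := eqVneq (Num.sqrt Q) 0.
  by rewrite sQ !mulr_ge0 ?invr_ge0 ?(ltW t0) ?sqrtr_ge0 ?expR_ge0 ?rnorm_ge0.
have sQ0 : 0 < Num.sqrt Q by rewrite lt_def sQ sqrtr_ge0.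
rewrite -(ler_pM2r sQ0) -expr2 sqr_sqrtr// (le_trans bnd)//.
by rewrite le_eqVlt; apply/orP; left; apply/eqP; ring.
Qed.

Lemma observation_admissible : admissible_observation (@exp_semigroup R) obs.
Proof.
exists tau; split; first exact: tau_gt0.
have t0 := @tau_gt0 R.
exists (tau^-1 * (Num.sqrt tau * expR tau)); split.
  by rewrite !mulr_gt0 ?invr_gt0 ?sqrtr_gt0 ?expR_gt0.
move=> x dx; set y := 2 *: x - generator (@exp_semigroup R) x.
have xE : x = mult (resm (@beta1 R)) y by exact: dom_resm.
have oE : (fun r => obs (exp_semigroup r x)) = (fun r => (exp_semigroup r y) output_vec).
  by apply/funext => r; rewrite xE /exp_semigroup mult_commute obs_resm.
rewrite oE L2normE//; first by rewrite lee_fin {1}xE; exact: observation_bound.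
have cg : ccontinuous (fun r => (exp_semigroup r y) output_vec).
  by apply: eval_ccontinuous => z; exact: exp_semigroup_continuous.
exact: (sqint_continuous cg).2.
Qed.

Let conj_scaled (t : R) (x : C) : (t%:C * x^*)^* = t%:C * x.
Proof. by apply: complex_ext; rewrite !(ReJ, ImJ, ReM, ImM) /=; ring. Qed.

Let cancel_kernel (p q t g c : C) : p != 0 -> q != 0 -> t != 0 ->
  p / q * (p / t * (g * p^-1)) * (c * p^-1) = c * (g / (q * t)).
Proof. by move=> p0 q0 t0; field; rewrite p0 q0 t0. Qed.

(** Both resolvents act as multiplications, so that the right-hand side is an
    integral of G (a) / ((s - a) (z - a)) over the line. *)
Lemma obs_resolvent s z : 2 < Re s -> 2 < Re z -> s != z ->
  (G s - G z) / (z - s) =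
  obs (resolvent (@exp_semigroup R) s (resolvent_m1 (@embm1 R) (@exp_semigroup R) z input_vec)).
Proof.
move=> s2 z2 sz.
have s1 : 1 < Re s by lra.
have z1 : 1 < Re z by lra.
rewrite (resolvent_m1E z1) (resolventE s1); set Y := mult _ input_vec.
have -> : obs (mult (resm s1) Y) = (mult (resm1 s1) Y) output_vec.
  rewrite /obs (generator_resm s1); congr (cval _ _).
  by rewrite mult_linm mult_cst scale1r scalerBl opprB addrA addrAC.
rewrite /Y /input_vec !mult_emb embE.
have t0 := @tau_gt0 R.
have -> : form (mulm (resm1 s1) (mulm (resm1 z1) (mulm symbol kernel))) output_vec =
   cint setT (fun w => (tau^-1)%:C * (G (line w) / ((s - line w) * (z - line w)))).
  apply: eq_cint => w _; rewrite !mulmE.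
  have -> : (output_vec w)^* = (tau^-1)%:C * (2 - line w)^-1 by exact: conj_scaled.
  have n2 := line_far_neq0 (@beta1 R) w.
  have ns := line_far_neq0 s1 w; have nz := line_far_neq0 z1 w.
  rewrite resm1E resm1E -[LHS]/((2 - line w) / (s - line w) * ((2 - line w) / (z - line w)
    * (G (line w) * (2 - line w)^-1)) * ((tau^-1)%:C * (2 - line w)^-1)).
  exact: cancel_kernel.
rewrite (cintZ (@measurable_line R)); last first.
  have fM w : rnorm (G (line w)) <= M by exact: symbol_le.
  have s1' : Re s != 1 by apply/eqP; lra.
  have z1' : Re z != 1 by apply/eqP; lra.
  have := cintegrable_line2 s1' z1' 
    (ccontinuous_cmeasurable (@measurable_line R) (G_line_ccontinuous dG)) fM.
  apply: (eq_cintegrable (@measurable_line R)) => w _; congr (_ / _); ring.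
rewrite (cauchy_line dG bG s2 z2 sz) mulrA -rmorphM.
by rewrite -/(tau) mulVf ?gt_eqF// mul1r.
Qed.

End Realization.

Theorem theorem2p6 (R : realType) (G : R[i] -> R[i])
    (hG : Hinfty (half_plane (0 : R)%R) G) :
  exists (H : completeNormedModType R[i]) (T : R -> {linear H -> H})
         (beta : R[i]) (Hm1 : completeNormedModType R[i])
         (iota : {linear H -> Hm1}) (B : Hm1) (C : H -> R[i]),
    well_posed_linear_system T beta iota B C G.
Proof.
have [dG [M bG]] := hG.
exists (completion (L2pre R)), (@exp_semigroup R), 2, (completion (L2pre R)), (@embm1 R).
exists (input_vec dG bG), (@obs R); split.
- split; [exact: completion_hilbert|exact: completion_separable|exact: exp_semigroup_C0].
- by split; [exact: (resolvent_setP (@beta1 R))|exact: embm1_Hm1].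
- exact: control_admissible.
- by split; [exact: obs_H1|exact: observation_admissible].
- exists 2; split; first by [].
  have half0 z : half_plane 2 z -> 0 < Re z by exact: lt_trans.
  split.
  + by move=> z z2; apply: resolvent_setP; apply: lt_trans z2; rewrite ltr1n.
  + by split=> [z /half0/dG//|]; exists M => z /half0/bG.
  + by move=> s z s2 z2; exact: obs_resolvent.
Qed.
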